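(* Let $m>1$, let $N=2$ or $N=3$, and let $\sigma_c=\frac{2(N-1)(m-1)}{3m+1}$. Then for every $\sigma\in[0,\sigma_c]$ there exist good profiles with interface for the differential equation $$(f^m)''(\xi)+\frac{N-1}{\xi}(f^m)'(\xi)-\frac{1}{m-1}f(\xi)+\xi^{\sigma}f^m(\xi)=0,\qquad \xi\ge 0,$$ and all these good profiles with interface satisfy (P1), that is, $f(0)=A>0$ and $f'(0)=0$.
   Context: The equation is the one satisfied by the profiles $f\ge 0$ of separate variable solutions $u(x,t)=(T-t)^{-1/(m-1)}f(|x|)$ of $\partial_t u=\Delta u^m+|x|^\sigma u^m$ in $\mathbb{R}^N$. A nonnegative solution $f$ of the differential equation is a \emph{good profile} if it satisfies one of the following: (P1) $f(0)=a>0$ and $f'(0)=0$; (P2) $f(0)=0$ and $(f^m)'(0)=0$; (P3) there exists $\xi_0\in(0,\infty)$ such that $f(\xi_0)=0$, $(f^m)'(\xi_0)=0$ and $f(\xi)>0$ in a right-neighborhood of $\xi_0$. A good profile $f$ is a \emph{good profile with interface} at $\eta\in(0,\infty)$ if $f(\eta)=0$, $(f^m)'(\eta)=0$ and $f(\xi)>0$ in a left-neighborhood of $\eta$. Convention: a profile with interface is positive on the whole open interval between its starting point ($0$ in cases (P1), (P2); $\xi_0$ in case (P3)) and the interface point $\eta$. *)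

(* Defs.v *)
From Stdlib Require Import Reals.
From Coquelicot Require Import Coquelicot.
Open Scope R_scope.

(* [f^m] for a nonnegative [f] and [m > 0]. [Rpower] alone cannot be used here:
   [ln 0 = 0] in the standard library, hence [Rpower 0 m = 1]. *)
Definition fpow (m : R) (f : R -> R) (xi : R) : R :=
  if Rlt_dec 0 (f xi) then Rpower (f xi) m else 0.

Definition is_right_derive (g : R -> R) (x l : R) : Prop :=
  filterlim (fun y => (g y - g x) / (y - x)) (at_right x) (locally l).

(* A profile is a function on [0, oo); its values on negative numbers are
   junk and are never used. Since [1 / xi] is singular at [0], the equation is
   required for [xi > 0], the behaviour at [0] being the object of P1 and P2.
   The equation is satisfied classically also where [f = 0]: in terms of
   [w = f^m] it says that [w''] is a continuous expression in [xi], [w], [w'],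
   so a piece of solution reaching [w = w' = 0] can be continued by zero. *)
Definition nonneg_solution (N : nat) (m sigma : R) (f : R -> R) : Prop :=
  (forall xi, 0 <= xi -> 0 <= f xi) /\
  (forall xi, 0 < xi ->
     ex_derive (fpow m f) xi /\
     ex_derive (Derive (fpow m f)) xi /\
     Derive (Derive (fpow m f)) xi
       + (INR N - 1) / xi * Derive (fpow m f) xi
       - 1 / (m - 1) * f xi
       + Rpower xi sigma * fpow m f xi = 0).

Definition P1 (f : R -> R) : Prop :=
  0 < f 0 /\ is_right_derive f 0 0.

Definition P2 (m : R) (f : R -> R) : Prop :=
  f 0 = 0 /\ is_right_derive (fpow m f) 0 0.

Definition P3 (m : R) (f : R -> R) (xi0 : R) : Prop :=
  0 < xi0 /\ f xi0 = 0 /\ is_derive (fpow m f) xi0 0 /\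
  at_right xi0 (fun xi => 0 < f xi).

(* [s] is the starting point of the profile. *)
Definition good_profile (N : nat) (m sigma : R) (f : R -> R) (s : R) : Prop :=
  nonneg_solution N m sigma f /\
  ((s = 0 /\ P1 f) \/ (s = 0 /\ P2 m f) \/ P3 m f s).

Definition interface_at (m : R) (f : R -> R) (eta : R) : Prop :=
  0 < eta /\ f eta = 0 /\ is_derive (fpow m f) eta 0 /\
  at_left eta (fun xi => 0 < f xi).

Definition good_profile_with_interface
    (N : nat) (m sigma : R) (f : R -> R) (s eta : R) : Prop :=
  good_profile N m sigma f s /\ interface_at m f eta /\
  s < eta /\ (forall xi, s < xi < eta -> 0 < f xi).

Definition sigma_c (N : nat) (m : R) : R :=
  2 * (INR N - 1) * (m - 1) / (3 * m + 1).

(* Main.v *)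
Require Import Defs.
From Stdlib Require Import Reals Lra Lia Psatz Classical ClassicalEpsilon Ranalysis5.
From Coquelicot Require Import Coquelicot.
Open Scope R_scope.

(** For [w = f ^ m], [p = 1 / m] and [nu = N - 1] the change of unknown
    [v = x ^ k w], [k = 2 nu / (3 + p)], in the time [tau] with
    [dtau = x ^ (sigma_c / 2) dx], turns the equation into the undamped oscillator
    [v'' = c v ^ p - G v], where
    [G = x ^ (sigma - sigma_c) + k (k + 1 - nu) x ^ (- sigma_c - 2)].
    For [sigma <= sigma_c] and [nu = 1, 2] the potential [G] decreases, so the energy
    [v'^2 / 2 + G v^2 / 2 - c v^(p+1) / (p + 1)] decreases strictly. It vanishes at an
    interface, and also at the starting point of a profile of type P2 or P3, which rules
    these out.

    Existence is by shooting in the family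
    [w'' + nu / x w' = th w ^ p - (1 - th) x ^ sigma w], [w(0) = 1], [w'(0) = 0], which for
    [0 < th < 1] is the original equation up to scaling, while [th = 0] is linear and [th = 1]
    has no reaction. A solution whose energy becomes negative never vanishes. This happens
    for [th = 1] and not for [th = 0]; let [th] be the infimum of the parameters for which it
    happens. There the energy stays nonnegative, and then [r = v' / v] satisfies
    [r' <= - (1 - p) / 2 (r^2 + G)], so that [w] dies in finite time. A positive energy at that
    moment would persist for nearby parameters, so the energy is zero there, i.e. [w = w' = 0]. *)

(** * Calculus on the real line *)

(** The power [p < 1] is not Lipschitz at [0]: solutions depend continuously on parameters only
    while they stay away from [0], and the moment of vanishing is out of reach. Nearby solutions are
    therefore compared at an earlier point only. An a priori estimate covers the rest: once [v] is
    small and [v'] is negative and bounded away from [0], the Riccati inequality bounds the time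
    left with nonnegative energy, hence the energy lost meanwhile. The singular term [nu / x w'] is
    handled by integrating [(x ^ nu w')']; in differences of solutions it has a favourable sign. The
    bound [nu <= 2] makes [k (k + 1 - nu)] positive, and [sigma <= sigma_c] makes the first exponent
    of [G] nonpositive. Shooting in [th] instead of the height [w(0)] replaces the limits of large
    and small height by two equations that can be treated directly. The endpoint [th = 0] must still
    be excluded as the infimum, because scaling back divides by [th]: there [x ^ (sigma_c + 2)]
    times the energy is nondecreasing, so the energy cannot tend to [0] in finite time. *)

Lemma is_derive_eq (f : R -> R) (x a b : R) :
  is_derive f x a -> a = b -> is_derive f x b.
Proof. intros H <-. exact H. Qed.

Lemma is_derive_Rconst (c x : R) : is_derive (fun _ : R => c) x 0.
Proof. exact (is_derive_const (K:=R_AbsRing) (V:=R_NormedModule) c x). Qed.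

Lemma is_derive_Rplus (f g : R -> R) (x a b : R) :
  is_derive f x a -> is_derive g x b -> is_derive (fun t => f t + g t) x (a + b).
Proof. exact (is_derive_plus (K:=R_AbsRing) (V:=R_NormedModule) f g x a b). Qed.

Lemma is_derive_Rminus (f g : R -> R) (x a b : R) :
  is_derive f x a -> is_derive g x b -> is_derive (fun t => f t - g t) x (a - b).
Proof. exact (is_derive_minus (K:=R_AbsRing) (V:=R_NormedModule) f g x a b). Qed.

Lemma is_derive_Rmult (f g : R -> R) (x a b : R) :
  is_derive f x a -> is_derive g x b ->
  is_derive (fun t => f t * g t) x (a * g x + f x * b).
Proof.
intros Hf Hg. exact (is_derive_mult (K:=R_AbsRing) f g x a b Hf Hg Rmult_comm).
Qed.

Lemma is_derive_Rscal (f : R -> R) (x a c : R) :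
  is_derive f x a -> is_derive (fun t => c * f t) x (c * a).
Proof. exact (is_derive_scal f x c a). Qed.

Lemma is_derive_Rdiv (f g : R -> R) (x a b : R) :
  is_derive f x a -> is_derive g x b -> g x <> 0 ->
  is_derive (fun t => f t / g t) x ((a * g x - f x * b) / (g x * g x)).
Proof.
intros Hf Hg Hx. eapply is_derive_eq.
- exact (is_derive_div f g x a b Hf Hg Hx).
- simpl. field. exact Hx.
Qed.

Lemma is_derive_Rcomp (f g : R -> R) (x a b : R) :
  is_derive f (g x) a -> is_derive g x b -> is_derive (fun t => f (g t)) x (b * a).
Proof. exact (is_derive_comp (K:=R_AbsRing) (V:=R_NormedModule) f g x a b). Qed.

Lemma is_derive_Rpower (a x : R) :
  0 < x -> is_derive (fun t => Rpower t a) x (a * (Rpower x a / x)).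
Proof.
intros Hx. eapply is_derive_eq.
- apply is_derive_Reals, derivable_pt_lim_power; trivial.
- unfold Rminus. rewrite Rpower_plus, Rpower_Ropp, Rpower_1 by trivial. reflexivity.
Qed.

Lemma is_derive_continuous (f : R -> R) (x a : R) : is_derive f x a -> continuous f x.
Proof. intros H. apply (ex_derive_continuous f). exists a; exact H. Qed.

Lemma continuous_Rplus (f g : R -> R) (x : R) :
  continuous f x -> continuous g x -> continuous (fun t => f t + g t) x.
Proof. exact (continuous_plus f g x). Qed.

Lemma continuous_Rminus (f g : R -> R) (x : R) :
  continuous f x -> continuous g x -> continuous (fun t => f t - g t) x.
Proof. exact (continuous_minus f g x). Qed.

Lemma continuous_Rmult (f g : R -> R) (x : R) :
  continuous f x -> continuous g x -> continuous (fun t => f t * g t) x.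
Proof. exact (continuous_mult f g x). Qed.

Lemma Rpower_pos (x a : R) : 0 < Rpower x a.
Proof. apply exp_pos. Qed.

Lemma locally_between (P : R -> Prop) (a b x : R) :
  a < x < b -> (forall t, a < t < b -> P t) -> locally x P.
Proof.
intros Hx HP.
assert (H1 : locally x (fun t => a < t)) by (apply open_gt; lra).
assert (H2 : locally x (fun t => t < b)) by (apply open_lt; lra).
generalize (filter_and _ _ H1 H2). apply filter_imp. intros t Ht. apply HP; trivial.
Qed.

Lemma continuous_epsilon (f : R -> R) (x eps : R) :
  continuous f x -> 0 < eps ->
  exists del, 0 < del /\ forall t, Rabs (t - x) < del -> Rabs (f t - f x) < eps.
Proof.
intros Hc He.
destruct ((proj1 (filterlim_locally _ _) Hc) (mkposreal eps He)) as [d Hd].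
exists d. split; [apply cond_pos|]. intros t Ht. exact (Hd t Ht).
Qed.

Lemma mean_value (f df : R -> R) (a b : R) :
  a < b -> (forall x, a <= x <= b -> continuous f x) ->
  (forall x, a < x < b -> is_derive f x (df x)) ->
  exists c, a < c < b /\ f b - f a = df c * (b - a).
Proof.
intros Hab Hc Hd.
assert (pr : forall c, a < c < b -> derivable_pt f c).
{ intros c Hx. exists (df c). apply is_derive_Reals, Hd, Hx. }
destruct (MVT f id a b pr (fun c _ => derivable_pt_id c) Hab) as [c [P Hm]].
- intros c Hx. apply continuity_pt_filterlim, Hc, Hx.
- intros c _. apply derivable_continuous_pt, derivable_pt_id.
- exists c. split; trivial.
  replace (df c) with (derive_pt f c (pr c P)).
  2:{ apply derive_pt_eq_0, is_derive_Reals, Hd, P. }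
  rewrite derive_pt_id in Hm. unfold id in Hm. rewrite Rmult_1_r in Hm. rewrite <- Hm. ring.
Qed.

Lemma decreasing_on (f df : R -> R) (a b : R) :
  a <= b -> (forall x, a <= x <= b -> continuous f x) ->
  (forall x, a < x < b -> is_derive f x (df x)) ->
  (forall x, a < x < b -> df x <= 0) -> f b <= f a.
Proof.
intros Hab Hc Hd Hn. destruct Hab as [Hab| ->]; [|lra].
destruct (mean_value f df a b Hab Hc Hd) as [c [Hx He]].
specialize (Hn c Hx). nra.
Qed.

Lemma strictly_decreasing_on (f df : R -> R) (a b : R) :
  a < b -> (forall x, a <= x <= b -> continuous f x) ->
  (forall x, a < x < b -> is_derive f x (df x)) ->
  (forall x, a < x < b -> df x < 0) -> f b < f a.
Proof.
intros Hab Hc Hd Hn.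
destruct (mean_value f df a b Hab Hc Hd) as [c [Hx He]].
specialize (Hn c Hx). nra.
Qed.

Lemma zero_between (f : R -> R) (a b : R) :
  a < b -> (forall x, a <= x <= b -> continuous f x) -> 0 < f a -> f b < 0 ->
  exists z, a < z < b /\ f z = 0.
Proof.
intros Hab Hc Ha Hb.
destruct (IVT_interv (fun t => - f t) a b) as [z [Hz He]]; try lra.
{ intros c Hx. apply continuity_pt_opp, continuity_pt_filterlim, Hc, Hx. }
exists z. split; [|lra].
destruct Hz as [[H1|H1] [H2|H2]]; subst; lra.
Qed.

Lemma positive_min (f : R -> R) (a b : R) :
  a <= b -> (forall x, a <= x <= b -> continuous f x) ->
  (forall x, a <= x <= b -> 0 < f x) ->
  exists e, 0 < e /\ forall x, a <= x <= b -> e <= f x.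
Proof.
intros Hab Hc Hp.
destruct (continuity_ab_min f a b Hab) as [z [Hz Hi]].
{ intros c Hx. apply continuity_pt_filterlim, Hc, Hx. }
exists (f z). split; auto.
Qed.

Lemma bounded_on (f : R -> R) (a b : R) :
  a <= b -> (forall x, a <= x <= b -> continuous f x) ->
  exists B, 0 < B /\ forall x, a <= x <= b -> Rabs (f x) <= B.
Proof.
intros Hab Hc.
destruct (continuity_ab_maj (fun t => Rabs (f t)) a b Hab) as [z [Hz Hi]].
{ intros c Hx. apply (continuity_pt_comp f Rabs).
  apply continuity_pt_filterlim, Hc, Hx. apply Rcontinuity_abs. }
exists (Rabs (f z) + 1). split. { pose proof (Rabs_pos (f z)); lra. }
intros x Hx. specialize (Hz x Hx). lra.
Qed.

Lemma half_pow_small (B eps : R) :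
  0 < eps -> exists k0 : nat, forall k, (k0 <= k)%nat -> B * (/ 2) ^ k < eps.
Proof.
intros He.
destruct (pow_lt_1_zero (/ 2) ltac:(rewrite Rabs_pos_eq; lra)
            (eps / (Rabs B + 1))) as [k0 Hk].
{ apply Rdiv_lt_0_compat; trivial. pose proof (Rabs_pos B); lra. }
exists k0. intros k Hk0. specialize (Hk k Hk0).
pose proof (pow_le (/2) k ltac:(lra)). rewrite Rabs_pos_eq in Hk by trivial.
apply Rle_lt_trans with ((Rabs B + 1) * (/ 2) ^ k).
- apply Rmult_le_compat_r; trivial. pose proof (Rle_abs B); lra.
- pose proof (Rabs_pos B). apply Rlt_le_trans with ((Rabs B + 1) * (eps / (Rabs B + 1))).
  apply Rmult_lt_compat_l; lra. right; field; lra.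
Qed.

Lemma Rpower_ge_1 (x a : R) : 1 <= x -> 0 <= a -> 1 <= Rpower x a.
Proof.
intros Hx Ha. rewrite <- (Rpower_O x) at 1 by lra. apply Rle_Rpower; trivial.
Qed.

Lemma Rpower_le_1 (x q : R) : 0 < x <= 1 -> 0 <= q -> Rpower x q <= 1.
Proof.
intros Hx Hq. apply Rle_trans with (Rpower 1 q); [apply Rle_Rpower_l; lra|].
unfold Rpower. rewrite ln_1, Rmult_0_r, exp_0. lra.
Qed.

Lemma Rpower_le_nonpos (a b c : R) : 0 < a -> a <= b -> c <= 0 -> Rpower b c <= Rpower a c.
Proof.
intros Ha Hab Hc. replace c with (- - c) by ring. rewrite !(Rpower_Ropp _ (- c)).
apply Rinv_le_contravar; [apply Rpower_pos|]. apply Rle_Rpower_l; lra.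
Qed.

Lemma Rpower_le_self (p v : R) : 0 < p -> 0 < v <= 1 -> Rpower v (p + 1) <= v.
Proof.
intros Hp Hv. rewrite Rpower_plus, Rpower_1 by lra.
assert (Rpower v p <= 1) by (apply Rpower_le_1; lra).
pose proof (Rpower_pos v p). nra.
Qed.

Lemma continuous_of_lipschitz_at (g : R -> R) (x0 C kap : R) :
  0 < kap -> 0 <= C ->
  (forall x, Rabs (x - x0) < kap -> Rabs (g x - g x0) <= C * Rabs (x - x0)) ->
  continuous g x0.
Proof.
intros Hk HC Hg. apply filterlim_locally. intros eps.
assert (Hd : 0 < Rmin kap (eps / (C + 1))).
{ apply Rmin_pos; trivial. apply Rdiv_lt_0_compat; [apply cond_pos|lra]. }
exists (mkposreal _ Hd). intros x Hx. unfold ball in Hx |- *; simpl in Hx |- *.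
unfold AbsRing_ball, abs, minus, plus, opp in *; simpl in *.
change (x + - x0) with (x - x0) in *. change (g x + - g x0) with (g x - g x0).
assert (H1 : Rabs (x - x0) < kap) by (eapply Rlt_le_trans; [exact Hx|apply Rmin_l]).
assert (H2 : Rabs (x - x0) < eps / (C + 1)) by (eapply Rlt_le_trans; [exact Hx|apply Rmin_r]).
eapply Rle_lt_trans; [apply Hg; trivial|].
pose proof (Rabs_pos (x - x0)). pose proof (cond_pos eps).
apply Rle_lt_trans with ((C + 1) * Rabs (x - x0)); [lra|].
apply Rlt_le_trans with ((C + 1) * (eps / (C + 1))); [apply Rmult_lt_compat_l; lra|].
right. field. lra.
Qed.

(** * Radial Picard iteration *)

(** In the norm weighted by [exp (- lam * t)] each integration gains a factor [1 / lam]. The two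
    integrations of a second order equation gain [1 / lam ^ 2], so a large [lam] makes the Picard
    map contract on the whole half-line at once. *)
Lemma RInt_exp_bound (f : R -> R) (A lam s : R) :
  0 < lam -> 0 <= s -> (forall t, continuous f t) ->
  (forall t, 0 <= t <= s -> Rabs (f t) <= A * exp (lam * t)) ->
  Rabs (RInt f 0 s) <= A / lam * exp (lam * s).
Proof.
intros Hl Hs Hc Hb.
assert (HA : 0 <= A).
{ specialize (Hb 0 ltac:(lra)). rewrite Rmult_0_r, exp_0 in Hb.
  pose proof (Rabs_pos (f 0)). lra. }
assert (HI : is_RInt (fun t => A * exp (lam * t)) 0 s
               (A / lam * exp (lam * s) - A / lam * exp (lam * 0))).
{ apply (is_RInt_derive (fun t => A / lam * exp (lam * t))).
  - intros x _. auto_derive. trivial. field. lra.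
  - intros x _. apply (ex_derive_continuous (fun t => A * exp (lam * t))).
    auto_derive. trivial. }
apply Rle_trans with (RInt (fun t => Rabs (f t)) 0 s).
{ apply abs_RInt_le; trivial. apply (ex_RInt_continuous (V:=R_CompleteNormedModule)). intros; apply Hc. }
apply Rle_trans with (RInt (fun t => A * exp (lam * t)) 0 s).
{ apply RInt_le; trivial.
  - apply (ex_RInt_continuous (V:=R_CompleteNormedModule)). intros z _.
    apply (continuous_comp f Rabs). apply Hc. apply continuous_Rabs.
  - eexists; exact HI.
  - intros x Hx. apply Hb. lra. }
rewrite (is_RInt_unique _ _ _ _ HI), Rmult_0_r, exp_0.
assert (0 <= A / lam) by (apply Rdiv_le_0_compat; lra). lra.
Qed.

(** The solution of [d' + n / s * d = g] vanishing at [0], read off from [(s ^ n * d)' = s ^ n * g].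
    The value [0] for [s <= 0] keeps the singular point inside ordinary two-sided calculus. *)
Definition radial_flux (n : nat) (g : R -> R) (s : R) : R :=
  if Rle_dec s 0 then 0 else RInt (fun t => t ^ n * g t) 0 s / s ^ n.

Lemma continuous_pow_mult (n : nat) (g : R -> R) (x : R) :
  continuous g x -> continuous (fun t => t ^ n * g t) x.
Proof.
intros Hg. apply (continuous_mult (fun t => t ^ n) g); trivial.
apply (ex_derive_continuous (fun t => t ^ n)). auto_derive. trivial.
Qed.

Lemma radial_flux_bound (n : nat) (g : R -> R) (A s : R) :
  0 < s -> (forall t, continuous g t) ->
  (forall t, 0 <= t <= s -> Rabs (g t) <= A) ->
  Rabs (radial_flux n g s) <= A * s.
Proof.
intros Hs Hc Hb. unfold radial_flux. destruct (Rle_dec s 0); [lra|].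
assert (Hp : 0 < s ^ n) by (apply pow_lt; lra).
unfold Rdiv. rewrite Rabs_mult, Rabs_inv, (Rabs_pos_eq (s ^ n)) by lra.
apply Rmult_le_reg_r with (s ^ n); trivial.
rewrite Rmult_assoc, Rinv_l, Rmult_1_r by lra.
replace (A * s * s ^ n) with ((s - 0) * (s ^ n * A)) by ring.
apply abs_RInt_le_const; [lra| |].
- apply (ex_RInt_continuous (V:=R_CompleteNormedModule)). intros. apply continuous_pow_mult, Hc.
- intros t Ht. rewrite Rabs_mult.
  apply Rmult_le_compat; try apply Rabs_pos.
  + rewrite <- RPow_abs, (Rabs_pos_eq t) by lra. apply pow_incr; lra.
  + apply Hb; trivial.
Qed.

Lemma radial_flux_exp_bound (n : nat) (g : R -> R) (A lam s : R) :
  0 < lam -> 0 <= s -> (forall t, continuous g t) ->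
  (forall t, 0 <= t <= s -> Rabs (g t) <= A * exp (lam * t)) ->
  Rabs (radial_flux n g s) <= A / lam * exp (lam * s).
Proof.
intros Hl Hs Hc Hb.
assert (HA : 0 <= A).
{ specialize (Hb 0 ltac:(lra)). rewrite Rmult_0_r, exp_0 in Hb.
  pose proof (Rabs_pos (g 0)). lra. }
assert (HA' : 0 <= A / lam) by (apply Rdiv_le_0_compat; lra).
unfold radial_flux. destruct (Rle_dec s 0).
{ rewrite Rabs_R0. apply Rmult_le_pos; trivial. left; apply exp_pos. }
assert (Hp : 0 < s ^ n) by (apply pow_lt; lra).
unfold Rdiv at 1. rewrite Rabs_mult, Rabs_inv, (Rabs_pos_eq (s ^ n)) by lra.
apply Rmult_le_reg_r with (s ^ n); trivial.
rewrite Rmult_assoc, Rinv_l, Rmult_1_r by lra.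
replace (A / lam * exp (lam * s) * s ^ n) with ((s ^ n * A) / lam * exp (lam * s))
  by (field; lra).
apply RInt_exp_bound; trivial.
- intros. apply continuous_pow_mult, Hc.
- intros t Ht. rewrite Rabs_mult, Rmult_assoc.
  apply Rmult_le_compat; try apply Rabs_pos.
  + rewrite <- RPow_abs, (Rabs_pos_eq t) by lra. apply pow_incr; lra.
  + apply Hb; trivial.
Qed.

Lemma radial_flux_minus (n : nat) (g h : R -> R) (s : R) :
  (forall t, continuous g t) -> (forall t, continuous h t) ->
  radial_flux n (fun t => g t - h t) s = radial_flux n g s - radial_flux n h s.
Proof.
intros Hg Hh. unfold radial_flux. destruct (Rle_dec s 0); [ring|].
assert (Hp : 0 < s ^ n) by (apply pow_lt; lra).
replace (RInt (fun t => t ^ n * (g t - h t)) 0 s)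
  with (RInt (fun t => t ^ n * g t) 0 s - RInt (fun t => t ^ n * h t) 0 s).
{ field. lra. }
symmetry. transitivity (RInt (fun t => minus (t ^ n * g t) (t ^ n * h t)) 0 s).
- apply RInt_ext. intros x _. unfold minus, plus, opp; simpl. ring.
- apply (RInt_minus (V:=R_CompleteNormedModule)); apply (ex_RInt_continuous (V:=R_CompleteNormedModule));
    intros; apply continuous_pow_mult; auto.
Qed.

Lemma is_derive_radial_flux (n : nat) (g : R -> R) (s : R) :
  0 < s -> (forall t, continuous g t) ->
  is_derive (radial_flux n g) s (g s - INR n / s * radial_flux n g s).
Proof.
intros Hs Hc.
assert (Hp : 0 < s ^ n) by (apply pow_lt; lra).
apply is_derive_ext_loc with (fun t => RInt (fun t => t ^ n * g t) 0 t / t ^ n).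
{ assert (H : locally s (fun t => 0 < t)) by (apply open_gt; trivial).
  revert H. apply filter_imp. intros t Ht. unfold radial_flux.
  destruct (Rle_dec t 0); [lra|reflexivity]. }
assert (HI : is_derive (fun t => RInt (fun t => t ^ n * g t) 0 t) s (s ^ n * g s)).
{ apply (is_derive_RInt (fun t => t ^ n * g t)
           (fun t => RInt (fun t => t ^ n * g t) 0 t) 0 s).
  - apply filter_forall. intros b. apply (RInt_correct (V:=R_CompleteNormedModule)).
    apply (ex_RInt_continuous (V:=R_CompleteNormedModule)). intros; apply continuous_pow_mult, Hc.
  - apply continuous_pow_mult, Hc. }
assert (HP : is_derive (fun t => / t ^ n) s (- (INR n * s ^ pred n) / (s ^ n) ^ 2)).
{ apply (is_derive_inv (fun t => t ^ n)); [|lra]. auto_derive; trivial. ring. }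
generalize (is_derive_mult _ _ _ _ _ HI HP Rmult_comm).
intros HD. unfold Rdiv at 1.
replace (g s - INR n / s * radial_flux n g s)
  with (plus (mult (s ^ n * g s) (/ s ^ n))
         (mult (RInt (fun t => t ^ n * g t) 0 s) (- (INR n * s ^ pred n) / (s ^ n) ^ 2))).
{ exact HD. }
unfold radial_flux, plus, mult; simpl. destruct (Rle_dec s 0); [lra|].
destruct n as [|n]. { simpl. field. lra. }
cbn [pred]. change (s ^ S n) with (s * s ^ n) in *.
assert (s ^ n <> 0) by (apply pow_nonzero; lra).
field. split; lra.
Qed.

Lemma continuous_radial_flux (n : nat) (g : R -> R) (x : R) :
  (forall t, continuous g t) -> continuous (radial_flux n g) x.
Proof.
intros Hc. destruct (Rtotal_order x 0) as [Hx|[Hx|Hx]].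
- apply continuous_ext_loc with (fun _ => 0).
  + assert (H : locally x (fun t => t < 0)) by (apply open_lt; trivial).
    revert H. apply filter_imp. intros t Ht. unfold radial_flux.
    destruct (Rle_dec t 0); [reflexivity|lra].
  + apply continuous_const.
- subst x.
  assert (Hr0 : radial_flux n g 0 = 0).
  { unfold radial_flux. destruct (Rle_dec 0 0); lra. }
  assert (Hcb := Hc 0).
  apply filterlim_locally. intros eps.
  rewrite Hr0.
  (* Near [0] the function [g] is bounded by [A], so the flux at [y] is at most [A * y]. *)
  destruct ((proj1 (filterlim_locally _ _) Hcb) (mkposreal 1 Rlt_0_1)) as [d Hd].
  set (A := Rabs (g 0) + 1).
  assert (HA : 0 < A) by (unfold A; pose proof (Rabs_pos (g 0)); lra).
  assert (Hd2 : 0 < Rmin d (eps / A)).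
  { apply Rmin_pos. apply cond_pos. apply Rdiv_lt_0_compat; trivial. apply cond_pos. }
  exists (mkposreal _ Hd2). intros y Hy.
  unfold ball in Hy |- *; simpl in Hy |- *.
  unfold AbsRing_ball, abs, minus, plus, opp in *; simpl in *.
  rewrite Ropp_0, Rplus_0_r in *.
  destruct (Rle_dec y 0) as [Hy0|Hy0].
  + unfold radial_flux. destruct (Rle_dec y 0); [|lra]. rewrite Rabs_R0. apply cond_pos.
  + rewrite Rabs_pos_eq in Hy by lra.
    apply Rle_lt_trans with (A * y).
    * apply radial_flux_bound; trivial. lra. intros t Ht.
      assert (Hb : ball 0 d t).
      { unfold ball; simpl. unfold AbsRing_ball, abs, minus, plus, opp; simpl.
        rewrite Ropp_0, Rplus_0_r, Rabs_pos_eq by lra.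
        eapply Rle_lt_trans; [apply Ht|]. eapply Rlt_le_trans; [apply Hy|apply Rmin_l]. }
      specialize (Hd _ Hb). unfold ball in Hd; simpl in Hd.
      unfold AbsRing_ball, abs, minus, plus, opp in Hd; simpl in Hd.
      unfold A. replace (g t) with (g 0 + (g t + - g 0)) by ring.
      eapply Rle_trans; [apply Rabs_triang|]. lra.
    * assert (y < eps / A) by (eapply Rlt_le_trans; [apply Hy|apply Rmin_r]).
      apply Rmult_lt_reg_r with (/ A). apply Rinv_0_lt_compat; trivial.
      replace (A * y * / A) with y by (field; lra). exact H.
- apply (ex_derive_continuous (radial_flux n g)). eexists. apply is_derive_radial_flux; trivial.
Qed.

(** A right inverse of the radial Laplacian [y'' + n / x * y'] with zero data at the origin. *)
Definition radial_inverse (n : nat) (g : R -> R) (x : R) : R :=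
  RInt (radial_flux n g) 0 x.

Lemma is_derive_radial_inverse (n : nat) (g : R -> R) (x : R) :
  (forall t, continuous g t) ->
  is_derive (radial_inverse n g) x (radial_flux n g x).
Proof.
intros Hc.
apply (is_derive_RInt (radial_flux n g) (radial_inverse n g) 0 x).
- apply filter_forall. intros b. apply (RInt_correct (V:=R_CompleteNormedModule)).
  apply (ex_RInt_continuous (V:=R_CompleteNormedModule)). intros; apply continuous_radial_flux, Hc.
- apply continuous_radial_flux, Hc.
Qed.

Lemma radial_inverse_neg (n : nat) (g : R -> R) (x : R) :
  x <= 0 -> radial_inverse n g x = 0.
Proof.
intros Hx. unfold radial_inverse.
transitivity (RInt (fun _ => 0) 0 x).
- apply RInt_ext. intros t Ht. unfold radial_flux. rewrite Rmax_left in Ht by lra.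
  destruct (Rle_dec t 0); [reflexivity|lra].
- rewrite RInt_const. unfold scal; simpl; unfold mult; simpl. ring.
Qed.

Lemma radial_inverse_exp_bound (n : nat) (g : R -> R) (A lam x : R) :
  0 < lam -> 0 <= A -> (forall t, continuous g t) ->
  (forall t, 0 <= t -> Rabs (g t) <= A * exp (lam * t)) ->
  Rabs (radial_inverse n g x) <= A / (lam * lam) * exp (lam * x).
Proof.
intros Hl HA Hc Hb. destruct (Rle_dec x 0) as [Hx|Hx].
- rewrite radial_inverse_neg, Rabs_R0 by trivial.
  apply Rmult_le_pos; [|left; apply exp_pos].
  apply Rdiv_le_0_compat; trivial. nra.
- replace (A / (lam * lam)) with (A / lam / lam) by (field; lra).
  apply RInt_exp_bound; try lra.
  + intros; apply continuous_radial_flux, Hc.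
  + intros t Ht. apply radial_flux_exp_bound; try lra; trivial.
    intros u Hu. apply Hb; lra.
Qed.

Lemma radial_inverse_minus (n : nat) (g h : R -> R) (x : R) :
  (forall t, continuous g t) -> (forall t, continuous h t) ->
  radial_inverse n (fun t => g t - h t) x = radial_inverse n g x - radial_inverse n h x.
Proof.
intros Hg Hh. unfold radial_inverse.
transitivity (RInt (fun t => minus (radial_flux n g t) (radial_flux n h t)) 0 x).
- apply RInt_ext. intros t _. rewrite radial_flux_minus by trivial. reflexivity.
- apply (RInt_minus (V:=R_CompleteNormedModule)); apply (ex_RInt_continuous (V:=R_CompleteNormedModule));
    intros; apply continuous_radial_flux; trivial.
Qed.

Section Picard.
Context (n : nat) (F : R -> R -> R) (L A : R).
Context (HFc : forall y, (forall x, continuous y x) ->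
                 forall x, continuous (fun t => F t (y t)) x).
Context (HL : 0 < L).
Context (HFl : forall x a b, Rabs (F x a - F x b) <= L * Rabs (a - b)).
Context (HFb : forall x, 0 <= x -> Rabs (F x 1) <= A).

Fixpoint picard (k : nat) : R -> R :=
  match k with
  | O => fun _ => 1
  | S j => fun x => 1 + radial_inverse n (fun t => F t (picard j t)) x
  end.

(** With this weight the Lipschitz constant and the two integrations give the contraction factor
    [L / lam ^ 2 = 1 / 2]. *)
Let lam := sqrt (2 * L).

Lemma lam_sqr : lam * lam = 2 * L.
Proof. apply sqrt_sqrt. lra. Qed.

Lemma lam_pos : 0 < lam.
Proof. apply sqrt_lt_R0. lra. Qed.

Lemma continuous_one_plus_inverse (g : R -> R) (x : R) :
  (forall t, continuous g t) ->
  continuous (fun x => 1 + radial_inverse n g x) x.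
Proof.
intros Hg. apply (continuous_plus (fun _ => 1)). apply continuous_const.
apply (ex_derive_continuous (radial_inverse n g)). eexists.
apply is_derive_radial_inverse; trivial.
Qed.

Lemma continuous_picard (k : nat) (x : R) : continuous (picard k) x.
Proof.
revert x. induction k as [|k IH]; intros x; cbn [picard].
- apply continuous_const.
- apply continuous_one_plus_inverse. apply HFc, IH.
Qed.

Lemma picard_contract (y z : R -> R) (B x : R) :
  0 <= B -> (forall t, continuous y t) -> (forall t, continuous z t) ->
  (forall t, Rabs (y t - z t) <= B * exp (lam * t)) ->
  Rabs ((1 + radial_inverse n (fun t => F t (y t)) x)
        - (1 + radial_inverse n (fun t => F t (z t)) x)) <= B / 2 * exp (lam * x).
Proof.
intros HB Hy Hz Hb.
replace ((1 + radial_inverse n (fun t => F t (y t)) x)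
        - (1 + radial_inverse n (fun t => F t (z t)) x))
  with (radial_inverse n (fun t => F t (y t) - F t (z t)) x).
2:{ rewrite (radial_inverse_minus n (fun t => F t (y t)) (fun t => F t (z t)));
    auto; try ring. }
replace (B / 2) with (L * B / (lam * lam)) by (rewrite lam_sqr; field; lra).
apply radial_inverse_exp_bound; [apply lam_pos|nra| |].
- intros t. apply (continuous_minus (fun t => F t (y t)) (fun t => F t (z t))); auto.
- intros t _. eapply Rle_trans; [apply HFl|]. rewrite Rmult_assoc.
  apply Rmult_le_compat_l; [lra|apply Hb].
Qed.

Lemma A_nonneg : 0 <= A.
Proof. eapply Rle_trans; [apply Rabs_pos|apply (HFb 0); lra]. Qed.

Let C := A / (2 * L).

Lemma C_nonneg : 0 <= C.
Proof. apply Rdiv_le_0_compat; [apply A_nonneg|lra]. Qed.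

Lemma picard_step (k : nat) (x : R) :
  Rabs (picard (S k) x - picard k x) <= C * (/ 2) ^ k * exp (lam * x).
Proof.
revert x. induction k as [|k IH]; intros x.
- cbn [picard pow]. rewrite Rmult_1_r.
  replace (1 + radial_inverse n (fun t => F t 1) x - 1)
    with (radial_inverse n (fun t => F t 1) x) by ring.
  unfold C. rewrite <- lam_sqr. apply radial_inverse_exp_bound.
  apply lam_pos. apply A_nonneg.
  { apply (HFc (fun _ => 1)). intros; apply continuous_const. }
  intros t Ht. apply Rle_trans with A; [apply HFb; trivial|].
  rewrite <- (Rmult_1_r A) at 1. apply Rmult_le_compat_l; [apply A_nonneg|].
  rewrite <- exp_0. assert (0 <= lam * t) by (pose proof lam_pos; nra).
  destruct H as [H|H]; [left; apply exp_increasing; trivial|right; f_equal; trivial].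
- replace (C * (/ 2) ^ S k) with ((C * (/ 2) ^ k) / 2) by (cbn [pow]; field).
  change (picard (S (S k)) x) with (1 + radial_inverse n (fun t => F t (picard (S k) t)) x).
  change (picard (S k) x) with (1 + radial_inverse n (fun t => F t (picard k t)) x).
  apply picard_contract; auto using continuous_picard.
  apply Rmult_le_pos; [apply C_nonneg|apply pow_le; lra].
Qed.

Lemma picard_cauchy (k j : nat) (x : R) :
  Rabs (picard (k + j) x - picard k x)
    <= 2 * C * (/ 2) ^ k * (1 - (/ 2) ^ j) * exp (lam * x).
Proof.
induction j as [|j IH].
- rewrite Nat.add_0_r, Rminus_diag, Rabs_R0. cbn [pow]. right; ring.
- rewrite Nat.add_succ_r.
  replace (picard (S (k + j)) x - picard k x)
    with ((picard (S (k + j)) x - picard (k + j) x) + (picard (k + j) x - picard k x)) by ring.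
  eapply Rle_trans; [apply Rabs_triang|].
  eapply Rle_trans; [apply Rplus_le_compat; [apply picard_step|apply IH]|].
  right. rewrite pow_add. cbn [pow]. field.
Qed.

Lemma picard_cauchy_le (k j : nat) (x : R) :
  Rabs (picard (k + j) x - picard k x) <= 2 * C * (/ 2) ^ k * exp (lam * x).
Proof.
eapply Rle_trans; [apply picard_cauchy|].
apply Rmult_le_compat_r; [left; apply exp_pos|].
rewrite <- (Rmult_1_r (2 * C * (/ 2) ^ k)) at 2.
apply Rmult_le_compat_l.
- pose proof C_nonneg. pose proof (pow_le (/2) k ltac:(lra)). nra.
- pose proof (pow_le (/2) j ltac:(lra)). lra.
Qed.

Definition picard_limit (x : R) : R := real (Lim_seq (fun k => picard k x)).

Lemma is_lim_seq_picard (x : R) : is_lim_seq (fun k => picard k x) (picard_limit x).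
Proof.
apply Lim_seq_correct', ex_lim_seq_cauchy_corr.
intros eps.
destruct (half_pow_small (2 * C * exp (lam * x)) (eps / 2)) as [k0 Hk].
{ pose proof (cond_pos eps). lra. }
specialize (Hk k0 (le_n _)).
exists k0. intros i j Hi Hj.
replace i with (k0 + (i - k0))%nat by lia. replace j with (k0 + (j - k0))%nat by lia.
pose proof (picard_cauchy_le k0 (i - k0) x).
pose proof (picard_cauchy_le k0 (j - k0) x).
replace (picard (k0 + (i - k0)) x - picard (k0 + (j - k0)) x)
 with ((picard (k0 + (i - k0)) x - picard k0 x) + - (picard (k0 + (j - k0)) x - picard k0 x))
 by ring.
eapply Rle_lt_trans; [apply Rabs_triang|]. rewrite Rabs_Ropp. lra.
Qed.

Lemma picard_limit_rate (k : nat) (x : R) :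
  Rabs (picard_limit x - picard k x) <= 2 * C * (/ 2) ^ k * exp (lam * x).
Proof.
assert (H : is_lim_seq (fun j => Rabs (picard (j + k) x - picard k x))
              (Rabs (picard_limit x - picard k x))).
{ apply (is_lim_seq_abs _ (picard_limit x - picard k x)).
  apply is_lim_seq_minus'; [|apply is_lim_seq_const].
  apply (is_lim_seq_incr_n (fun k => picard k x)), is_lim_seq_picard. }
refine (is_lim_seq_le _ (fun _ => 2 * C * (/ 2) ^ k * exp (lam * x)) _ _ _ H
          (is_lim_seq_const _)).
intros j. rewrite Nat.add_comm. apply picard_cauchy_le.
Qed.

Lemma continuous_picard_limit (x : R) : continuous picard_limit x.
Proof.
apply continuity_pt_filterlim.
assert (Hr : 0 < Rabs x + 1) by (pose proof (Rabs_pos x); lra).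
apply (CVU_continuity picard picard_limit 0 (mkposreal _ Hr)).
- intros eps He.
  destruct (half_pow_small (2 * C * exp (lam * (Rabs x + 1))) eps He) as [k0 Hk].
  exists k0. intros k y Hk0 Hy. specialize (Hk k Hk0).
  unfold Boule in Hy; simpl in Hy. rewrite Rminus_0_r in Hy.
  eapply Rle_lt_trans; [apply picard_limit_rate|].
  eapply Rle_lt_trans; [|exact Hk].
  replace (2 * C * exp (lam * (Rabs x + 1)) * (/ 2) ^ k)
    with (2 * C * (/ 2) ^ k * exp (lam * (Rabs x + 1))) by ring.
  apply Rmult_le_compat_l.
  + pose proof C_nonneg. pose proof (pow_le (/2) k ltac:(lra)). nra.
  + left. apply exp_increasing. apply Rmult_lt_compat_l; [apply lam_pos|].
    eapply Rle_lt_trans; [apply Rle_abs|exact Hy].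
- intros k y _. apply continuity_pt_filterlim, continuous_picard.
- unfold Boule; simpl. rewrite Rminus_0_r. lra.
Qed.

Lemma picard_limit_fixed (x : R) :
  picard_limit x = 1 + radial_inverse n (fun t => F t (picard_limit t)) x.
Proof.
apply Rminus_diag_uniq. apply NNPP. intros Hne.
apply Rabs_pos_lt in Hne. set (z := Rabs _) in Hne.
destruct (half_pow_small (2 * C * exp (lam * x)) z Hne) as [k Hk].
specialize (Hk k (le_n _)).
(* The distances of both sides to [picard (S k) x] add up to the bound just made smaller than
   [z]. *)
assert (H1 := picard_limit_rate (S k) x).
assert (H2 : Rabs (picard (S k) x - (1 + radial_inverse n (fun t => F t (picard_limit t)) x))
             <= (2 * C * (/ 2) ^ k) / 2 * exp (lam * x)).
{ cbn [picard]. apply picard_contract; auto using continuous_picard, continuous_picard_limit.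
  - pose proof C_nonneg. pose proof (pow_le (/2) k ltac:(lra)). nra.
  - intros t. rewrite Rabs_minus_sym. apply picard_limit_rate. }
assert (H3 : z <= Rabs (picard_limit x - picard (S k) x) +
          Rabs (picard (S k) x - (1 + radial_inverse n (fun t => F t (picard_limit t)) x))).
{ unfold z. eapply Rle_trans; [|apply Rabs_triang]. right. f_equal. ring. }
cbn [pow] in H1. 
assert (H4 : 0 <= 2 * C * (/ 2) ^ k * exp (lam * x)).
{ eapply Rle_trans; [apply Rabs_pos|apply (picard_limit_rate k)]. }
lra.
Qed.

(** The constant extension to [x <= 0] makes [y] differentiable and [d] continuous across [0], so
    the initial data are values at an interior point; the equation itself is claimed for [x > 0]. *)
Lemma picard_existence :
  exists y d : R -> R,
    (forall x, is_derive y x (d x)) /\ (forall x, continuous d x) /\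
    (forall x, x <= 0 -> y x = 1 /\ d x = 0) /\
    (forall x, 0 < x -> is_derive d x (F x (y x) - INR n / x * d x)).
Proof.
assert (Hg : forall x, continuous (fun t => F t (picard_limit t)) x)
  by (apply HFc, continuous_picard_limit).
exists picard_limit, (radial_flux n (fun t => F t (picard_limit t))).
split; [|split; [|split; [intros x Hx; split|]]].
- intros x. apply is_derive_ext with
    (fun x => 1 + radial_inverse n (fun t => F t (picard_limit t)) x).
  { intros t. symmetry. apply picard_limit_fixed. }
  eapply is_derive_eq.
  + apply is_derive_Rplus; [apply is_derive_Rconst|].
    apply is_derive_radial_inverse, Hg.
  + ring.
- intros x. apply continuous_radial_flux, Hg.
- rewrite picard_limit_fixed, radial_inverse_neg by trivial. ring.
- unfold radial_flux. destruct (Rle_dec x 0); [reflexivity|lra].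
- intros x Hx.
  apply (is_derive_radial_flux n (fun t => F t (picard_limit t))); trivial.
Qed.

End Picard.

(** * Truncated equations *)

(** The singular term contributes [- 2 * n / x * (d1 - d2) ^ 2] to the derivative of the sum of
    squares [S], which only helps. What remains gives [(S + a ^ 2)' <= (L + 2) * (S + a ^ 2)], with
    [S = 0] at the origin. *)
Lemma radial_gronwall (n : nat) (y1 d1 f1 y2 d2 f2 : R -> R) (L a b : R) :
  0 <= L -> 0 <= a ->
  (forall x, 0 <= x <= b -> is_derive y1 x (d1 x)) ->
  (forall x, 0 <= x <= b -> is_derive y2 x (d2 x)) ->
  (forall x, 0 <= x <= b -> continuous d1 x) ->
  (forall x, 0 <= x <= b -> continuous d2 x) ->
  (forall x, 0 < x < b -> is_derive d1 x (f1 x - INR n / x * d1 x)) ->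
  (forall x, 0 < x < b -> is_derive d2 x (f2 x - INR n / x * d2 x)) ->
  (forall x, 0 < x < b -> Rabs (f1 x - f2 x) <= L * Rabs (y1 x - y2 x) + a) ->
  y1 0 = y2 0 -> d1 0 = d2 0 ->
  forall x, 0 <= x <= b ->
    Rabs (y1 x - y2 x) <= a * exp ((L + 2) * x) /\
    Rabs (d1 x - d2 x) <= a * exp ((L + 2) * x).
Proof.
intros HL Ha Hy1 Hy2 Hc1 Hc2 Hd1 Hd2 Hf Hy0 Hd0 x Hx.
set (S := fun t => (y1 t - y2 t) * (y1 t - y2 t) + (d1 t - d2 t) * (d1 t - d2 t)).
set (W := fun t => (S t + a * a) * exp (- ((L + 2) * t))).
assert (HW : W x <= W 0).
{ apply decreasing_on with
    (df := fun t =>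
      (((d1 t - d2 t) * (y1 t - y2 t) + (y1 t - y2 t) * (d1 t - d2 t)
        + (((f1 t - INR n / t * d1 t) - (f2 t - INR n / t * d2 t)) * (d1 t - d2 t)
          + (d1 t - d2 t) * ((f1 t - INR n / t * d1 t) - (f2 t - INR n / t * d2 t)))
       + 0) * exp (- ((L + 2) * t)) + (S t + a * a) * (- (L + 2) * exp (- ((L + 2) * t))))).
  - lra.
  - intros t Ht.
    assert (HY : continuous (fun t => y1 t - y2 t) t).
    { apply continuous_Rminus; eapply is_derive_continuous; [apply Hy1|apply Hy2]; lra. }
    assert (HD : continuous (fun t => d1 t - d2 t) t).
    { apply continuous_Rminus; [apply Hc1|apply Hc2]; lra. }
    apply continuous_Rmult.
    + apply continuous_Rplus; [|apply continuous_const].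
      apply continuous_Rplus; apply continuous_Rmult; trivial.
    + apply (ex_derive_continuous (fun t => exp (- ((L + 2) * t)))). auto_derive. trivial.
  - intros t Ht. 
    assert (HY : is_derive (fun t => y1 t - y2 t) t (d1 t - d2 t)).
    { apply is_derive_Rminus; [apply Hy1|apply Hy2]; lra. }
    assert (HD := is_derive_Rminus _ _ _ _ _ (Hd1 t ltac:(lra)) (Hd2 t ltac:(lra))).
    assert (HS : is_derive S t
      ((d1 t - d2 t) * (y1 t - y2 t) + (y1 t - y2 t) * (d1 t - d2 t)
        + (((f1 t - INR n / t * d1 t) - (f2 t - INR n / t * d2 t)) * (d1 t - d2 t)
          + (d1 t - d2 t) * ((f1 t - INR n / t * d1 t) - (f2 t - INR n / t * d2 t))))).
    { exact (is_derive_Rplus _ _ _ _ _ (is_derive_Rmult _ _ _ _ _ HY HY)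
               (is_derive_Rmult _ _ _ _ _ HD HD)). }
    refine (is_derive_Rmult (fun t => S t + a * a) (fun t => exp (- ((L + 2) * t))) t _ _ _ _).
    + exact (is_derive_Rplus _ _ _ _ _ HS (is_derive_Rconst (a * a) t)).
    + auto_derive; trivial. ring.
  - intros t Ht. specialize (Hf t ltac:(lra)).
    set (D := y1 t - y2 t) in *. set (P := d1 t - d2 t) in *.
    set (e := exp _). assert (He : 0 < e) by apply exp_pos.
    set (g := f1 t - f2 t) in *.
    replace (f1 t - INR n / t * d1 t - (f2 t - INR n / t * d2 t))
      with (g - INR n / t * P) by (unfold g, P; ring).
    unfold S. fold D P.
    assert (Hn : 0 <= INR n / t) by (apply Rdiv_le_0_compat; [apply pos_INR|lra]).
    assert (HPg : P * g <= Rabs P * (L * Rabs D + a)).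
    { eapply Rle_trans; [apply Rle_abs|]. rewrite Rabs_mult.
      apply Rmult_le_compat_l; [apply Rabs_pos|exact Hf]. }
    assert (H1 : Rabs P * Rabs P = P * P) by (rewrite <- Rabs_mult; apply Rabs_pos_eq; nra).
    assert (H2 : Rabs D * Rabs D = D * D) by (rewrite <- Rabs_mult; apply Rabs_pos_eq; nra).
    assert (H3 : 2 * (Rabs P * (L * Rabs D + a)) <= L * (P * P + D * D) + P * P + a * a).
    { rewrite <- H1, <- H2.
      assert (0 <= L * ((Rabs P - Rabs D) * (Rabs P - Rabs D))).
      { apply Rmult_le_pos; trivial. apply Rle_0_sqr. }
      assert (0 <= (Rabs P - a) * (Rabs P - a)) by apply Rle_0_sqr. nra. }
    assert (H4 : 0 <= INR n / t * (P * P)) by (apply Rmult_le_pos; nra).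
    assert (H5 : 2 * (D * P) <= D * D + P * P).
    { assert (0 <= (D - P) * (D - P)) by apply Rle_0_sqr. nra. }
    assert (H6 : 0 <= L * (a * a)) by (apply Rmult_le_pos; nra).
    assert (0 <= a * a) by nra.
    match goal with |- ?u <= 0 =>
      replace u with (e * ((2 * (D * P) + 2 * (P * g) - 2 * (INR n / t * (P * P)))
                           - (L + 2) * (D * D + P * P + a * a))) by ring end.
    assert (2 * (D * P) + 2 * (P * g) - 2 * (INR n / t * (P * P))
                           - (L + 2) * (D * D + P * P + a * a) <= 0) by nra.
    nra. }
unfold W, S in HW. rewrite Hy0, Hd0, !Rminus_diag, !Rmult_0_r, Ropp_0, exp_0 in HW.
rewrite exp_Ropp in HW.
set (e := exp ((L + 2) * x)) in *.
assert (He : 1 <= e).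
{ unfold e. rewrite <- exp_0. assert (H : 0 <= (L + 2) * x) by nra.
  destruct H as [H|H]; [left; apply exp_increasing; trivial|right; f_equal; trivial]. }
assert (HS : (y1 x - y2 x) * (y1 x - y2 x) + (d1 x - d2 x) * (d1 x - d2 x) <= a * a * e).
{ apply Rmult_le_compat_r with (r := e) in HW; [|lra].
  rewrite Rmult_assoc, Rinv_l in HW by lra. nra. }
assert (Hae : 0 <= a * e) by nra.
(* As [e >= 1], the bound may be enlarged to a perfect square, which avoids halving the exponent. *)
assert (Hee : a * a * e <= (a * e) * (a * e)).
{ replace ((a * e) * (a * e)) with (a * a * (e * e)) by ring.
  apply Rmult_le_compat_l; nra. }
split; rewrite <- (Rabs_pos_eq (a * e)) by lra;
  apply Rsqr_le_abs_0; unfold Rsqr;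
  pose proof (Rle_0_sqr (y1 x - y2 x)); pose proof (Rle_0_sqr (d1 x - d2 x)); unfold Rsqr in *; lra.
Qed.

(** The slope [p / t ^ (1 - p)] is largest at [eta]. It blows up as [eta] tends to [0], which is why
    the power gets truncated. *)
Lemma Rpower_lipschitz (p eta : R) :
  0 < p < 1 -> 0 < eta ->
  exists L, 0 <= L /\ forall a b, eta <= a -> eta <= b ->
    Rabs (Rpower a p - Rpower b p) <= L * Rabs (a - b).
Proof.
intros Hp He. exists (p * / Rpower eta (1 - p)).
assert (HL : 0 <= p * / Rpower eta (1 - p)).
{ apply Rmult_le_pos; [lra|]. left. apply Rinv_0_lt_compat, Rpower_pos. }
split; trivial.
assert (H : forall a b, eta <= a -> a < b ->
    Rabs (Rpower a p - Rpower b p) <= p * / Rpower eta (1 - p) * Rabs (a - b)).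
{ intros a b Ha Hab.
  destruct (mean_value (fun t => Rpower t p) (fun t => p * (Rpower t p / t)) a b Hab)
    as [c [Hc Heq]].
  - intros x Hx. eapply is_derive_continuous, is_derive_Rpower. lra.
  - intros x Hx. apply is_derive_Rpower. lra.
  - rewrite Rabs_minus_sym, Heq, (Rabs_minus_sym a), Rabs_mult.
    apply Rmult_le_compat_r; [apply Rabs_pos|].
    assert (Hq : Rpower c p / c = / Rpower c (1 - p)).
    { rewrite <- Rpower_Ropp. replace (- (1 - p)) with (p + - (1)) by ring.
      rewrite Rpower_plus, Rpower_Ropp, Rpower_1 by lra. reflexivity. }
    rewrite Hq, Rabs_pos_eq.
    + apply Rmult_le_compat_l; [lra|]. apply Rinv_le_contravar; [apply Rpower_pos|].
      apply Rle_Rpower_l; lra.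
    + apply Rmult_le_pos; [lra|]. left. apply Rinv_0_lt_compat, Rpower_pos. }
intros a b Ha Hb. destruct (Rtotal_order a b) as [Hab|[Hab|Hab]].
- apply H; trivial.
- subst. rewrite !Rminus_diag, Rabs_R0. lra.
- rewrite Rabs_minus_sym, (Rabs_minus_sym a). apply H; trivial.
Qed.

(* [x ^ sigma] extended continuously to [x <= 0]; [Rpower 0 sigma] is the junk value [1]. *)
Definition weight (sigma x : R) : R :=
  if Rle_dec x 0 then (if Req_dec_T sigma 0 then 1 else 0) else Rpower x sigma.

Lemma continuous_weight (sigma x : R) : 0 <= sigma -> continuous (weight sigma) x.
Proof.
intros Hs. destruct (Req_dec_T sigma 0) as [Hs0|Hs0].
{ apply continuous_ext with (fun _ => 1); [|apply continuous_const].
  intros t. unfold weight. destruct (Rle_dec t 0); destruct (Req_dec_T sigma 0); try lra.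
  subst sigma. rewrite Rpower_O by lra. reflexivity. }
destruct (Rtotal_order x 0) as [Hx|[Hx|Hx]].
- apply continuous_ext_loc with (fun _ => 0); [|apply continuous_const].
  apply (locally_between _ (x - 1) 0 x); [lra|]. intros t Ht.
  unfold weight. destruct (Rle_dec t 0); destruct (Req_dec_T sigma 0); lra.
- subst x. apply filterlim_locally. intros eps.
  assert (H0 : weight sigma 0 = 0).
  { unfold weight. destruct (Rle_dec 0 0); destruct (Req_dec_T sigma 0); lra. }
  rewrite H0.
  exists (mkposreal _ (Rpower_pos eps (/ sigma))). intros y Hy.
  unfold ball in Hy |- *; simpl in Hy |- *.
  unfold AbsRing_ball, abs, minus, plus, opp in *; simpl in *.
  rewrite Ropp_0, Rplus_0_r in *.
  unfold weight. destruct (Rle_dec y 0); destruct (Req_dec_T sigma 0); try lra.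
  + rewrite Rabs_R0. apply cond_pos.
  + rewrite Rabs_pos_eq in Hy by lra.
    rewrite Rabs_pos_eq by (left; apply Rpower_pos).
    apply Rlt_le_trans with (Rpower (Rpower eps (/ sigma)) sigma).
    * apply Rlt_Rpower_l; lra.
    * rewrite Rpower_mult, Rinv_l, Rpower_1 by (trivial || apply cond_pos). lra.
- apply continuous_ext_loc with (fun t => Rpower t sigma).
  + apply (locally_between _ 0 (x + 1) x); [lra|]. intros t Ht.
    unfold weight. destruct (Rle_dec t 0); [lra|reflexivity].
  + eapply is_derive_continuous, is_derive_Rpower; trivial.
Qed.

Lemma weight_bound (sigma X x : R) :
  0 <= sigma -> 0 < X -> Rabs (weight sigma (Rmin x X)) <= 1 + Rpower X sigma.
Proof.
intros Hs HX. pose proof (Rpower_pos X sigma).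
unfold weight. destruct (Rle_dec (Rmin x X) 0) as [Hm|Hm].
- destruct (Req_dec_T sigma 0); [rewrite Rabs_R1|rewrite Rabs_R0]; lra.
- rewrite Rabs_pos_eq by (left; apply Rpower_pos).
  assert (Rpower (Rmin x X) sigma <= Rpower X sigma); [|lra].
  apply Rle_Rpower_l; trivial. split; [lra|apply Rmin_r].
Qed.

(** The cutoff [Rmax (y x) eta] makes the absorption Lipschitz, so these solutions exist on any
    interval, whatever their sign. As long as [y >= eta] the cutoff is inactive and [y] solves the
    true equation. *)
Definition truncated_solution (n : nat) (p sg de ep eta : R) (y d : R -> R) (X : R) : Prop :=
  (forall x, is_derive y x (d x)) /\ (forall x, continuous d x) /\
  (forall x, x <= 0 -> y x = 1 /\ d x = 0) /\
  (forall x, 0 < x <= X -> is_derive d x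
     (ep * Rpower (Rmax (y x) eta) p - de * (Rpower x sg * y x) - INR n / x * d x)).

Lemma continuous_Rmax_const (eta x : R) : continuous (fun t => Rmax t eta) x.
Proof.
apply filterlim_locally. intros eps. exists eps. intros y Hy.
unfold ball in Hy |- *; simpl in Hy |- *.
unfold AbsRing_ball, abs, minus, plus, opp in *; simpl in *.
eapply Rle_lt_trans; [|exact Hy].
unfold Rmax. destruct (Rle_dec y eta); destruct (Rle_dec x eta);
  unfold Rabs; repeat destruct Rcase_abs; lra.
Qed.

Lemma Rmax_lipschitz (a b eta : R) : Rabs (Rmax a eta - Rmax b eta) <= Rabs (a - b).
Proof.
unfold Rmax. destruct (Rle_dec a eta); destruct (Rle_dec b eta);
  unfold Rabs; repeat destruct Rcase_abs; lra.
Qed.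

Lemma truncated_solution_exists (n : nat) (p sg de ep eta X : R) :
  0 < p < 1 -> 0 <= sg -> 0 < eta -> 0 < X ->
  exists y d, truncated_solution n p sg de ep eta y d X.
Proof.
intros Hp Hs He HX.
destruct (Rpower_lipschitz p eta Hp He) as [Lh [HLh Hlip]].
set (B := 1 + Rpower X sg).
assert (HB : 0 < B) by (unfold B; pose proof (Rpower_pos X sg); lra).
(* Freezing the weight beyond [X] bounds the coefficient of [y] and makes [F] globally Lipschitz in
   [y]; up to [X] nothing changes. *)
set (F := fun x y => ep * Rpower (Rmax y eta) p - de * (weight sg (Rmin x X) * y)).
destruct (picard_existence n F (Rabs ep * Lh + Rabs de * B + 1)
            (Rabs ep * Rpower (Rmax 1 eta) p + Rabs de * B))
  as [y [d [H1 [H2 [H3 H4]]]]].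
- intros y Hy x. unfold F. apply continuous_Rminus.
  + apply continuous_Rmult; [apply continuous_const|].
    apply (continuous_comp (fun t => Rmax (y t) eta) (fun u => Rpower u p)).
    * apply (continuous_comp y (fun u => Rmax u eta)); [apply Hy|apply continuous_Rmax_const].
    * eapply is_derive_continuous, is_derive_Rpower.
      eapply Rlt_le_trans; [exact He|apply Rmax_r].
  + apply continuous_Rmult; [apply continuous_const|].
    apply continuous_Rmult; [|apply Hy].
    apply (continuous_comp (fun t => Rmin t X) (weight sg)).
    * apply continuous_ext with (fun t => - (Rmax (- t) (- X))).
      { intros t. unfold Rmax, Rmin. destruct (Rle_dec (-t) (-X)); destruct (Rle_dec t X); lra. }
      apply (continuous_opp (V:=R_NormedModule) (fun t => Rmax (- t) (- X))).
      apply (continuous_comp (fun t => - t) (fun t => Rmax t (- X))).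
      { apply (ex_derive_continuous (fun t => - t)). auto_derive. trivial. }
      apply continuous_Rmax_const.
    * apply continuous_weight; trivial.
- pose proof (Rabs_pos ep). pose proof (Rabs_pos de). nra.
- intros x a b. unfold F.
  replace (ep * Rpower (Rmax a eta) p - de * (weight sg (Rmin x X) * a)
    - (ep * Rpower (Rmax b eta) p - de * (weight sg (Rmin x X) * b)))
   with (ep * (Rpower (Rmax a eta) p - Rpower (Rmax b eta) p)
         + - (de * (weight sg (Rmin x X) * (a - b)))) by ring.
  eapply Rle_trans; [apply Rabs_triang|]. rewrite Rabs_Ropp, !Rabs_mult.
  pose proof (Hlip (Rmax a eta) (Rmax b eta) (Rmax_r _ _) (Rmax_r _ _)) as Hh.
  pose proof (Rmax_lipschitz a b eta) as Hm.
  pose proof (weight_bound sg X x Hs HX) as Hw. fold B in Hw.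
  pose proof (Rabs_pos ep). pose proof (Rabs_pos de). pose proof (Rabs_pos (a - b)).
  assert (Rabs ep * Rabs (Rpower (Rmax a eta) p - Rpower (Rmax b eta) p)
          <= Rabs ep * (Lh * Rabs (a - b))).
  { apply Rmult_le_compat_l; trivial. eapply Rle_trans; [exact Hh|].
    apply Rmult_le_compat_l; trivial. }
  assert (Rabs de * (Rabs (weight sg (Rmin x X)) * Rabs (a - b))
          <= Rabs de * (B * Rabs (a - b))).
  { apply Rmult_le_compat_l; trivial. apply Rmult_le_compat_r; trivial. }
  lra.
- intros x Hx. unfold F.
  eapply Rle_trans; [apply Rabs_triang|]. rewrite Rabs_Ropp, !Rabs_mult, Rabs_R1, Rmult_1_r.
  rewrite (Rabs_pos_eq (Rpower _ _)) by (left; apply Rpower_pos).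
  apply Rplus_le_compat_l. apply Rmult_le_compat_l; [apply Rabs_pos|].
  apply weight_bound; trivial.
- exists y, d. split; [|split; [|split]]; trivial.
  intros x Hx. specialize (H4 x ltac:(lra)). unfold F in H4.
  rewrite Rmin_left in H4 by lra. unfold weight in H4.
  destruct (Rle_dec x 0); [lra|exact H4].
Qed.

(** * Positive solutions *)

(** Nothing is asked at [X] itself: on a maximal interval [y] may come arbitrarily close to [0]
    there. *)
Definition positive_solution (n : nat) (p sg de ep : R) (y d : R -> R) (X : R) : Prop :=
  (forall x, x < X -> is_derive y x (d x)) /\ (forall x, x < X -> continuous d x) /\
  (forall x, x <= 0 -> y x = 1 /\ d x = 0) /\
  (forall x, 0 < x < X -> 0 < y x /\ is_derive d x
     (ep * Rpower (y x) p - de * (Rpower x sg * y x) - INR n / x * d x)).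

Section PositiveSolutions.
Context (n : nat) (p sg : R) (Hp : 0 < p < 1) (Hsg : 0 <= sg).

Lemma positive_solution_le (de ep : R) (y d : R -> R) (X X' : R) :
  X' <= X -> positive_solution n p sg de ep y d X -> positive_solution n p sg de ep y d X'.
Proof.
intros HX [H1 [H2 [H3 H4]]]. split; [|split; [|split]]; trivial; intros x Hx;
  [apply H1|apply H2|apply H4]; lra.
Qed.

Lemma positive_solution_pos (de ep : R) (y d : R -> R) (X x : R) :
  positive_solution n p sg de ep y d X -> x < X -> 0 < y x.
Proof.
intros [H1 [H2 [H3 H4]]] Hx. destruct (Rle_dec x 0) as [H|H].
- rewrite (proj1 (H3 x H)). lra.
- apply H4. lra.
Qed.

Lemma truncated_positive_solution (de ep eta : R) (y d : R -> R) (X X0 : R) :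
  0 < eta -> X <= X0 -> truncated_solution n p sg de ep eta y d X0 ->
  (forall x, 0 < x < X -> eta <= y x) -> positive_solution n p sg de ep y d X.
Proof.
intros He HX [H1 [H2 [H3 H4]]] Hy.
split; [|split; [|split]]; trivial; try (intros; apply H1 || apply H2).
intros x Hx. specialize (Hy x Hx). split; [lra|].
specialize (H4 x ltac:(lra)). rewrite Rmax_left in H4 by lra. exact H4.
Qed.

(** The perturbed solution [z] enters as a truncated one, because its positivity up to [b] is not
    known beforehand; the estimate is what later proves it. The reference solution stays above
    [eta], so the cutoff does not affect it and both right-hand sides are comparable. *)
Lemma dependence_estimate (eta M b Y : R) :
  0 < eta -> 0 <= M -> 0 < b -> eta <= Y ->
  exists C, 0 <= C /\ forall de ep de0 ep0 y d z dz X X0,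
    Rabs ep <= M -> Rabs de <= M -> b < X -> b <= X0 ->
    positive_solution n p sg de0 ep0 y d X ->
    truncated_solution n p sg de ep eta z dz X0 ->
    (forall x, 0 <= x <= b -> eta <= y x <= Y) ->
    forall x, 0 <= x <= b ->
      Rabs (z x - y x) <= C * (Rabs (ep - ep0) + Rabs (de - de0)) /\
      Rabs (dz x - d x) <= C * (Rabs (ep - ep0) + Rabs (de - de0)).
Proof.
intros He HM Hb HY.
destruct (Rpower_lipschitz p eta Hp He) as [Lh [HLh Hlip]].
set (B := Rpower b sg). assert (HB : 0 < B) by apply Rpower_pos.
set (A := Rpower Y p + B * Y).
assert (HA : 0 <= A) by (unfold A; pose proof (Rpower_pos Y p); nra).
set (L := M * Lh + M * B). assert (HL : 0 <= L) by (unfold L; nra).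
exists (A * exp ((L + 2) * b)). split.
{ apply Rmult_le_pos; trivial. left; apply exp_pos. }
intros de ep de0 ep0 y d z dz X X0 Hep Hde HX HX0 Hy Hz Hr x Hx.
set (D := Rabs (ep - ep0) + Rabs (de - de0)).
assert (HD : 0 <= D).
{ unfold D. pose proof (Rabs_pos (ep - ep0)). pose proof (Rabs_pos (de - de0)). lra. }
destruct Hy as [Hy1 [Hy2 [Hy3 Hy4]]]. destruct Hz as [Hz1 [Hz2 [Hz3 Hz4]]].
assert (Hex : exp ((L + 2) * x) <= exp ((L + 2) * b)).
{ destruct (Rle_lt_or_eq_dec x b (proj2 Hx)) as [H|H]; [|subst; lra].
  left. apply exp_increasing. nra. }
assert (Hfin : D * A * exp ((L + 2) * x) <= A * exp ((L + 2) * b) * D).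
{ replace (A * exp ((L + 2) * b) * D) with (D * A * exp ((L + 2) * b)) by ring.
  apply Rmult_le_compat_l; trivial. nra. }
assert (HG : Rabs (z x - y x) <= D * A * exp ((L + 2) * x) /\
             Rabs (dz x - d x) <= D * A * exp ((L + 2) * x)).
2:{ destruct HG; split; lra. }
revert x Hx Hex Hfin. 
assert (Hmain := radial_gronwall n z dz
  (fun x => ep * Rpower (Rmax (z x) eta) p - de * (Rpower x sg * z x))
  y d (fun x => ep0 * Rpower (y x) p - de0 * (Rpower x sg * y x)) L (D * A) b HL).
intros x Hx _ _. apply Hmain; clear Hmain; trivial.
- nra.
- intros t Ht. apply Hy1; lra.
- intros t Ht. apply Hy2; lra.
- intros t Ht. apply Hz4; lra.
- intros t Ht. apply Hy4; lra.
- intros t Ht. specialize (Hr t ltac:(lra)).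
  assert (Hw : 0 < Rpower t sg <= B).
  { split; [apply Rpower_pos|]. apply Rle_Rpower_l; lra. }
  set (w := Rpower t sg) in *.
  assert (Hh := Hlip (Rmax (z t) eta) (Rmax (y t) eta) (Rmax_r _ _) (Rmax_r _ _)).
  assert (Hm := Rmax_lipschitz (z t) (y t) eta).
  rewrite (Rmax_left (y t)) in Hh, Hm by lra.
  assert (Hq : 0 < Rpower (y t) p <= Rpower Y p).
  { split; [apply Rpower_pos|]. apply Rle_Rpower_l; lra. }
  set (hz := Rpower (Rmax (z t) eta) p) in *. set (hy := Rpower (y t) p) in *.
  replace (ep * hz - de * (w * z t) - (ep0 * hy - de0 * (w * y t)))
    with ((ep * (hz - hy) + - (de * (w * (z t - y t))))
          + ((ep - ep0) * hy + - ((de - de0) * (w * y t)))) by ring.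
  assert (Rabs (ep * (hz - hy)) <= M * (Lh * Rabs (z t - y t))).
  { rewrite Rabs_mult. apply Rmult_le_compat; try apply Rabs_pos; trivial.
    eapply Rle_trans; [exact Hh|]. apply Rmult_le_compat_l; trivial. }
  assert (Rabs (- (de * (w * (z t - y t)))) <= M * (B * Rabs (z t - y t))).
  { rewrite Rabs_Ropp, !Rabs_mult, (Rabs_pos_eq w) by lra.
    pose proof (Rabs_pos (z t - y t)).
    apply Rmult_le_compat; try apply Rabs_pos; trivial; [nra|].
    apply Rmult_le_compat_r; lra. }
  assert (Rabs ((ep - ep0) * hy) <= Rabs (ep - ep0) * A).
  { rewrite Rabs_mult, (Rabs_pos_eq hy) by lra.
    apply Rmult_le_compat_l; [apply Rabs_pos|]. unfold A. nra. }
  assert (Rabs (- ((de - de0) * (w * y t))) <= Rabs (de - de0) * A).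
  { rewrite Rabs_Ropp, Rabs_mult, (Rabs_pos_eq (w * y t)) by nra.
    apply Rmult_le_compat_l; [apply Rabs_pos|]. unfold A.
    pose proof (Rpower_pos Y p). nra. }
  eapply Rle_trans; [apply Rabs_triang|].
  pose proof (Rabs_triang (ep * (hz - hy)) (- (de * (w * (z t - y t))))).
  pose proof (Rabs_triang ((ep - ep0) * hy) (- ((de - de0) * (w * y t)))).
  unfold L, D. lra.
- rewrite (proj1 (Hy3 0 ltac:(lra))). apply Hz3; lra.
- rewrite (proj2 (Hy3 0 ltac:(lra))). apply Hz3; lra.
Qed.

Lemma positive_solution_range (de ep : R) (y d : R -> R) (X b : R) :
  positive_solution n p sg de ep y d X -> 0 <= b < X ->
  exists eta Y, 0 < eta /\ eta <= Y /\ forall x, 0 <= x <= b -> eta <= y x <= Y.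
Proof.
intros Hy Hb.
assert (Hc : forall x, 0 <= x <= b -> continuous y x).
{ intros x Hx. eapply is_derive_continuous, (proj1 Hy). lra. }
destruct (positive_min y 0 b (proj1 Hb) Hc) as [eta [He Hm]].
{ intros x Hx. eapply positive_solution_pos; [exact Hy|lra]. }
destruct (bounded_on y 0 b (proj1 Hb) Hc) as [Y [HY HM]].
assert (Hr : forall x, 0 <= x <= b -> eta <= y x <= Y).
{ intros x Hx. split; [apply Hm; trivial|].
  eapply Rle_trans; [apply Rle_abs|apply HM; trivial]. }
exists eta, Y. split; [|split]; trivial. specialize (Hr 0 ltac:(lra)). lra.
Qed.

(** The dependence estimate for equal parameters. *)
Lemma truncated_solution_eq (de ep eta : R) (y d z dz : R -> R) (X X0 b : R) :
  0 < eta -> 0 < b -> b < X -> b <= X0 ->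
  positive_solution n p sg de ep y d X -> truncated_solution n p sg de ep eta z dz X0 ->
  (forall x, 0 <= x <= b -> eta <= y x) ->
  forall x, 0 <= x <= b -> z x = y x /\ dz x = d x.
Proof.
intros He Hb HbX HbX0 Hy Hz Hr x Hx.
destruct (positive_solution_range _ _ _ _ _ b Hy ltac:(lra)) as [e [Y [_ [_ HY]]]].
assert (HeY : eta <= Y).
{ specialize (Hr 0 ltac:(lra)). specialize (HY 0 ltac:(lra)). lra. }
destruct (dependence_estimate eta (Rabs ep + Rabs de) b Y) as [C [HC HE]]; trivial.
{ pose proof (Rabs_pos ep); pose proof (Rabs_pos de); lra. }
specialize (HE de ep de ep y d z dz X X0).
destruct (HE ltac:(pose proof (Rabs_pos de); lra) ltac:(pose proof (Rabs_pos ep); lra)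
             HbX HbX0 Hy Hz) with (x := x) as [H1 H2]; trivial.
{ intros t Ht. split; [apply Hr|apply HY]; trivial. }
rewrite !Rminus_diag, Rabs_R0, Rplus_0_l, Rmult_0_r in H1, H2.
split; apply Rminus_diag_uniq, NNPP; intros Hn; apply Rabs_pos_lt in Hn; lra.
Qed.

(** Both solutions have positive minima on [[0, x]], hence both agree with one truncated solution
    whose cutoff lies below these minima. *)
Lemma positive_solution_unique (de ep : R) (y1 d1 y2 d2 : R -> R) (X1 X2 x : R) :
  positive_solution n p sg de ep y1 d1 X1 -> positive_solution n p sg de ep y2 d2 X2 ->
  x < X1 -> x < X2 -> y1 x = y2 x /\ d1 x = d2 x.
Proof.
intros H1 H2 Hx1 Hx2. destruct (Rle_dec x 0) as [Hx|Hx].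
{ destruct (proj1 (proj2 (proj2 H1)) x Hx) as [-> ->].
  destruct (proj1 (proj2 (proj2 H2)) x Hx) as [-> ->]. split; reflexivity. }
destruct (positive_solution_range _ _ _ _ _ x H1 ltac:(lra)) as [e1 [Y1 [He1 [_ Hr1]]]].
destruct (positive_solution_range _ _ _ _ _ x H2 ltac:(lra)) as [e2 [Y2 [He2 [_ Hr2]]]].
assert (He : 0 < Rmin e1 e2) by (apply Rmin_pos; trivial).
destruct (truncated_solution_exists n p sg de ep (Rmin e1 e2) x Hp Hsg He ltac:(lra))
  as [z [dz Hz]].
destruct (truncated_solution_eq de ep (Rmin e1 e2) y1 d1 z dz X1 x x) with (x := x)
  as [E1 E2]; trivial; try lra.
{ intros t Ht. specialize (Hr1 t Ht). pose proof (Rmin_l e1 e2). lra. }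
destruct (truncated_solution_eq de ep (Rmin e1 e2) y2 d2 z dz X2 x x) with (x := x)
  as [E3 E4]; trivial; try lra.
{ intros t Ht. specialize (Hr2 t Ht). pose proof (Rmin_r e1 e2). lra. }
Qed.

Lemma truncated_solution_above (de ep eta : R) (z dz : R -> R) (X X0 : R) :
  0 < eta -> 0 <= X < X0 -> truncated_solution n p sg de ep eta z dz X0 ->
  (forall x, 0 < x < X -> 2 * eta <= z x) -> 2 * eta <= z X ->
  exists X', X < X' /\ positive_solution n p sg de ep z dz X'.
Proof.
intros He HX Hz Hr HzX.
assert (Hc : continuous z X) by exact (is_derive_continuous _ _ _ (proj1 Hz X)).
destruct (continuous_epsilon z X eta Hc He) as [del [Hdel Hn]].
exists (Rmin X0 (X + del)). split; [apply Rmin_glb_lt; lra|].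
apply truncated_positive_solution with eta X0; trivial; [apply Rmin_l|].
intros x Hx. destruct (Rlt_dec x X) as [H|H].
- specialize (Hr x ltac:(lra)). lra.
- assert (x < X + del) by (eapply Rlt_le_trans; [apply Hx|apply Rmin_r]).
  specialize (Hn x). rewrite Rabs_pos_eq in Hn by lra.
  specialize (Hn ltac:(lra)). apply Rabs_def2 in Hn. lra.
Qed.

Lemma positive_solution_local (de ep : R) :
  exists X y d, 0 < X /\ positive_solution n p sg de ep y d X.
Proof.
destruct (truncated_solution_exists n p sg de ep (/ 2) 1 Hp Hsg ltac:(lra) ltac:(lra))
  as [z [dz Hz]].
destruct (truncated_solution_above de ep (/ 2) z dz 0 1) as [X [HX HX']]; trivial; try lra.
- intros; lra.
- rewrite (proj1 (proj1 (proj2 (proj2 Hz)) 0 ltac:(lra))). lra.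
- exists X, z, dz. split; trivial.
Qed.

(** The truncated solution with cutoff [eta / 4] coincides with [y] before [X] and runs past [X]. By
    continuity [z X >= eta / 2], twice the cutoff. *)
Lemma positive_solution_extend (de ep eta : R) (y d : R -> R) (X : R) :
  0 < eta -> 0 < X -> positive_solution n p sg de ep y d X ->
  (forall x, 0 <= x < X -> eta <= y x) ->
  exists X' z dz, X < X' /\ positive_solution n p sg de ep z dz X'.
Proof.
intros He HX Hy Hr.
destruct (truncated_solution_exists n p sg de ep (eta / 4) (X + 1) Hp Hsg ltac:(lra) ltac:(lra))
  as [z [dz Hz]].
assert (Hzy : forall x, 0 <= x < X -> eta <= z x).
{ intros x Hx. rewrite (proj1 (truncated_solution_eq de ep (eta / 4) y d z dz X (X + 1)
    ((x + X) / 2) ltac:(lra) ltac:(lra) ltac:(lra) ltac:(lra) Hy Hz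
    ltac:(intros t Ht; specialize (Hr t ltac:(lra)); lra) x ltac:(lra))).
  apply Hr; trivial. }
assert (HzX : eta / 2 <= z X).
{ assert (Hc : continuous z X) by exact (is_derive_continuous _ _ _ (proj1 Hz X)).
  destruct (continuous_epsilon z X (eta / 4) Hc ltac:(lra)) as [del [Hdel Hn]].
  pose proof (Rmin_l del X). pose proof (Rmin_r del X).
  assert (0 < Rmin del X) by (apply Rmin_pos; trivial).
  set (t := X - Rmin del X / 2). assert (0 <= t < X) by (unfold t; lra).
  specialize (Hzy t ltac:(lra)). specialize (Hn t).
  replace (t - X) with (- (Rmin del X / 2)) in Hn by (unfold t; ring).
  rewrite Rabs_Ropp, Rabs_pos_eq in Hn by lra. specialize (Hn ltac:(lra)).
  apply Rabs_def2 in Hn. lra. }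
destruct (truncated_solution_above de ep (eta / 4) z dz X (X + 1)) as [X' [HX1 HX2]];
  trivial; try lra.
- intros x Hx. specialize (Hzy x ltac:(lra)). lra.
- exists X', z, dz. split; trivial.
Qed.

(** By uniqueness the value at [x] is the same for all solutions that reach beyond [x], so choosing
    it pointwise defines one function that agrees locally with each of them. *)
Lemma positive_solution_glue (de ep : R) (D : R -> Prop) :
  (forall X, D X -> 0 < X /\ exists y d, positive_solution n p sg de ep y d X) ->
  exists y d, forall X, D X -> positive_solution n p sg de ep y d X.
Proof.
intros HD.
set (Q := fun (x : R) (v : R * R) => forall X y d, D X -> x < X ->
            positive_solution n p sg de ep y d X -> v = (y x, d x)).
assert (HQ : forall x, exists v, Q x v).
{ intros x. destruct (classic (exists X, D X /\ x < X)) as [[X [HX Hx]]|Hno].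
  - destruct (HD X HX) as [_ [y [d Hy]]]. exists (y x, d x). intros X' y' d' HX' Hx' Hy'.
    destruct (positive_solution_unique _ _ _ _ _ _ _ _ x Hy Hy' Hx Hx') as [-> ->].
    reflexivity.
  - exists (0, 0). intros X y d HX Hx. exfalso. apply Hno. exists X; split; trivial. }
destruct (choice Q HQ) as [v Hv].
exists (fun x => fst (v x)), (fun x => snd (v x)).
intros X HX. destruct (HD X HX) as [HX0 [y [d Hy]]].
assert (Heq : forall x, x < X -> v x = (y x, d x)).
{ intros x Hx. apply (Hv x X y d); trivial. }
assert (Hloc : forall x, x < X -> locally x (fun t => v t = (y t, d t))).
{ intros x Hx. apply (locally_between _ (x - 1) X); [lra|]. intros t Ht. apply Heq. lra. }
destruct Hy as [H1 [H2 [H3 H4]]]. split; [|split; [|split]].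
- intros x Hx. rewrite (Heq x Hx). simpl. apply is_derive_ext_loc with y; [|apply H1; trivial].
  generalize (Hloc x Hx). apply filter_imp. intros t ->. reflexivity.
- intros x Hx. apply continuous_ext_loc with d; [|apply H2; trivial].
  generalize (Hloc x Hx). apply filter_imp. intros t ->. reflexivity.
- intros x Hx. rewrite Heq by lra. apply H3; trivial.
- intros x Hx. rewrite (Heq x (proj2 Hx)). simpl. split; [apply H4; trivial|].
  apply is_derive_ext_loc with d; [|apply H4; trivial].
  generalize (Hloc x (proj2 Hx)). apply filter_imp. intros t ->. reflexivity.
Qed.

(** If the lifetimes are bounded, gluing produces a solution up to their supremum [T]; a positive
    lower bound for it would allow an extension past [T]. *)
Lemma maximal_positive_solution (de ep : R) :
  exists y d,
    (forall X, positive_solution n p sg de ep y d X) \/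
    exists T, 0 < T /\ positive_solution n p sg de ep y d T /\
      forall eta, 0 < eta -> exists x, 0 <= x < T /\ y x < eta.
Proof.
set (S := fun X => exists y d, positive_solution n p sg de ep y d X).
destruct (positive_solution_local de ep) as [X0 [y0 [d0 [HX0 Hy0]]]].
destruct (classic (exists B, is_upper_bound S B)) as [HB|HB].
- destruct (completeness S HB) as [T [HT1 HT2]].
  { exists X0, y0, d0. exact Hy0. }
  assert (HT0 : X0 <= T) by (apply HT1; exists y0, d0; exact Hy0).
  assert (HS : forall X, X < T -> S X).
  { intros X HX. apply NNPP. intros Hn.
    assert (T <= X); [|lra]. apply HT2. intros X1 [y1 [d1 H1]].
    apply Rnot_lt_le. intros Hlt. apply Hn. exists y1, d1.
    apply positive_solution_le with X1; trivial; lra. }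
  destruct (positive_solution_glue de ep (fun X => 0 < X < T)) as [y [d Hy]].
  { intros X HX. split; [lra|apply HS; lra]. }
  assert (HyT : positive_solution n p sg de ep y d T).
  { split; [|split; [|split]].
    - intros x Hx. pose proof (Rmax_l 0 x). pose proof (Rmax_r 0 x).
      assert (Rmax 0 x < T) by (apply Rmax_lub_lt; lra).
      apply (proj1 (Hy ((Rmax 0 x + T) / 2) ltac:(lra))); lra.
    - intros x Hx. pose proof (Rmax_l 0 x). pose proof (Rmax_r 0 x).
      assert (Rmax 0 x < T) by (apply Rmax_lub_lt; lra).
      apply (proj1 (proj2 (Hy ((Rmax 0 x + T) / 2) ltac:(lra)))); lra.
    - exact (proj1 (proj2 (proj2 (Hy (T / 2) ltac:(lra))))).
    - intros x Hx. apply (proj2 (proj2 (proj2 (Hy ((x + T) / 2) ltac:(lra))))); lra. }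
  exists y, d. right. exists T. split; [lra|]. split; trivial.
  intros eta He. apply NNPP. intros Hn.
  destruct (positive_solution_extend de ep eta y d T He ltac:(lra) HyT)
    as [X' [z [dz [HX' Hz]]]].
  { intros x Hx. apply Rnot_lt_le. intros Hlt. apply Hn. exists x. split; trivial. }
  assert (X' <= T); [|lra]. apply HT1. exists z, dz. exact Hz.
- destruct (positive_solution_glue de ep (fun X => 0 < X)) as [y [d Hy]].
  { intros X HX. split; trivial. apply NNPP. intros Hn. apply HB. exists X.
    intros X1 [y1 [d1 H1]]. apply Rnot_lt_le. intros Hlt. apply Hn. exists y1, d1.
    apply positive_solution_le with X1; trivial; lra. }
  exists y, d. left. intros X. apply positive_solution_le with (Rmax 1 X).
  + apply Rmax_r.
  + apply Hy. eapply Rlt_le_trans; [apply Rlt_0_1|apply Rmax_l].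
Qed.

Lemma positive_solution_dependence (de0 ep0 : R) (y0 d0 : R -> R) (X b : R) :
  positive_solution n p sg de0 ep0 y0 d0 X -> 0 < b < X ->
  exists kap C, 0 < kap /\ 0 <= C /\
    forall de ep, Rabs (ep - ep0) + Rabs (de - de0) < kap ->
    exists y d, positive_solution n p sg de ep y d b /\
      forall x, 0 <= x <= b ->
        Rabs (y x - y0 x) <= C * (Rabs (ep - ep0) + Rabs (de - de0)) /\
        Rabs (d x - d0 x) <= C * (Rabs (ep - ep0) + Rabs (de - de0)).
Proof.
intros Hy0 Hb.
destruct (positive_solution_range _ _ _ _ _ b Hy0 ltac:(lra)) as [e [Y [He [HeY Hr]]]].
set (M := Rabs ep0 + Rabs de0 + 1).
pose proof (Rabs_pos ep0). pose proof (Rabs_pos de0).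
destruct (dependence_estimate (e / 2) M b Y) as [C [HC HE]]; try (unfold M; lra).
(* The bound [1] keeps the parameters within [M]. The other one makes the perturbation at most
   [e / 2], so the truncated solution stays above its cutoff [e / 2] and is a positive solution. *)
exists (Rmin 1 (e / 2 / (C + 1))), C.
assert (Hk : 0 < e / 2 / (C + 1)) by (apply Rdiv_lt_0_compat; lra).
split; [apply Rmin_pos; lra|]. split; trivial.
intros de ep Hlt. set (D := Rabs (ep - ep0) + Rabs (de - de0)) in *.
assert (HD1 : D < 1) by (eapply Rlt_le_trans; [exact Hlt|apply Rmin_l]).
assert (HD2 : D < e / 2 / (C + 1)) by (eapply Rlt_le_trans; [exact Hlt|apply Rmin_r]).
pose proof (Rabs_pos (ep - ep0)). pose proof (Rabs_pos (de - de0)).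
assert (HD0 : 0 <= D) by (unfold D; lra).
assert (HCD : C * D <= e / 2).
{ apply Rle_trans with ((C + 1) * (e / 2 / (C + 1))); [|right; field; lra].
  apply Rmult_le_compat; lra. }
destruct (truncated_solution_exists n p sg de ep (e / 2) b Hp Hsg ltac:(lra) ltac:(lra))
  as [z [dz Hz]].
assert (Hclose : forall x, 0 <= x <= b -> Rabs (z x - y0 x) <= C * D /\
                                          Rabs (dz x - d0 x) <= C * D).
{ apply (HE de ep de0 ep0 y0 d0 z dz X b); trivial; try lra.
  - pose proof (Rabs_triang (ep - ep0) ep0) as Ht.
    replace (ep - ep0 + ep0) with ep in Ht by ring. unfold D in HD1. unfold M. lra.
  - pose proof (Rabs_triang (de - de0) de0) as Ht.
    replace (de - de0 + de0) with de in Ht by ring. unfold D in HD1. unfold M. lra.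
  - intros x Hx. specialize (Hr x Hx). lra. }
exists z, dz. split; [|exact Hclose].
apply truncated_positive_solution with (e / 2) b; trivial; try lra.
intros x Hx. specialize (Hr x ltac:(lra)).
destruct (Hclose x ltac:(lra)) as [Hz1 _].
pose proof (Rabs_def2 (y0 x - z x) (e / 2 + 1)) as _.
assert (y0 x - z x <= e / 2); [|lra].
eapply Rle_trans; [apply Rle_abs|]. rewrite Rabs_minus_sym. lra.
Qed.

End PositiveSolutions.

(** * The energy *)

Section Energy.
Context (al K p sg de ep : R).
Context (Hp : 0 < p < 1) (Hal : 0 < al < 1) (HK : 0 < K) (Hsg : 0 <= sg <= 2 * al)
        (Hde : 0 <= de) (Hep : 0 <= ep).

Definition potential (x : R) : R :=
  de * Rpower x (sg - 2 * al) + K * Rpower x (- 2 * al - 2).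

Definition potential_slope (x : R) : R :=
  (de * (sg - 2 * al) * Rpower x (sg - 2 * al)
   + K * (- 2 * al - 2) * Rpower x (- 2 * al - 2)) / x.

Definition energy (v s x : R) : R :=
  s * s / 2 + potential x * (v * v) / 2 - ep / (p + 1) * Rpower v (p + 1).

(* [s] is the derivative of [v] in the time [tau] with [dtau = x ^ al dx]. *)
Definition oscillator (v s : R -> R) (a b : R) : Prop :=
  forall x, a < x < b ->
    0 < v x /\ is_derive v x (Rpower x al * s x) /\
    is_derive s x (Rpower x al * (ep * Rpower (v x) p - potential x * v x)).

Lemma potential_pos (x : R) : 0 < potential x.
Proof.
unfold potential. pose proof (Rpower_pos x (sg - 2 * al)).
pose proof (Rpower_pos x (- 2 * al - 2)). nra.
Qed.

(** Strictness comes from the term with [K]; the other one is only nonpositive and vanishes if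
    [de = 0] or [sg = 2 * al]. *)
Lemma potential_slope_neg (x : R) : 0 < x -> potential_slope x < 0.
Proof.
intros Hx. unfold potential_slope. apply Ropp_lt_cancel. rewrite Ropp_0.
pose proof (Rpower_pos x (sg - 2 * al)). pose proof (Rpower_pos x (- 2 * al - 2)).
set (A := Rpower x (sg - 2 * al)) in *. set (B := Rpower x (- 2 * al - 2)) in *.
assert (0 <= de * (2 * al - sg) * A).
{ apply Rmult_le_pos; [apply Rmult_le_pos|]; lra. }
assert (0 < K * (2 * al + 2) * B).
{ apply Rmult_lt_0_compat; [apply Rmult_lt_0_compat|]; lra. }
replace (- ((de * (sg - 2 * al) * A + K * (-2 * al - 2) * B) / x))
  with ((de * (2 * al - sg) * A + K * (2 * al + 2) * B) / x) by (field; lra).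
apply Rdiv_lt_0_compat; lra.
Qed.

Lemma is_derive_potential (x : R) : 0 < x -> is_derive potential x (potential_slope x).
Proof.
intros Hx. eapply is_derive_eq.
- apply is_derive_Rplus; apply is_derive_Rscal; apply is_derive_Rpower; trivial.
- unfold potential_slope. field. lra.
Qed.

(** All terms containing [s] cancel along the oscillator, so only the explicit dependence of the
    potential on [x] survives. *)
Lemma is_derive_energy (v s : R -> R) (a b x : R) :
  oscillator v s a b -> a < x < b -> 0 < x ->
  is_derive (fun t => energy (v t) (s t) t) x (potential_slope x * (v x * v x) / 2).
Proof.
intros Ho Hx Hx0. destruct (Ho x Hx) as [Hv [Dv Ds]].
assert (Hvp : Rpower (v x) (p + 1) = Rpower (v x) p * v x).
{ rewrite Rpower_plus, Rpower_1; trivial. }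
assert (D1 := is_derive_Rmult _ _ _ _ _ Ds Ds).
assert (D2 := is_derive_Rmult _ _ _ _ _ (is_derive_potential x Hx0)
                (is_derive_Rmult _ _ _ _ _ Dv Dv)).
assert (D3 := is_derive_Rcomp (fun t => Rpower t (p + 1)) v x _ _
                (is_derive_Rpower (p + 1) (v x) Hv) Dv).
assert (D4 := is_derive_Rplus _ _ _ _ _
  (is_derive_Rmult _ _ _ _ _ D1 (is_derive_Rconst (/ 2) x))
  (is_derive_Rmult _ _ _ _ _ D2 (is_derive_Rconst (/ 2) x))).
eapply is_derive_eq.
- exact (is_derive_Rminus _ _ _ _ _ D4 (is_derive_Rscal _ _ _ (ep / (p + 1)) D3)).
- simpl. rewrite Hvp. field. lra.
Qed.

Lemma energy_decreasing (v s : R -> R) (a b x1 x2 : R) :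
  oscillator v s a b -> 0 <= a -> a < x1 -> x1 < x2 -> x2 < b ->
  energy (v x2) (s x2) x2 < energy (v x1) (s x1) x1.
Proof.
intros Ho Ha H1 H2 H3.
apply (strictly_decreasing_on (fun t => energy (v t) (s t) t)
         (fun x => potential_slope x * (v x * v x) / 2)); trivial.
- intros x Hx. eapply is_derive_continuous, is_derive_energy; [exact Ho|lra|lra].
- intros x Hx. eapply is_derive_energy; [exact Ho|lra|lra].
- intros x Hx. pose proof (potential_slope_neg x ltac:(lra)).
  destruct (Ho x ltac:(lra)) as [Hv _].
  assert (0 < v x * v x) by nra.
  assert (0 < - potential_slope x * (v x * v x)) by (apply Rmult_lt_0_compat; lra). lra.
Qed.

(** Nonnegative energy bounds [ep * v ^ (p + 1)] by [(p + 1) / 2] times the quadratic terms. Since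
    [(p + 1) / 2 < 1], the fraction [(1 - p) / 2] of these is left over. *)
Lemma energy_nonneg_bound (v s x : R) :
  0 < v -> 0 <= energy v s x ->
  ep * Rpower v p * v - potential x * (v * v) - s * s
    <= - ((1 - p) / 2) * (s * s + potential x * (v * v)).
Proof.
intros Hv HE. unfold energy in HE. rewrite Rpower_plus, Rpower_1 in HE by trivial.
assert (H : ep * Rpower v p * v <= (p + 1) * (s * s / 2 + potential x * (v * v) / 2)).
{ apply Rle_trans with ((p + 1) * (ep / (p + 1) * (Rpower v p * v))).
  - right. field. lra.
  - apply Rmult_le_compat_l; lra. }
lra.
Qed.

Lemma is_derive_ratio (v s : R -> R) (a b x : R) :
  oscillator v s a b -> a < x < b ->
  is_derive (fun t => s t / v t) x
    (Rpower x al * ((ep * Rpower (v x) p * v x - potential x * (v x * v x) - s x * s x)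
                    / (v x * v x))).
Proof.
intros Ho Hx. destruct (Ho x Hx) as [Hv [Dv Ds]].
eapply is_derive_eq.
- apply is_derive_Rdiv; [exact Ds|exact Dv|lra].
- field. lra.
Qed.

(* The term [s * s] only helps: this weakens the Riccati inequality
   [r' <= - (1 - p) / 2 * x ^ al * (r ^ 2 + potential)] for [r = s / v]. *)
Lemma ratio_slope_bound (v s x : R) :
  0 < v -> 0 <= energy v s x ->
  Rpower x al * ((ep * Rpower v p * v - potential x * (v * v) - s * s) / (v * v))
    <= - ((1 - p) / 2) * (Rpower x al * potential x).
Proof.
intros Hv HE. assert (H := energy_nonneg_bound v s x Hv HE).
assert (Hvv : 0 < v * v) by nra.
assert (H1 : (ep * Rpower v p * v - potential x * (v * v) - s * s) / (v * v)
             <= - ((1 - p) / 2) * potential x).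
{ apply Rmult_le_reg_r with (v * v); trivial. unfold Rdiv at 1.
  rewrite Rmult_assoc, Rinv_l, Rmult_1_r by lra. 
  assert (0 <= (1 - p) / 2 * (s * s)) by (apply Rmult_le_pos; nra). lra. }
pose proof (Rpower_pos x al).
apply Rmult_le_compat_l with (r := Rpower x al) in H1; lra.
Qed.

Lemma ratio_decreasing (v s : R -> R) (a b x1 x2 : R) :
  oscillator v s a b -> a < x1 -> x1 <= x2 -> x2 < b ->
  (forall x, x1 <= x <= x2 -> 0 <= energy (v x) (s x) x) ->
  s x2 / v x2 <= s x1 / v x1.
Proof.
intros Ho H1 H2 H3 HE.
apply (decreasing_on (fun t => s t / v t) (fun x => Rpower x al *
    ((ep * Rpower (v x) p * v x - potential x * (v x * v x) - s x * s x) / (v x * v x))));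
  trivial.
- intros x Hx. eapply is_derive_continuous, is_derive_ratio; [exact Ho|lra].
- intros x Hx. eapply is_derive_ratio; [exact Ho|lra].
- intros x Hx. eapply Rle_trans; [apply ratio_slope_bound|].
  + apply Ho; lra.
  + apply HE; lra.
  + pose proof (Rpower_pos x al). pose proof (potential_pos x).
    assert (0 <= (1 - p) / 2 * (Rpower x al * potential x)).
    { apply Rmult_le_pos; [lra|]. apply Rmult_le_pos; lra. }
    lra.
Qed.

Lemma ratio_negative (v s : R -> R) (a b x1 x2 : R) :
  oscillator v s a b -> a < x1 -> x1 <= x2 -> x2 < b ->
  (forall x, x1 <= x <= x2 -> 0 <= energy (v x) (s x) x) ->
  s x1 < 0 -> s x2 < 0.
Proof.
intros Ho H1 H2 H3 HE Hs.
assert (Hr := ratio_decreasing v s a b x1 x2 Ho H1 H2 H3 HE).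
destruct (Ho x1 ltac:(lra)) as [Hv1 _]. destruct (Ho x2 ltac:(lra)) as [Hv2 _].
assert (Hn : s x1 / v x1 < 0).
{ apply Rmult_lt_reg_r with (v x1); trivial. unfold Rdiv.
  rewrite Rmult_assoc, Rinv_l by lra. lra. }
replace (s x2) with (s x2 / v x2 * v x2) by (field; lra). nra.
Qed.

(* Here the term [r ^ 2] of the Riccati inequality is used: [1 / r] has slope at least
   [(1 - p) / 2 * x ^ al]. *)
Lemma extinction_bound (v s : R -> R) (a b x1 x2 : R) :
  oscillator v s a b -> 0 <= a -> a < x1 -> x1 < x2 -> x2 < b ->
  (forall x, x1 <= x <= x2 -> 0 <= energy (v x) (s x) x) ->
  s x1 < 0 ->
  (1 - p) / 2 * Rpower x1 al * (x2 - x1) <= v x1 / - s x1.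
Proof.
intros Ho Ha H1 H2 H3 HE Hs.
assert (Hneg : forall x, x1 <= x <= x2 -> s x < 0).
{ intros x Hx. eapply ratio_negative with (x1 := x1); [exact Ho| | | | |exact Hs]; try lra.
  intros t Ht; apply HE; lra. }
set (c := (1 - p) / 2 * Rpower x1 al).
assert (HW : (fun t => c * t - v t / s t) x2 <= (fun t => c * t - v t / s t) x1).
{ assert (HD : forall t, x1 <= t <= x2 -> is_derive (fun t => c * t - v t / s t) t
     (c + Rpower t al * ((ep * Rpower (v t) p * v t - potential t * (v t * v t) - s t * s t)
                    / (s t * s t)))).
  { intros t Ht. destruct (Ho t ltac:(lra)) as [Hv [Dv Ds]]. specialize (Hneg t Ht).
    eapply is_derive_eq.
    - apply is_derive_Rminus.
      + apply is_derive_Rscal. apply (is_derive_id (K:=R_AbsRing)).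
      + apply is_derive_Rdiv; [exact Dv|exact Ds|lra].
    - unfold one; simpl. field. lra. }
  apply (decreasing_on (fun t => c * t - v t / s t) (fun t =>
    (c + Rpower t al * ((ep * Rpower (v t) p * v t - potential t * (v t * v t) - s t * s t)
                    / (s t * s t)))) x1 x2); [lra| | |].
  - intros t Ht. eapply is_derive_continuous, HD, Ht.
  - intros t Ht. apply HD; lra.
  - intros t Ht. destruct (Ho t ltac:(lra)) as [Hv _]. specialize (Hneg t ltac:(lra)).
    assert (H := energy_nonneg_bound (v t) (s t) t Hv (HE t ltac:(lra))).
    assert (Hss : 0 < s t * s t) by nra.
    assert (H4 : (ep * Rpower (v t) p * v t - potential t * (v t * v t) - s t * s t)
                    / (s t * s t) <= - ((1 - p) / 2)).
    { apply Rmult_le_reg_r with (s t * s t); trivial. unfold Rdiv at 1.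
      rewrite Rmult_assoc, Rinv_l, Rmult_1_r by lra.
      pose proof (potential_pos t).
      assert (0 <= (1 - p) / 2 * (potential t * (v t * v t))).
      { apply Rmult_le_pos; [lra|]. apply Rmult_le_pos; nra. }
      lra. }
    assert (H5 : Rpower x1 al <= Rpower t al) by (apply Rle_Rpower_l; lra).
    pose proof (Rpower_pos x1 al).
    apply Rmult_le_compat_l with (r := Rpower t al) in H4; [|lra].
    unfold c. assert ((1 - p) / 2 * Rpower x1 al <= (1 - p) / 2 * Rpower t al).
    { apply Rmult_le_compat_l; lra. }
    lra. }
simpl in HW.
assert (Hp2 : 0 < - (v x2 / s x2)).
{ destruct (Ho x2 ltac:(lra)) as [Hv _]. specialize (Hneg x2 ltac:(lra)).
  replace (- (v x2 / s x2)) with (v x2 / - s x2) by (field; lra).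
  apply Rdiv_lt_0_compat; lra. }
replace (v x1 / - s x1) with (- (v x1 / s x1)) by (field; lra). lra.
Qed.

(** The integral of [x ^ al * potential] diverges at infinity at least like [de * ln x], which
    drives [s / v] below [0]; from then on [extinction_bound] allows only a finite further
    length. *)
Lemma no_global_nonneg_energy (v s : R -> R) :
  0 < de -> (forall b, oscillator v s 0 b) ->
  (forall x, 0 < x -> 0 <= energy (v x) (s x) x) -> False.
Proof.
intros Hde0 Ho HE.
set (c := (1 - p) / 2 * de). assert (Hc : 0 < c) by (unfold c; nra).
assert (HW : forall x, 1 <= x -> s x / v x + c * ln x <= s 1 / v 1).
{ intros x Hx.
  assert (HD : forall t, 1 <= t <= x -> is_derive (fun t => s t / v t + c * ln t) t
     (Rpower t al * ((ep * Rpower (v t) p * v t - potential t * (v t * v t) - s t * s t)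
                    / (v t * v t)) + c * / t)).
  { intros t Ht. apply is_derive_Rplus.
    - apply (is_derive_ratio v s 0 (t + 1)); [apply Ho|lra].
    - apply is_derive_Rscal. apply is_derive_ln. lra. }
  replace (s 1 / v 1) with (s 1 / v 1 + c * ln 1) by (rewrite ln_1; ring).
  apply (decreasing_on (fun t => s t / v t + c * ln t)
    (fun t => Rpower t al * ((ep * Rpower (v t) p * v t - potential t * (v t * v t)
       - s t * s t) / (v t * v t)) + c * / t)); trivial.
  - intros t Ht. eapply is_derive_continuous, HD, Ht.
  - intros t Ht. apply HD; lra.
  - intros t Ht.
    assert (H := ratio_slope_bound (v t) (s t) t (proj1 (Ho (t + 1) t ltac:(lra)))
                   (HE t ltac:(lra))).
    (* The reaction part is [de * t ^ (sg - al)], and [sg - al >= -1] because [al < 1]. *)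
    assert (H1 : de * / t <= Rpower t al * potential t).
    { unfold potential. rewrite Rmult_plus_distr_l.
      assert (0 <= Rpower t al * (K * Rpower t (- 2 * al - 2))).
      { pose proof (Rpower_pos t al). pose proof (Rpower_pos t (- 2 * al - 2)).
        apply Rmult_le_pos; nra. }
      assert (de * / t <= Rpower t al * (de * Rpower t (sg - 2 * al))); [|lra].
      replace (Rpower t al * (de * Rpower t (sg - 2 * al)))
        with (de * Rpower t (sg - al)).
      2:{ replace (sg - al) with (al + (sg - 2 * al)) by ring. rewrite Rpower_plus. ring. }
      apply Rmult_le_compat_l; trivial.
      replace (/ t) with (Rpower t (- (1))).
      2:{ rewrite Rpower_Ropp, Rpower_1 by lra. reflexivity. }
      apply Rle_Rpower; lra. }
    apply Rmult_le_compat_l with (r := (1 - p) / 2) in H1; [|lra].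
    unfold c. lra. }
set (x1 := exp (Rabs (s 1 / v 1) / c + 1)).
assert (Hx1 : 1 <= x1).
{ unfold x1. rewrite <- exp_0 at 1. left. apply exp_increasing.
  assert (0 <= Rabs (s 1 / v 1) / c) by (apply Rdiv_le_0_compat; [apply Rabs_pos|lra]). lra. }
assert (Hr1 : s x1 / v x1 < 0).
{ specialize (HW x1 Hx1). unfold x1 in HW at 3. rewrite ln_exp in HW.
  replace (c * (Rabs (s 1 / v 1) / c + 1)) with (Rabs (s 1 / v 1) + c) in HW by (field; lra).
  pose proof (Rle_abs (s 1 / v 1)). lra. }
assert (Hv1 : 0 < v x1) by (apply (Ho (x1 + 1)); lra).
assert (Hs1 : s x1 < 0).
{ replace (s x1) with (s x1 / v x1 * v x1) by (field; lra). nra. }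
set (e := (1 - p) / 2 * Rpower x1 al).
assert (He : 0 < e) by (unfold e; pose proof (Rpower_pos x1 al); nra).
assert (Hq : 0 < v x1 / - s x1) by (apply Rdiv_lt_0_compat; lra).
(* Farther than [extinction_bound] permits, by the length [1 / e]. *)
set (x2 := x1 + (v x1 / - s x1 + 1) / e).
assert (Hx2 : x1 < x2).
{ unfold x2. assert (0 < (v x1 / - s x1 + 1) / e) by (apply Rdiv_lt_0_compat; lra). lra. }
assert (H := extinction_bound v s 0 (x2 + 1) x1 x2 (Ho _) ltac:(lra) ltac:(lra) Hx2 ltac:(lra)
  ltac:(intros; apply HE; lra) Hs1).
fold e in H. unfold x2 in H.
replace (e * (x1 + (v x1 / - s x1 + 1) / e - x1)) with (v x1 / - s x1 + 1) in H
  by (field; lra).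
lra.
Qed.

End Energy.

(** * The change of unknown that removes the damping *)

Section Transformation.
Context (nu p sg de ep : R).
Context (Hnu : 1 <= nu <= 2) (Hp : 0 < p < 1).

(* The exponents solve [2 * expo_v - expo_t = nu], which removes the damping, and
   [expo_v * (1 - p) = 2 * expo_t], which makes the coefficient of [v ^ p] constant;
   [expo_s = expo_v - expo_t], and [2 * expo_t] is [sigma_c]. *)
Definition expo_v : R := 2 * nu / (3 + p).
Definition expo_t : R := nu * (1 - p) / (3 + p).
Definition expo_s : R := nu * (1 + p) / (3 + p).
Definition hardy : R := expo_v * (expo_v + 1 - nu).

Lemma expo_t_range : 0 < expo_t < 1.
Proof.
unfold expo_t. split.
- apply Rdiv_lt_0_compat; nra.
- apply Rmult_lt_reg_r with (3 + p); [lra|]. unfold Rdiv.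
  rewrite Rmult_assoc, Rinv_l by lra. nra.
Qed.

Lemma expo_s_pos : 0 < expo_s.
Proof. unfold expo_s. apply Rdiv_lt_0_compat; nra. Qed.

(** Here the dimension enters: [expo_v + 1 - nu] has the sign of [3 + p - nu * (1 + p)], which is at
    least [1 - p] for [nu <= 2] but equals [- 2 * p] at [nu = 3]. *)
Lemma hardy_pos : 0 < hardy.
Proof.
unfold hardy. apply Rmult_lt_0_compat.
- unfold expo_v. apply Rdiv_lt_0_compat; nra.
- replace (expo_v + 1 - nu) with ((3 + p - nu * (1 + p)) / (3 + p))
    by (unfold expo_v; field; lra).
  apply Rdiv_lt_0_compat; nra.
Qed.

Definition to_v (w : R -> R) (x : R) : R := Rpower x expo_v * w x.
(** The derivative of [to_v] in [tau], that is [x ^ (- expo_t)] times its derivative in [x], with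
    the powers collected. *)
Definition to_s (w dw : R -> R) (x : R) : R :=
  Rpower x expo_s * (dw x + expo_v * (w x / x)).

Lemma radial_oscillator (w dw : R -> R) (a b : R) :
  0 <= a ->
  (forall x, a < x < b -> 0 < w x /\ is_derive w x (dw x) /\
     is_derive dw x (ep * Rpower (w x) p - de * (Rpower x sg * w x) - nu / x * dw x)) ->
  oscillator expo_t hardy p sg de ep (to_v w) (to_s w dw) a b.
Proof.
intros Ha Hw x Hx. destruct (Hw x Hx) as [Hpos [D1 D2]].
assert (Hx0 : 0 < x) by lra.
assert (Hkv : 0 < Rpower x expo_v) by apply Rpower_pos.
split; [|split].
- unfold to_v. nra.
- eapply is_derive_eq.
  + apply is_derive_Rmult; [apply is_derive_Rpower; trivial|exact D1].
  + assert (E : Rpower x expo_v = Rpower x expo_t * Rpower x expo_s).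
    { rewrite <- Rpower_plus. f_equal. unfold expo_t, expo_s, expo_v; field; lra. }
    unfold to_s. rewrite E. field. lra.
- eapply is_derive_eq.
  + apply is_derive_Rmult; [apply is_derive_Rpower; trivial|].
    apply is_derive_Rplus; [exact D2|]. apply is_derive_Rscal.
    apply is_derive_Rdiv; [exact D1|apply (is_derive_id (K:=R_AbsRing))|lra].
  + unfold to_v, potential, one; simpl.
    rewrite <- Rpower_mult_distr, Rpower_mult by trivial.
    (* [E1], [E2] and [E3] match the powers of [x] in the absorption, the reaction and the term with
       [hardy]. The terms in [dw] cancel because [expo_s + expo_v = nu]. *)
    assert (E1 : Rpower x expo_t * Rpower x (expo_v * p) = Rpower x expo_s).
    { rewrite <- Rpower_plus. f_equal. unfold expo_t, expo_s, expo_v; field; lra. }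
    assert (E2 : Rpower x expo_t * Rpower x (sg - 2 * expo_t) * Rpower x expo_v
                 = Rpower x expo_s * Rpower x sg).
    { rewrite <- !Rpower_plus. f_equal. unfold expo_t, expo_s, expo_v; field; lra. }
    assert (E3 : Rpower x expo_t * Rpower x (-2 * expo_t - 2) * Rpower x expo_v
                 = Rpower x expo_s / (x * x)).
    { replace (Rpower x expo_s / (x * x)) with (Rpower x (expo_s + - (1) + - (1))).
      - rewrite <- !Rpower_plus. f_equal. unfold expo_t, expo_s, expo_v; field; lra.
      - rewrite !Rpower_plus, Rpower_Ropp, Rpower_1 by trivial. field. lra. }
    set (S := Rpower x expo_s) in *. set (Wp := Rpower (w x) p).
    transitivity (ep * (Rpower x expo_t * Rpower x (expo_v * p)) * Wp
      - de * (Rpower x expo_t * Rpower x (sg - 2 * expo_t) * Rpower x expo_v) * w x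
      - hardy * (Rpower x expo_t * Rpower x (-2 * expo_t - 2) * Rpower x expo_v) * w x);
      [|ring].
    rewrite E1, E2, E3.
    unfold hardy, expo_s, expo_v. field. lra.
Qed.

End Transformation.

(** * Shooting *)

Section Shooting.
Context (n : nat) (p sg : R).
Context (Hn : 1 <= INR n <= 2) (Hp : 0 < p < 1) (Hsg : 0 <= sg <= 2 * expo_t (INR n) p).

Let al := expo_t (INR n) p.
Let K := hardy (INR n) p.

Definition family (th : R) (y d : R -> R) (X : R) : Prop :=
  positive_solution n p sg (1 - th) th y d X.

Definition family_energy (th : R) (y d : R -> R) (x : R) : R :=
  energy al K p sg (1 - th) th (to_v (INR n) p y x) (to_s (INR n) p y d x) x.

(* The energy decreases and is nonnegative where [y] vanishes, so a trapped solution
   never reaches zero. *)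
Definition trapped (th : R) : Prop :=
  0 <= th <= 1 /\
  exists y d X x, family th y d X /\ 0 < x < X /\ family_energy th y d x < 0.

Lemma al_in_unit : 0 < al < 1.
Proof. apply expo_t_range; trivial. Qed.

Lemma K_pos : 0 < K.
Proof. apply hardy_pos; trivial. Qed.

Lemma family_oscillator (th : R) (y d : R -> R) (X : R) :
  family th y d X ->
  oscillator al K p sg (1 - th) th (to_v (INR n) p y) (to_s (INR n) p y d) 0 X.
Proof.
intros H. apply radial_oscillator; trivial; [lra|]. intros x Hx.
destruct H as [H1 [H2 [H3 H4]]]. destruct (H4 x Hx) as [H5 H6].
split; [|split]; trivial. apply H1; lra.
Qed.

Lemma family_energy_decreasing (th : R) (y d : R -> R) (X x1 x2 : R) :
  0 <= th <= 1 -> family th y d X -> 0 < x1 -> x1 < x2 -> x2 < X ->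
  family_energy th y d x2 < family_energy th y d x1.
Proof.
intros Hth Hy H1 H2 H3.
apply (energy_decreasing al K p sg (1 - th) th Hp al_in_unit K_pos Hsg) with 0 X; try lra.
apply family_oscillator; trivial.
Qed.

Lemma family_energy_unique (th : R) (y1 d1 y2 d2 : R -> R) (X1 X2 x : R) :
  family th y1 d1 X1 -> family th y2 d2 X2 -> x < X1 -> x < X2 ->
  family_energy th y1 d1 x = family_energy th y2 d2 x /\
  to_v (INR n) p y1 x = to_v (INR n) p y2 x /\
  to_s (INR n) p y1 d1 x = to_s (INR n) p y2 d2 x.
Proof.
intros H1 H2 Hx1 Hx2.
destruct (positive_solution_unique n p sg Hp (proj1 Hsg) _ _ _ _ _ _ _ _ x H1 H2 Hx1 Hx2)
  as [E1 E2].
unfold family_energy, to_v, to_s. rewrite E1, E2. repeat split.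
Qed.

(** Without reaction [(x ^ n * d)' = x ^ n * y ^ p]. Positivity of the right-hand side gives
    [d >= 0] and so [y >= 1]; fed back, [y ^ p >= 1] gives [d >= x / (n + 1)], and one more
    integration gives the claim. *)
Lemma quadratic_growth (y d : R -> R) (X x : R) :
  family 1 y d X -> 0 <= x < X ->
  1 + x * x / (2 * (INR n + 1)) <= y x.
Proof.
intros [H1 [H2 [H3 H4]]] Hx.
assert (Hc : forall t, 0 <= t < X -> continuous (fun t => t ^ n * d t) t).
{ intros t Ht. apply continuous_pow_mult, H2. lra. }
assert (HD : forall t, 0 < t < X ->
          is_derive (fun t => t ^ n * d t) t (t ^ n * Rpower (y t) p)).
{ intros t Ht. destruct (H4 t Ht) as [_ H5].
  assert (HP : is_derive (fun t => t ^ n) t (INR n * (t ^ n / t))).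
  { eapply is_derive_eq. auto_derive; trivial.
    clear -Ht. destruct n as [|j]; [simpl; field; lra|].
    replace (t ^ S j / t) with (t ^ j) by (simpl; field; lra). simpl. ring. }
  eapply is_derive_eq; [exact (is_derive_Rmult _ _ _ _ _ HP H5)|]. cbv beta. field. lra. }
assert (Hd : forall t, 0 <= t < X -> 0 <= d t).
{ intros t Ht. destruct (Rle_lt_or_eq_dec 0 t (proj1 Ht)) as [Ht0| <-].
  2:{ rewrite (proj2 (H3 0 (Rle_refl 0))). lra. }
  assert (H : - (t ^ n * d t) <= - (0 ^ n * d 0)).
  { apply (decreasing_on (fun t => - (t ^ n * d t)) (fun t => - (t ^ n * Rpower (y t) p)));
      try lra.
    - intros u Hu. apply (continuous_opp (V:=R_NormedModule) (fun t => t ^ n * d t)), Hc. lra.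
    - intros u Hu. apply (is_derive_opp (fun t => t ^ n * d t)), HD. lra.
    - intros u Hu. pose proof (pow_lt u n ltac:(lra)). pose proof (Rpower_pos (y u) p). nra. }
  rewrite (proj2 (H3 0 (Rle_refl 0))), Rmult_0_r in H.
  pose proof (pow_lt t n Ht0). nra. }
assert (Hy1 : forall t, 0 <= t < X -> 1 <= y t).
{ intros t Ht. destruct (H3 0 (Rle_refl 0)) as [<- _].
  apply Ropp_le_cancel.
  apply (decreasing_on (fun t => - y t) (fun t => - d t)); try lra.
  - intros u Hu. apply (continuous_opp (V:=R_NormedModule) y).
    eapply is_derive_continuous, H1. lra.
  - intros u Hu. apply (is_derive_opp y), H1. lra.
  - intros u Hu. specialize (Hd u ltac:(lra)). lra. }
assert (HN : 0 < INR n + 1) by lra.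
assert (Hd2 : forall t, 0 < t < X -> t / (INR n + 1) <= d t).
{ intros t Ht.
  assert (H : (t ^ S n / (INR n + 1) - t ^ n * d t) <= (0 ^ S n / (INR n + 1) - 0 ^ n * d 0)).
  { apply (decreasing_on (fun t => t ^ S n / (INR n + 1) - t ^ n * d t)
             (fun t => t ^ n - t ^ n * Rpower (y t) p)); try lra.
    - intros u Hu. apply continuous_Rminus; [|apply Hc; lra].
      apply (ex_derive_continuous (fun t => t ^ S n / (INR n + 1))). auto_derive. trivial.
    - intros u Hu. apply is_derive_Rminus; [|apply HD; lra].
      eapply is_derive_eq. auto_derive; trivial.
      change (match n with O => 1 | S _ => INR n + 1 end) with (INR (S n)).
      rewrite S_INR. field. lra.
    - intros u Hu. specialize (Hy1 u ltac:(lra)).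
      assert (1 <= Rpower (y u) p).
      { rewrite <- (Rpower_O (y u)) at 1 by lra. apply Rle_Rpower; lra. }
      pose proof (pow_lt u n ltac:(lra)). nra. }
  rewrite (proj2 (H3 0 (Rle_refl 0))), Rmult_0_r in H.
  change (t ^ S n) with (t * t ^ n) in H. change (0 ^ S n) with (0 * 0 ^ n) in H.
  assert (Hz : 0 * 0 ^ n / (INR n + 1) - 0 = 0) by (field; lra).
  rewrite Hz in H. pose proof (pow_lt t n ltac:(lra)).
  apply Rmult_le_reg_r with (t ^ n); trivial.
  replace (t / (INR n + 1) * t ^ n) with (t * t ^ n / (INR n + 1)) by (field; lra). lra. }
assert (H : x * x / (2 * (INR n + 1)) - y x <= 0 * 0 / (2 * (INR n + 1)) - y 0).
{ apply (decreasing_on (fun t => t * t / (2 * (INR n + 1)) - y t)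
           (fun t => t / (INR n + 1) - d t)); try lra.
  - intros u Hu. apply continuous_Rminus.
    + apply (ex_derive_continuous (fun t => t * t / (2 * (INR n + 1)))). auto_derive. trivial.
    + eapply is_derive_continuous, H1. lra.
  - intros u Hu. apply is_derive_Rminus; [|apply H1; lra].
    eapply is_derive_eq. auto_derive; trivial. field. lra.
  - intros u Hu. specialize (Hd2 u ltac:(lra)). lra. }
rewrite (proj1 (H3 0 (Rle_refl 0))) in H.
assert (Hz : 0 * 0 / (2 * (INR n + 1)) = 0) by (field; lra).
lra.
Qed.

(** Here [y >= 1] makes the solution global. The energy has slope [- K (2 al + 2) x ^ (- 2 al - 3) v
    ^ 2 / 2], and quadratic growth of [y] makes this at most [- c0 x ^ (2 expo_s + 1)]; so the
    energy falls at least linearly and becomes negative. *)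
Lemma trapped_1 : trapped 1.
Proof.
split; [lra|].
destruct (maximal_positive_solution n p sg Hp (proj1 Hsg) (1 - 1) 1) as [y [d [Hy|HT]]].
2:{ destruct HT as [T [HT [Hy HI]]]. destruct (HI 1 ltac:(lra)) as [x [Hx Hx1]].
    assert (H := quadratic_growth y d T x Hy Hx).
    assert (0 <= x * x / (2 * (INR n + 1))) by (apply Rdiv_le_0_compat; nra). lra. }
(* The modulus of the slope of the energy at [x = 1] if [y] is replaced by [x ^ 2 / (2 (n + 1))]. *)
set (c0 := K * (2 * al + 2) / (8 * ((INR n + 1) * (INR n + 1)))).
assert (Hc0 : 0 < c0).
{ unfold c0. pose proof K_pos. pose proof al_in_unit. apply Rdiv_lt_0_compat; nra. }
assert (HE : forall x, 1 <= x ->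
  family_energy 1 y d x + c0 * x <= family_energy 1 y d 1 + c0 * 1).
{ intros x Hx.
  assert (HD : forall t, 0 < t -> is_derive (fun t => family_energy 1 y d t + c0 * t) t
     (potential_slope al K sg (1 - 1) t * (to_v (INR n) p y t * to_v (INR n) p y t) / 2
      + c0 * 1)).
  { intros t Ht. apply is_derive_Rplus.
    - apply (is_derive_energy al K p sg (1 - 1) 1 Hp _ _ 0 (t + 1)); try lra.
      apply family_oscillator, Hy.
    - apply is_derive_Rscal. apply (is_derive_id (K:=R_AbsRing)). }
  apply (decreasing_on (fun t => family_energy 1 y d t + c0 * t) (fun t =>
     (potential_slope al K sg (1 - 1) t * (to_v (INR n) p y t * to_v (INR n) p y t) / 2
      + c0 * 1))); trivial.
  - intros t Ht. eapply is_derive_continuous, HD. lra.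
  - intros t Ht. apply HD. lra.
  - intros t Ht.
    assert (H := quadratic_growth y d (t + 1) t (Hy _) ltac:(lra)).
    set (q := t * t / (2 * (INR n + 1))) in *.
    assert (Hq : 0 < q) by (unfold q; apply Rdiv_lt_0_compat; nra).
    unfold potential_slope, to_v. rewrite Rminus_diag, !Rmult_0_l, Rplus_0_l.
    set (B := Rpower t (-2 * al - 2)). set (Z := Rpower t (expo_v (INR n) p)).
    assert (HB : 0 < B) by apply Rpower_pos. assert (HZ : 0 < Z) by apply Rpower_pos.
    assert (Hlow : 1 <= B * (Z * Z) * (t * t * t)).
    { apply Rle_trans with (Rpower t (2 * expo_s (INR n) p + 1)).
      - apply Rpower_ge_1; [lra|]. pose proof (expo_s_pos (INR n) p Hn Hp). lra.
      - right. replace (2 * expo_s (INR n) p + 1) with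
          ((-2 * al - 2) + (expo_v (INR n) p + expo_v (INR n) p) + (1 + 1 + 1)).
        + rewrite !Rpower_plus, Rpower_1 by lra. reflexivity.
        + unfold al, expo_t, expo_s, expo_v. field. lra. }
    assert (Hk : 0 < K * (2 * al + 2)).
    { pose proof K_pos. pose proof al_in_unit. nra. }
    assert (Hyq : q * q <= y t * y t) by (apply Rmult_le_compat; lra).
    assert (H1 : c0 <= K * (2 * al + 2) * (B / t) * (Z * Z) * (q * q) / 2).
    { replace (K * (2 * al + 2) * (B / t) * (Z * Z) * (q * q) / 2)
        with (c0 * (B * (Z * Z) * (t * t * t))).
      2:{ unfold c0, q. field. lra. }
      rewrite <- (Rmult_1_r c0) at 1. apply Rmult_le_compat_l; lra. }
    assert (H2 : K * (2 * al + 2) * (B / t) * (Z * Z) * (q * q)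
                 <= K * (2 * al + 2) * (B / t) * (Z * Z) * (y t * y t)).
    { apply Rmult_le_compat_l; trivial.
      assert (0 < B / t) by (apply Rdiv_lt_0_compat; lra).
      apply Rmult_le_pos; [|nra]. apply Rmult_le_pos; lra. }
    replace (K * (-2 * al - 2) * B / t * (Z * y t * (Z * y t)) / 2)
      with (- (K * (2 * al + 2) * (B / t) * (Z * Z) * (y t * y t) / 2)) by (field; lra).
    lra. }
set (E1 := family_energy 1 y d 1) in *.
set (x := 1 + (Rabs E1 + 1) / c0).
assert (Hq : 0 < (Rabs E1 + 1) / c0).
{ apply Rdiv_lt_0_compat; trivial. pose proof (Rabs_pos E1); lra. }
exists y, d, (x + 1), x. split; [apply Hy|]. split; [unfold x; lra|].
specialize (HE x ltac:(unfold x; lra)). unfold x in HE at 2.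
replace (c0 * (1 + (Rabs E1 + 1) / c0)) with (c0 + (Rabs E1 + 1)) in HE by (field; lra).
pose proof (Rle_abs E1). lra.
Qed.

(** The factor [th] removes the only negative term of the energy. *)
Lemma not_trapped_0 : ~ trapped 0.
Proof.
intros [_ [y [d [X [x [Hy [Hx HE]]]]]]]. revert HE. apply Rle_not_lt.
unfold family_energy, energy.
pose proof (potential_pos al K sg (1 - 0) K_pos ltac:(lra) x).
assert (0 <= potential al K sg (1 - 0) x * (to_v (INR n) p y x * to_v (INR n) p y x)).
{ apply Rmult_le_pos; [lra|]. apply Rle_0_sqr. }
assert (0 <= to_s (INR n) p y d x * to_s (INR n) p y d x) by apply Rle_0_sqr.
unfold Rdiv. rewrite !Rmult_0_l. lra.
Qed.

Lemma family_energy_close (th0 : R) (y0 d0 : R -> R) (X x e : R) :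
  family th0 y0 d0 X -> 0 < x < X -> 0 < e ->
  exists kap, 0 < kap /\ forall th, Rabs (th - th0) < kap ->
  exists y d b, x < b /\ family th y d b /\
    Rabs (family_energy th y d x - family_energy th0 y0 d0 x) < e /\
    Rabs (to_v (INR n) p y x - to_v (INR n) p y0 x) < e /\
    Rabs (to_s (INR n) p y d x - to_s (INR n) p y0 d0 x) < e.
Proof.
intros Hy0 Hx He. set (b := (x + X) / 2).
destruct (positive_solution_dependence n p sg Hp (proj1 Hsg) _ _ _ _ _ b Hy0
            ltac:(unfold b; lra)) as [k0 [C [Hk0 [HC Hdep]]]].
(* Choosing one solution for each parameter turns the estimates at [x] into continuity of functions
   of [th], to which the composition rules apply. Far from [th0] the pair [(y0, d0)] is a
   placeholder. *)
assert (Hch : forall th, exists yd : (R -> R) * (R -> R), Rabs (th - th0) < k0 / 2 ->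
   family th (fst yd) (snd yd) b /\
   Rabs (fst yd x - y0 x) <= 2 * C * Rabs (th - th0) /\
   Rabs (snd yd x - d0 x) <= 2 * C * Rabs (th - th0)).
{ intros th. destruct (Rlt_dec (Rabs (th - th0)) (k0 / 2)) as [Hth|Hth].
  2:{ exists (y0, d0). intros H; contradiction. }
  assert (Heq : Rabs (1 - th - (1 - th0)) = Rabs (th - th0)).
  { rewrite <- Rabs_Ropp. f_equal. ring. }
  destruct (Hdep (1 - th) th) as [y [d [Hy Hc]]]; [lra|].
  exists (y, d). intros _. simpl. split; [exact Hy|].
  destruct (Hc x ltac:(unfold b; lra)) as [H1 H2]. rewrite Heq in H1, H2.
  split; lra. }
destruct (choice _ Hch) as [F HF].
(* At [th0] the right-hand sides vanish, so the chosen solution takes the values of [y0] and [d0] at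
   [x]. *)
assert (HF0 := HF th0). rewrite Rminus_diag, Rabs_R0, Rmult_0_r in HF0.
destruct (HF0 ltac:(lra)) as [Hf0 [E1 E2]].
assert (Ey : fst (F th0) x = y0 x).
{ apply Rminus_diag_uniq, NNPP. intros H. apply Rabs_pos_lt in H. lra. }
assert (Ed : snd (F th0) x = d0 x).
{ apply Rminus_diag_uniq, NNPP. intros H. apply Rabs_pos_lt in H. lra. }
assert (Cy : continuous (fun th => fst (F th) x) th0).
{ apply continuous_of_lipschitz_at with (2 * C) (k0 / 2); try lra.
  intros th Hth. rewrite Ey. apply HF; trivial. }
assert (Cd : continuous (fun th => snd (F th) x) th0).
{ apply continuous_of_lipschitz_at with (2 * C) (k0 / 2); try lra.
  intros th Hth. rewrite Ed. apply HF; trivial. }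
assert (Cv : continuous (fun th => to_v (INR n) p (fst (F th)) x) th0).
{ unfold to_v. apply continuous_Rmult; [apply continuous_const|exact Cy]. }
assert (Cs : continuous (fun th => to_s (INR n) p (fst (F th)) (snd (F th)) x) th0).
{ unfold to_s. apply continuous_Rmult; [apply continuous_const|].
  apply continuous_Rplus; trivial. apply continuous_Rmult; [apply continuous_const|].
  apply continuous_Rmult; [exact Cy|apply continuous_const]. }
assert (C1 : continuous (fun th => 1 - th) th0).
{ apply (ex_derive_continuous (fun th => 1 - th)). auto_derive. trivial. }
assert (Cid : continuous (fun th : R => th) th0) by apply continuous_id.
assert (CE : continuous (fun th => family_energy th (fst (F th)) (snd (F th)) x) th0).
{ unfold family_energy, energy, potential.
  apply continuous_Rminus.
  - apply continuous_Rplus; (apply continuous_Rmult; [|apply continuous_const]).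
    + apply continuous_Rmult; exact Cs.
    + apply continuous_Rmult; [|apply continuous_Rmult; exact Cv].
      apply continuous_Rplus; [|apply continuous_const].
      apply continuous_Rmult; [exact C1|apply continuous_const].
  - apply continuous_Rmult.
    + apply continuous_Rmult; [exact Cid|apply continuous_const].
    + apply (continuous_comp (fun th => to_v (INR n) p (fst (F th)) x)
               (fun u => Rpower u (p + 1))); trivial.
      eapply is_derive_continuous, is_derive_Rpower.
      unfold to_v. rewrite Ey. apply Rmult_lt_0_compat; [apply Rpower_pos|].
      eapply positive_solution_pos; [exact Hy0|lra]. }
destruct (continuous_epsilon _ _ e CE He) as [k1 [Hk1 G1]].
destruct (continuous_epsilon _ _ e Cv He) as [k2 [Hk2 G2]].
destruct (continuous_epsilon _ _ e Cs He) as [k3 [Hk3 G3]].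
exists (Rmin (k0 / 2) (Rmin k1 (Rmin k2 k3))). split.
{ repeat apply Rmin_pos; lra. }
intros th Hth.
assert (L1 := Rmin_l (k0 / 2) (Rmin k1 (Rmin k2 k3))).
assert (L2 := Rmin_r (k0 / 2) (Rmin k1 (Rmin k2 k3))).
assert (L3 := Rmin_l k1 (Rmin k2 k3)). assert (L4 := Rmin_r k1 (Rmin k2 k3)).
assert (L5 := Rmin_l k2 k3). assert (L6 := Rmin_r k2 k3).
exists (fst (F th)), (snd (F th)), b.
split; [unfold b; lra|]. split; [apply HF; lra|].
specialize (G1 th ltac:(lra)). specialize (G2 th ltac:(lra)). specialize (G3 th ltac:(lra)).
unfold family_energy, to_v, to_s in *. cbv beta in *. rewrite Ey, ?Ed in *.
split; [exact G1|split; [exact G2|exact G3]].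
Qed.

Lemma critical_value :
  exists th, 0 <= th < 1 /\ ~ trapped th /\ (forall t, trapped t -> th <= t) /\
    forall kap, 0 < kap -> exists t, trapped t /\ t < th + kap.
Proof.
(* The infimum is obtained as the supremum of the lower bounds. *)
set (S := fun t => forall u, trapped u -> t <= u).
assert (HB : bound S) by (exists 1; intros t Ht; apply Ht, trapped_1).
assert (HS0 : S 0) by (intros u [Hu _]; lra).
destruct (completeness S HB (ex_intro _ 0 HS0)) as [th [H1 H2]].
assert (Hlow : forall t, trapped t -> th <= t).
{ intros t Ht. apply H2. intros u Hu. apply Hu; trivial. }
assert (H0 : 0 <= th) by (apply H1; exact HS0).
assert (Hnt : ~ trapped th).
{ intros Ht. assert (Ht' := Ht). destruct Ht' as [Hr [y [d [X [x [Hy [Hx HE]]]]]]].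
  assert (Hth : 0 < th).
  { destruct H0 as [H0|H0]; trivial. exfalso. apply not_trapped_0. rewrite H0. exact Ht. }
  destruct (family_energy_close th y d X x (- family_energy th y d x) Hy Hx ltac:(lra))
    as [kap [Hk Hc]].
  (* A positive parameter strictly below [th] and within [kap] of it: it inherits the negative
     energy, against [Hlow]. *)
  set (t := th - Rmin (th / 2) (kap / 2)).
  pose proof (Rmin_l (th / 2) (kap / 2)). pose proof (Rmin_r (th / 2) (kap / 2)).
  assert (0 < Rmin (th / 2) (kap / 2)) by (apply Rmin_pos; lra).
  destruct (Hc t) as [y' [d' [b [Hb [Hy' [HE' _]]]]]].
  { unfold t. rewrite Rabs_minus_sym, Rabs_pos_eq; lra. }
  assert (Htt : trapped t).
  { split; [unfold t; lra|]. exists y', d', b, x. split; trivial. split; [lra|].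
    apply Rabs_def2 in HE'. lra. }
  apply Hlow in Htt. unfold t in Htt. lra. }
exists th. split; [|split; [|split]]; trivial.
- split; trivial. pose proof (Hlow 1 trapped_1).
  destruct (Req_dec th 1) as [->|Hne]; [|lra]. exfalso. apply Hnt, trapped_1.
- intros kap Hk. apply NNPP. intros Hno.
  assert (th + kap <= th); [|lra]. apply H1. intros u Hu. apply Rnot_lt_le. intros Hlt.
  apply Hno. exists u. split; trivial.
Qed.

Lemma untrapped_energy (th : R) (y d : R -> R) (X x : R) :
  0 <= th <= 1 -> ~ trapped th -> family th y d X -> 0 < x < X ->
  0 <= family_energy th y d x.
Proof.
intros Hth Hnt Hy Hx. apply Rnot_lt_le. intros HE. apply Hnt. split; trivial.
exists y, d, X, x. split; [|split]; trivial.
Qed.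

Lemma untrapped_dies (th : R) :
  0 <= th < 1 -> ~ trapped th ->
  exists y d T, 0 < T /\ family th y d T /\
    forall eta, 0 < eta -> exists x, 0 <= x < T /\ y x < eta.
Proof.
intros Hth Hnt.
destruct (maximal_positive_solution n p sg Hp (proj1 Hsg) (1 - th) th) as [y [d [Hy|HT]]].
2:{ destruct HT as [T HT]. exists y, d, T. exact HT. }
exfalso.
apply (no_global_nonneg_energy al K p sg (1 - th) th Hp al_in_unit K_pos Hsg ltac:(lra)
         (to_v (INR n) p y) (to_s (INR n) p y d)); [lra| |].
- intros b. apply family_oscillator, Hy.
- intros x Hx. apply (untrapped_energy th y d (x + 1)); try lra; trivial. apply Hy.
Qed.

(** Upgrades values of [y] arbitrarily close to [0] to a limit of [v] at [T]. The slope [s] must be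
    negative somewhere, or [v] could not come close to [0]; nonnegative energy keeps it negative, so
    [v] decreases from there on. *)
Lemma approach_zero (th : R) (y d : R -> R) (T : R) :
  0 <= th <= 1 -> ~ trapped th -> 0 < T -> family th y d T ->
  (forall eta, 0 < eta -> exists x, 0 <= x < T /\ y x < eta) ->
  exists xa, 0 < xa < T /\
    (forall x, xa <= x < T -> to_s (INR n) p y d x < 0) /\
    forall e, 0 < e -> exists x1, xa <= x1 < T /\
      forall x, x1 <= x < T -> to_v (INR n) p y x < e.
Proof.
intros Hth Hnt HT Hy HI.
set (v := to_v (INR n) p y). set (s := to_s (INR n) p y d). set (k := expo_v (INR n) p).
assert (Hk : 0 <= k).
{ unfold k, expo_v. apply Rdiv_le_0_compat; lra. }
assert (Ho := family_oscillator th y d T Hy). fold v s in Ho.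
assert (Hrange : forall b, 0 <= b < T -> exists m, 0 < m /\ forall x, 0 <= x <= b -> m <= y x).
{ intros b Hb. destruct (positive_solution_range n p sg _ _ y d T b Hy Hb)
    as [m [Y [Hm [_ Hr]]]]. exists m. split; trivial. intros x Hx. apply Hr; trivial. }
assert (Hvy : forall x, 0 < x < T -> v x <= Rpower T k * y x).
{ intros x Hx. unfold v, to_v. fold k. apply Rmult_le_compat_r.
  - left. eapply positive_solution_pos; [exact Hy|lra].
  - apply Rle_Rpower_l; lra. }
assert (Hxa : exists xa, 0 < xa < T /\ s xa < 0).
{ apply NNPP. intros Hno.
  assert (Hs : forall x, 0 < x < T -> 0 <= s x).
  { intros x Hx. apply Rnot_lt_le. intros H. apply Hno. exists x. split; trivial. }
  destruct (Hrange (T / 2) ltac:(lra)) as [m [Hm Hmy]].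
  destruct (Ho (T / 2) ltac:(lra)) as [Hv2 _].
  assert (HTk := Rpower_pos T k).
  assert (Hq : 0 < v (T / 2) / Rpower T k) by (apply Rdiv_lt_0_compat; trivial).
  (* A value of [y] below [m] occurs only beyond [T / 2]; the second bound then forces
     [v x < v (T / 2)], against monotonicity. *)
  destruct (HI (Rmin m (v (T / 2) / Rpower T k))) as [x [Hx Hyx]].
  { apply Rmin_pos; trivial. }
  pose proof (Rmin_l m (v (T / 2) / Rpower T k)).
  pose proof (Rmin_r m (v (T / 2) / Rpower T k)).
  destruct (Rle_dec x (T / 2)) as [Hle|Hgt].
  { specialize (Hmy x ltac:(lra)). lra. }
  assert (Hmon : - v x <= - v (T / 2)).
  { apply (decreasing_on (fun t => - v t) (fun t => - (Rpower t al * s t))); try lra.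
    - intros t Ht. apply (continuous_opp (V:=R_NormedModule) v).
      exact (is_derive_continuous _ _ _ (proj1 (proj2 (Ho t ltac:(lra))))).
    - intros t Ht. apply (is_derive_opp v). apply Ho. lra.
    - intros t Ht. specialize (Hs t ltac:(lra)). pose proof (Rpower_pos t al). nra. }
  specialize (Hvy x ltac:(lra)).
  assert (y x * Rpower T k < v (T / 2) / Rpower T k * Rpower T k).
  { apply Rmult_lt_compat_r; lra. }
  unfold Rdiv in H1. rewrite Rmult_assoc, Rinv_l in H1 by lra. lra. }
destruct Hxa as [xa [Hxa Hsa]].
exists xa. split; trivial.
assert (Hneg : forall x, xa <= x < T -> s x < 0).
{ intros x Hx. apply (ratio_negative al K p sg (1 - th) th Hp K_pos ltac:(lra) v s 0 T xa x);
    trivial; try lra.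
  intros t Ht. apply (untrapped_energy th y d T); trivial; lra. }
split; trivial.
intros e He.
destruct (Hrange xa ltac:(lra)) as [m [Hm Hmy]].
assert (HTk := Rpower_pos T k).
assert (Hq : 0 < e / Rpower T k) by (apply Rdiv_lt_0_compat; trivial).
destruct (HI (Rmin m (e / Rpower T k))) as [x1 [Hx1 Hyx]].
{ apply Rmin_pos; trivial. }
pose proof (Rmin_l m (e / Rpower T k)). pose proof (Rmin_r m (e / Rpower T k)).
assert (Hx1a : xa < x1).
{ apply Rnot_le_lt. intros Hle. specialize (Hmy x1 ltac:(lra)). lra. }
exists x1. split; [lra|]. intros x Hx.
assert (Hmon : v x <= v x1).
{ apply (decreasing_on v (fun t => Rpower t al * s t)); try lra.
  - intros t Ht. exact (is_derive_continuous _ _ _ (proj1 (proj2 (Ho t ltac:(lra))))).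
  - intros t Ht. apply Ho. lra.
  - intros t Ht. specialize (Hneg t ltac:(lra)). pose proof (Rpower_pos t al). nra. }
specialize (Hvy x1 ltac:(lra)).
assert (y x1 * Rpower T k < e / Rpower T k * Rpower T k) by (apply Rmult_lt_compat_r; lra).
unfold Rdiv in H1. rewrite Rmult_assoc, Rinv_l in H1 by lra. lra.
Qed.

Lemma potential_le (th a x : R) :
  0 <= th <= 1 -> 0 < a -> a <= x -> potential al K sg (1 - th) x <= potential al K sg 1 a.
Proof.
intros Hth Ha Hx. unfold potential. pose proof al_in_unit. pose proof K_pos.
assert (A := Rpower_le_nonpos a x (sg - 2 * al) Ha Hx ltac:(unfold al in *; lra)).
assert (B := Rpower_le_nonpos a x (-2 * al - 2) Ha Hx ltac:(lra)).
pose proof (Rpower_pos x (sg - 2 * al)).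
apply Rplus_le_compat; [|apply Rmult_le_compat_l; lra].
apply Rmult_le_compat; lra.
Qed.

(** [M] is uniform in [th], because it is applied to parameters near the critical one that are
    selected only after [M] is fixed. *)
Lemma potential_slope_bound (a : R) :
  0 < a -> exists M, 0 < M /\ forall th x, 0 <= th <= 1 -> a <= x ->
    - M <= potential_slope al K sg (1 - th) x.
Proof.
intros Ha. pose proof al_in_unit. pose proof K_pos.
set (P := (2 * al - sg) * Rpower a (sg - 2 * al) + K * (2 * al + 2) * Rpower a (-2 * al - 2)).
assert (Hs2 : 0 <= 2 * al - sg) by (unfold al; lra).
pose proof (Rpower_pos a (sg - 2 * al)). pose proof (Rpower_pos a (-2 * al - 2)).
assert (HK2 : 0 < K * (2 * al + 2)) by nra.
assert (HP : 0 < P).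
{ unfold P. assert (0 <= (2 * al - sg) * Rpower a (sg - 2 * al)) by (apply Rmult_le_pos; lra).
  assert (0 < K * (2 * al + 2) * Rpower a (-2 * al - 2)) by (apply Rmult_lt_0_compat; lra).
  lra. }
exists (P / a). split; [apply Rdiv_lt_0_compat; lra|]. intros th x Hth Hx.
assert (A := Rpower_le_nonpos a x (sg - 2 * al) Ha Hx ltac:(lra)).
assert (B := Rpower_le_nonpos a x (-2 * al - 2) Ha Hx ltac:(lra)).
pose proof (Rpower_pos x (sg - 2 * al)). pose proof (Rpower_pos x (-2 * al - 2)).
unfold potential_slope.
set (Q := (1 - th) * ((2 * al - sg) * Rpower x (sg - 2 * al))
          + K * (2 * al + 2) * Rpower x (-2 * al - 2)).
replace (((1 - th) * (sg - 2 * al) * Rpower x (sg - 2 * al) +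
   K * (-2 * al - 2) * Rpower x (-2 * al - 2)) / x) with (- (Q / x))
  by (unfold Q; field; lra).
apply Ropp_le_contravar.
assert (HQ : 0 <= Q <= P).
{ assert (0 <= (2 * al - sg) * Rpower x (sg - 2 * al)) by (apply Rmult_le_pos; lra).
  assert ((2 * al - sg) * Rpower x (sg - 2 * al) <= (2 * al - sg) * Rpower a (sg - 2 * al))
    by (apply Rmult_le_compat_l; lra).
  assert (0 < K * (2 * al + 2) * Rpower x (-2 * al - 2)) by (apply Rmult_lt_0_compat; lra).
  assert (K * (2 * al + 2) * Rpower x (-2 * al - 2) <= K * (2 * al + 2) * Rpower a (-2 * al - 2))
    by (apply Rmult_le_compat_l; lra).
  unfold Q, P. split; [nra|].
  apply Rplus_le_compat; trivial.
  rewrite <- (Rmult_1_l ((2 * al - sg) * Rpower a (sg - 2 * al))).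
  apply Rmult_le_compat; lra. }
unfold Rdiv. apply Rmult_le_compat; try lra.
- left. apply Rinv_0_lt_compat; lra.
- apply Rinv_le_contravar; lra.
Qed.

(** Loss is at most rate times duration: [v] decreases, so the rate is at most [M * v ^ 2 / 2] taken
    at [x1], and [extinction_bound] limits the duration. The product is cubic in [v], hence
    negligible if [v] is small and [s] is not. *)
Lemma energy_loss (th : R) (y d : R -> R) (X x1 x2 M : R) :
  0 <= th <= 1 -> family th y d X -> 0 < x1 -> x1 < x2 -> x2 < X ->
  (forall x, x1 <= x -> - M <= potential_slope al K sg (1 - th) x) -> 0 < M ->
  (forall x, x1 <= x <= x2 -> 0 <= family_energy th y d x) ->
  to_s (INR n) p y d x1 < 0 ->
  family_energy th y d x1 - family_energy th y d x2
    <= M * (to_v (INR n) p y x1 * to_v (INR n) p y x1) / 2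
       * (to_v (INR n) p y x1 / - to_s (INR n) p y d x1 / ((1 - p) / 2 * Rpower x1 al)).
Proof.
intros Hth Hy H1 H2 H3 HM HM0 HE Hs1.
set (v := to_v (INR n) p y) in *. set (s := to_s (INR n) p y d) in *.
assert (Ho := family_oscillator th y d X Hy). fold v s in Ho.
assert (Hext := extinction_bound al K p sg (1 - th) th Hp al_in_unit K_pos ltac:(lra)
   v s 0 X x1 x2 Ho ltac:(lra) H1 H2 H3 HE Hs1).
set (c := (1 - p) / 2 * Rpower x1 al) in *.
assert (Hc : 0 < c) by (unfold c; pose proof (Rpower_pos x1 al); nra).
assert (Hlen : x2 - x1 <= v x1 / - s x1 / c).
{ apply Rmult_le_reg_l with c; trivial.
  replace (c * (v x1 / - s x1 / c)) with (v x1 / - s x1) by (field; lra). exact Hext. }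
destruct (mean_value (family_energy th y d)
  (fun t => potential_slope al K sg (1 - th) t * (v t * v t) / 2) x1 x2 H2) as [z [Hz Heq]].
- intros t Ht. eapply is_derive_continuous, (is_derive_energy al K p sg (1 - th) th Hp v s 0 X);
    trivial; lra.
- intros t Ht. apply (is_derive_energy al K p sg (1 - th) th Hp v s 0 X); trivial; lra.
- assert (Hneg : forall x, x1 <= x <= x2 -> s x < 0).
  { intros x Hx. apply (ratio_negative al K p sg (1 - th) th Hp K_pos ltac:(lra) v s 0 X x1 x);
      trivial; try lra.
    intros t Ht. apply HE. lra. }
  assert (Hmon : v z <= v x1).
  { apply (decreasing_on v (fun t => Rpower t al * s t)); try lra.
    - intros t Ht. exact (is_derive_continuous _ _ _ (proj1 (proj2 (Ho t ltac:(lra))))).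
    - intros t Ht. apply Ho. lra.
    - intros t Ht. specialize (Hneg t ltac:(lra)). pose proof (Rpower_pos t al). nra. }
  destruct (Ho z ltac:(lra)) as [Hvz _]. specialize (HM z ltac:(lra)).
  assert (Hvv : v z * v z <= v x1 * v x1) by (apply Rmult_le_compat; lra).
  assert (Hvz2 : 0 < v z * v z) by nra.
  assert (Hb : - (potential_slope al K sg (1 - th) z * (v z * v z) / 2)
               <= M * (v x1 * v x1) / 2).
  { assert (- potential_slope al K sg (1 - th) z * (v z * v z) <= M * (v z * v z))
      by (apply Rmult_le_compat_r; lra).
    assert (M * (v z * v z) <= M * (v x1 * v x1)) by (apply Rmult_le_compat_l; lra).
    lra. }
  assert (Hb0 : 0 <= M * (v x1 * v x1) / 2) by nra.
  apply Rle_trans with (M * (v x1 * v x1) / 2 * (x2 - x1)).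
  + replace (family_energy th y d x1 - family_energy th y d x2)
      with (- (potential_slope al K sg (1 - th) z * (v z * v z) / 2) * (x2 - x1)) by lra.
    apply Rmult_le_compat_r; lra.
  + apply Rmult_le_compat_l; trivial.
Qed.

(** If the energy stayed above [e], then close to [T] one would have [v] small and [s <= - sqrt e].
    A trapped neighbour has almost the same data at such a point [x1], so it starts there with
    energy above [e / 2]; until its energy reaches [0] it can lose at most [e / 4]. *)
Lemma energy_small (th : R) (y d : R -> R) (T e : R) :
  0 <= th <= 1 -> ~ trapped th ->
  (forall kap, 0 < kap -> exists t, trapped t /\ th <= t < th + kap) ->
  0 < T -> family th y d T ->
  (forall eta, 0 < eta -> exists x, 0 <= x < T /\ y x < eta) ->
  0 < e -> exists x0, 0 < x0 < T /\ family_energy th y d x0 < e.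
Proof.
intros Hth Hnt Hacc HT Hy HI He. apply NNPP. intros Hno.
assert (HE : forall x, 0 < x < T -> e <= family_energy th y d x).
{ intros x Hx. apply Rnot_lt_le. intros H. apply Hno. exists x. split; trivial. }
destruct (approach_zero th y d T Hth Hnt HT Hy HI) as [xa [Hxa [Hneg Hsmall]]].
destruct (potential_slope_bound (T / 2) ltac:(lra)) as [M [HM HMb]].
set (G0 := potential al K sg 1 (T / 2)).
assert (HG0 : 0 < G0) by (apply potential_pos; [apply K_pos|lra]).
set (c := sqrt e). assert (Hc : 0 < c) by (apply sqrt_lt_R0; trivial).
assert (Hcc : c * c = e) by (apply sqrt_sqrt; lra).
set (w := (1 - p) / 2 * Rpower (T / 2) al).
assert (Hw : 0 < w) by (unfold w; pose proof (Rpower_pos (T / 2) al); nra).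
assert (Hcw : 0 < c * w) by nra.
(* The first bound keeps the neighbour's [v] below [2]. The second makes the potential energy small
   enough for [s ^ 2 >= e]. The third brings the loss, at most [8 * M * eta / (c * w)], down to
   [e / 4]. *)
set (eta := Rmin 1 (Rmin (e / (G0 + 1)) (e * (c * w) / (32 * M)))).
assert (Heta : 0 < eta).
{ unfold eta. repeat apply Rmin_pos; try lra; apply Rdiv_lt_0_compat; nra. }
assert (Heta1 : eta <= 1) by apply Rmin_l.
assert (Heta2 : eta <= e / (G0 + 1)).
{ unfold eta. eapply Rle_trans; [apply Rmin_r|apply Rmin_l]. }
assert (Heta3 : eta <= e * (c * w) / (32 * M)).
{ unfold eta. eapply Rle_trans; [apply Rmin_r|apply Rmin_r]. }
destruct (Hsmall eta Heta) as [x0 [Hx0 Hv]].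
set (x1 := Rmax x0 (T / 2)).
pose proof (Rmax_l x0 (T / 2)). pose proof (Rmax_r x0 (T / 2)).
assert (Hx1 : x1 < T) by (apply Rmax_lub_lt; lra). fold x1 in H, H0.
specialize (Hv x1 ltac:(lra)). specialize (Hneg x1 ltac:(lra)).
set (v1 := to_v (INR n) p y x1) in *. set (s1 := to_s (INR n) p y d x1) in *.
assert (Hv1 : 0 < v1) by (apply (family_oscillator th y d T Hy); lra).
assert (Hs1 : s1 <= - c).
{ assert (HE1 := HE x1 ltac:(lra)). unfold family_energy, energy in HE1. fold v1 s1 in HE1.
  pose proof (Rpower_pos v1 (p + 1)).
  assert (0 <= th / (p + 1)) by (apply Rdiv_le_0_compat; lra).
  assert (HGx := potential_le th (T / 2) x1 Hth ltac:(lra) H0). fold G0 in HGx.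
  assert (0 < v1 * v1) by nra.
  assert (HGv : potential al K sg (1 - th) x1 * (v1 * v1) <= e).
  { apply Rle_trans with (G0 * (v1 * v1)); [apply Rmult_le_compat_r; lra|].
    apply Rle_trans with (G0 * eta); [apply Rmult_le_compat_l; nra|].
    apply Rle_trans with ((G0 + 1) * (e / (G0 + 1))); [|right; field; lra].
    apply Rmult_le_compat; lra. }
  assert (0 <= th / (p + 1) * Rpower v1 (p + 1)) by (apply Rmult_le_pos; lra).
  assert (c * c <= s1 * s1) by lra. nra. }
destruct (family_energy_close th y d T x1 (Rmin eta (Rmin (c / 2) (e / 2))) Hy ltac:(lra))
  as [kap [Hkap Hclose]].
{ repeat apply Rmin_pos; lra. }
destruct (Hacc kap Hkap) as [t [Ht Htk]].
destruct (Hclose t) as [y' [d' [b [Hb [Hy' [HE' [Hv' Hs']]]]]]].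
{ rewrite Rabs_pos_eq; lra. }
fold v1 in Hv'. fold s1 in Hs'.
assert (L1 := Rmin_l eta (Rmin (c / 2) (e / 2))).
assert (L2 := Rmin_r eta (Rmin (c / 2) (e / 2))).
assert (L3 := Rmin_l (c / 2) (e / 2)). assert (L4 := Rmin_r (c / 2) (e / 2)).
apply Rabs_def2 in HE'. apply Rabs_def2 in Hv'. apply Rabs_def2 in Hs'.
assert (HE1 := HE x1 ltac:(lra)).
destruct Ht as [Ht01 [z [dz [X [x3 [Hz [Hx3 HE3]]]]]]].
(* The neighbour has positive energy at [x1] and negative energy at [x3]; as its energy decreases,
   [x3] comes later and the energy vanishes in between. *)
assert (Hx13 : x1 < x3).
{ apply Rnot_le_lt. intros Hle.
  destruct (family_energy_unique t z dz y' d' X b x3 Hz Hy' ltac:(lra) ltac:(lra)) as [Eq _].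
  destruct Hle as [Hlt|Heq].
  - assert (Hd := family_energy_decreasing t y' d' b x3 x1 Ht01 Hy' ltac:(lra) Hlt Hb). lra.
  - rewrite Heq in Eq, HE3. lra. }
destruct (family_energy_unique t z dz y' d' X b x1 Hz Hy' ltac:(lra) Hb) as [EqE [Eqv Eqs]].
destruct (zero_between (family_energy t z dz) x1 x3 Hx13) as [x2 [Hx2 HE2]]; trivial.
{ intros u Hu. eapply is_derive_continuous,
    (is_derive_energy al K p sg (1 - t) t Hp _ _ 0 X); try lra.
  apply family_oscillator; trivial. }
{ rewrite EqE. lra. }
assert (Hloss := energy_loss t z dz X x1 x2 M Ht01 Hz ltac:(lra) ltac:(lra) ltac:(lra)).
rewrite Eqv, Eqs, EqE, HE2 in Hloss.
set (v' := to_v (INR n) p y' x1) in *. set (s' := to_s (INR n) p y' d' x1) in *.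
assert (Hl : family_energy t y' d' x1 - 0 <=
   M * (v' * v') / 2 * (v' / - s' / ((1 - p) / 2 * Rpower x1 al))).
{ apply Hloss; trivial; try lra.
  - intros u Hu. apply HMb; lra.
  - intros u Hu. destruct (Rle_lt_or_eq_dec u x2 (proj2 Hu)) as [Hlt| ->]; [|lra].
    rewrite <- HE2. left. apply family_energy_decreasing with X; trivial; lra. }
assert (Hv'0 : 0 < v') by (apply (family_oscillator t y' d' b Hy'); lra).
assert (Hw1 : w <= (1 - p) / 2 * Rpower x1 al).
{ unfold w. apply Rmult_le_compat_l; [lra|]. apply Rle_Rpower_l; [|lra].
  pose proof al_in_unit; lra. }
assert (Hq : v' / - s' / ((1 - p) / 2 * Rpower x1 al) <= 4 * eta / (c * w)).
{ replace (4 * eta / (c * w)) with (2 * eta * / (c / 2) * / w) by (field; lra).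
  unfold Rdiv at 1 2. apply Rmult_le_compat.
  - apply Rmult_le_pos; [lra|]. left. apply Rinv_0_lt_compat. lra.
  - left. apply Rinv_0_lt_compat. lra.
  - apply Rmult_le_compat; try lra.
    + left. apply Rinv_0_lt_compat. lra.
    + apply Rinv_le_contravar; lra.
  - apply Rinv_le_contravar; lra. }
assert (HA : 0 <= M * (v' * v') / 2 <= 2 * M).
{ assert (0 <= v' * v' <= 4) by (split; nra). split; nra. }
assert (Hq0 : 0 <= 4 * eta / (c * w)) by (apply Rdiv_le_0_compat; lra).
assert (Hfin : M * (v' * v') / 2 * (v' / - s' / ((1 - p) / 2 * Rpower x1 al))
               <= 2 * M * (4 * eta / (c * w))).
{ eapply Rle_trans; [apply Rmult_le_compat_l; [apply HA|apply Hq]|].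
  apply Rmult_le_compat_r; lra. }
assert (Hfin2 : 2 * M * (4 * eta / (c * w)) <= e / 4).
{ replace (2 * M * (4 * eta / (c * w))) with (8 * M / (c * w) * eta) by (field; lra).
  apply Rle_trans with (8 * M / (c * w) * (e * (c * w) / (32 * M))).
  - apply Rmult_le_compat_l; trivial. apply Rdiv_le_0_compat; lra.
  - right. field. lra. }
lra.
Qed.

(** The factor [x ^ (2 al + 2)] compensates the fastest decaying term of the potential. Without
    absorption every term of the product's derivative is then nonnegative. This serves to exclude
    [th = 0] as the critical parameter. *)
Lemma linear_energy_lower_bound (y d : R -> R) (T x0 x : R) :
  family 0 y d T -> 0 < x0 -> x0 <= x -> x < T ->
  Rpower x0 (2 * al + 2) * family_energy 0 y d x0
    <= Rpower x (2 * al + 2) * family_energy 0 y d x.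
Proof.
intros Hy H0 Hx HT. pose proof al_in_unit.
assert (Ho := family_oscillator 0 y d T Hy).
set (v := to_v (INR n) p y) in *. set (s := to_s (INR n) p y d) in *.
assert (HD : forall t, x0 <= t <= x ->
  is_derive (fun t => Rpower t (2 * al + 2) * family_energy 0 y d t) t
   ((2 * al + 2) * (Rpower t (2 * al + 2) / t) * family_energy 0 y d t
    + Rpower t (2 * al + 2) * (potential_slope al K sg (1 - 0) t * (v t * v t) / 2))).
{ intros t Ht.
  refine (is_derive_Rmult (fun t => Rpower t (2 * al + 2)) (family_energy 0 y d) t _ _ _ _).
  - apply is_derive_Rpower; lra.
  - apply (is_derive_energy al K p sg (1 - 0) 0 Hp v s 0 T); trivial; lra. }
apply Ropp_le_cancel.
apply (decreasing_on (fun t => - (Rpower t (2 * al + 2) * family_energy 0 y d t)) (fun t =>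
   - ((2 * al + 2) * (Rpower t (2 * al + 2) / t) * family_energy 0 y d t
    + Rpower t (2 * al + 2) * (potential_slope al K sg (1 - 0) t * (v t * v t) / 2)))); trivial.
- intros t Ht. 
  apply (continuous_opp (V:=R_NormedModule)
    (fun t => Rpower t (2 * al + 2) * family_energy 0 y d t)).
  eapply is_derive_continuous, HD, Ht.
- intros t Ht. apply (is_derive_opp
    (fun t => Rpower t (2 * al + 2) * family_energy 0 y d t)), HD. lra.
- intros t Ht. unfold family_energy, energy, potential, potential_slope. fold v s.
  set (P := Rpower t (2 * al + 2)). assert (HP : 0 < P) by apply Rpower_pos.
  set (A := Rpower t (sg - 2 * al)). assert (HA : 0 < A) by apply Rpower_pos.
  set (B := Rpower t (-2 * al - 2)). set (Z := Rpower (v t) (p + 1)).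
  match goal with |- ?g <= 0 => replace g with
    (- (P / t * ((2 * al + 2) * (s t * s t) / 2 + A * (v t * v t) / 2 * (2 + sg)))) end.
  2:{ field. lra. }
  assert (0 <= s t * s t) by apply Rle_0_sqr. assert (0 <= v t * v t) by apply Rle_0_sqr.
  assert (0 < P / t) by (apply Rdiv_lt_0_compat; lra).
  assert (0 <= A * (v t * v t)) by (apply Rmult_le_pos; lra).
  assert (0 <= (2 * al + 2) * (s t * s t)) by (apply Rmult_le_pos; lra).
  assert (0 <= A * (v t * v t) / 2 * (2 + sg)) by (apply Rmult_le_pos; lra).
  assert (0 <= P / t * ((2 * al + 2) * (s t * s t) / 2 + A * (v t * v t) / 2 * (2 + sg))).
  { apply Rmult_le_pos; lra. }
  lra.
Qed.

Lemma critical_profile :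
  exists th y d T, 0 < th < 1 /\ 0 < T /\ family th y d T /\
    forall e, 0 < e -> exists x1, 0 < x1 < T /\
      forall x, x1 <= x < T -> y x < e /\ Rabs (d x) < e.
Proof.
destruct critical_value as [th [Hth [Hnt [Hlow Hacc]]]].
destruct (untrapped_dies th Hth Hnt) as [y [d [T [HT [Hy HI]]]]].
assert (Hacc' : forall kap, 0 < kap -> exists t, trapped t /\ th <= t < th + kap).
{ intros kap Hk. destruct (Hacc kap Hk) as [t [Ht Htk]].
  exists t. split; trivial. split; [apply Hlow|]; trivial. }
assert (Hsm : forall e, 0 < e -> exists x0, 0 < x0 < T /\
          forall x, x0 <= x < T -> family_energy th y d x < e).
{ intros e He.
  destruct (energy_small th y d T e ltac:(lra) Hnt Hacc' HT Hy HI He) as [x0 [Hx0 HE]].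
  exists x0. split; trivial. intros x Hx.
  destruct (Rle_lt_or_eq_dec x0 x (proj1 Hx)) as [Hlt| <-]; trivial.
  assert (H := family_energy_decreasing th y d T x0 x ltac:(lra) Hy ltac:(lra) Hlt ltac:(lra)).
  lra. }
(* For [th = 0] the energy is positive at [T / 2] and the weighted energy does not decrease, which
   keeps the energy away from [0] up to [T], against [Hsm]. *)
assert (Hth0 : 0 < th).
{ destruct (proj1 Hth) as [H|H]; trivial. exfalso. subst th.
  set (E0 := family_energy 0 y d (T / 2)).
  assert (HE0 : 0 < E0).
  { unfold E0, family_energy, energy. replace (0 / (p + 1)) with 0 by (field; lra). rewrite Rmult_0_l.
    destruct (family_oscillator 0 y d T Hy (T / 2) ltac:(lra)) as [Hv _].
    set (v := to_v (INR n) p y (T / 2)) in *. set (s := to_s (INR n) p y d (T / 2)).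
    pose proof (potential_pos al K sg (1 - 0) K_pos ltac:(lra) (T / 2)).
    assert (0 <= s * s) by apply Rle_0_sqr.
    assert (0 < potential al K sg (1 - 0) (T / 2) * (v * v)).
    { apply Rmult_lt_0_compat; nra. }
    lra. }
  pose proof (Rpower_pos (T / 2) (2 * al + 2)) as Hr1.
  pose proof (Rpower_pos T (2 * al + 2)) as Hr2.
  set (r1 := Rpower (T / 2) (2 * al + 2)) in *. set (r2 := Rpower T (2 * al + 2)) in *.
  destruct (Hsm (r1 * E0 / r2)) as [x0 [Hx0 HE]].
  { apply Rdiv_lt_0_compat; nra. }
  pose proof (Rmax_l x0 (T / 2)). pose proof (Rmax_r x0 (T / 2)).
  assert (Rmax x0 (T / 2) < T) by (apply Rmax_lub_lt; lra).
  set (x := Rmax x0 (T / 2)) in *.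
  assert (Hlb := linear_energy_lower_bound y d T (T / 2) x Hy ltac:(lra) ltac:(lra) ltac:(lra)).
  fold E0 r1 in Hlb. specialize (HE x ltac:(lra)).
  assert (Hx : Rpower x (2 * al + 2) <= r2).
  { apply Rle_Rpower_l; [pose proof al_in_unit|]; lra. }
  assert (HEx := untrapped_energy 0 y d T x ltac:(lra) Hnt Hy ltac:(lra)).
  assert (r2 * family_energy 0 y d x < r1 * E0).
  { apply Rmult_lt_compat_l with (r := r2) in HE; trivial.
    replace (r2 * (r1 * E0 / r2)) with (r1 * E0) in HE by (field; lra). exact HE. }
  assert (Rpower x (2 * al + 2) * family_energy 0 y d x <= r2 * family_energy 0 y d x)
    by (apply Rmult_le_compat_r; trivial).
  lra. }
exists th, y, d, T. split; [lra|]. split; [|split]; trivial.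
intros e He.
destruct (approach_zero th y d T ltac:(lra) Hnt HT Hy HI) as [xa [Hxa [_ Hsmall]]].
set (k := expo_v (INR n) p).
assert (Hk : 0 < k) by (unfold k, expo_v; apply Rdiv_lt_0_compat; lra).
set (be := expo_s (INR n) p).
assert (Hbe : 0 < be) by (apply expo_s_pos; trivial).
pose proof (Rpower_pos (T / 2) k) as Hr1. pose proof (Rpower_pos (T / 2) be) as Hr2.
set (r1 := Rpower (T / 2) k) in *. set (r2 := Rpower (T / 2) be) in *.
(* The second bound gives [k * (y x / x) <= e / 4] beyond [T / 2], while [e2] is the bound on [s]
   that gives [Rabs (d x + k * (y x / x)) <= e / 2]. *)
set (e1 := Rmin e (e * T / (8 * k))).
assert (He1 : 0 < e1).
{ unfold e1. apply Rmin_pos; trivial. apply Rdiv_lt_0_compat; nra. }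
assert (He1a : e1 <= e) by apply Rmin_l.
assert (He1b : e1 <= e * T / (8 * k)) by apply Rmin_r.
set (e2 := r2 * (e / 2)). assert (He2 : 0 < e2) by (unfold e2; nra).
(* For [v <= 1], [s ^ 2 / 2] is at most the energy plus [v], so two bounds by [e2 * e2 / 4] give
   [s ^ 2 < e2 ^ 2]. *)
destruct (Hsm (e2 * e2 / 4)) as [x2 [Hx2 HE2]]; [nra|].
destruct (Hsmall (Rmin (r1 * e1) (Rmin 1 (e2 * e2 / 4)))) as [x3 [Hx3 Hv3]].
{ repeat apply Rmin_pos; nra. }
pose proof (Rmax_l (Rmax x2 x3) (T / 2)). pose proof (Rmax_r (Rmax x2 x3) (T / 2)).
pose proof (Rmax_l x2 x3). pose proof (Rmax_r x2 x3).
assert (Rmax (Rmax x2 x3) (T / 2) < T) by (repeat apply Rmax_lub_lt; lra).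
set (x1 := Rmax (Rmax x2 x3) (T / 2)) in *.
exists x1. split; [lra|]. intros x Hx.
specialize (HE2 x ltac:(lra)). specialize (Hv3 x ltac:(lra)).
assert (L1 := Rmin_l (r1 * e1) (Rmin 1 (e2 * e2 / 4))).
assert (L2 := Rmin_r (r1 * e1) (Rmin 1 (e2 * e2 / 4))).
assert (L3 := Rmin_l 1 (e2 * e2 / 4)). assert (L4 := Rmin_r 1 (e2 * e2 / 4)).
assert (Hyx : 0 < y x) by (eapply positive_solution_pos; [exact Hy|lra]).
assert (Hye : y x < e1).
{ assert (r1 * y x <= to_v (INR n) p y x).
  { unfold to_v. apply Rmult_le_compat_r; [lra|]. apply Rle_Rpower_l; fold k; lra. }
  nra. }
split; [lra|].
assert (Hv0 : 0 < to_v (INR n) p y x) by (apply (family_oscillator th y d T Hy); lra).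
assert (Hs2 : to_s (INR n) p y d x * to_s (INR n) p y d x < e2 * e2).
{ unfold family_energy, energy in HE2.
  set (v := to_v (INR n) p y x) in *. set (s := to_s (INR n) p y d x) in *.
  assert (Hvp := Rpower_le_self p v (proj1 Hp) ltac:(lra)). pose proof (Rpower_pos v (p + 1)).
  pose proof (potential_pos al K sg (1 - th) K_pos ltac:(lra) x).
  assert (0 <= potential al K sg (1 - th) x * (v * v)) by (apply Rmult_le_pos; nra).
  assert (Htp : 0 <= th / (p + 1) <= 1).
  { split; [apply Rdiv_le_0_compat; lra|].
    apply Rmult_le_reg_r with (p + 1); [lra|]. unfold Rdiv.
    rewrite Rmult_assoc, Rinv_l by lra. lra. }
  assert (th / (p + 1) * Rpower v (p + 1) <= v).
  { rewrite <- (Rmult_1_l v) at 2. apply Rmult_le_compat; lra. }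
  lra. }
assert (Hs3 : Rabs (to_s (INR n) p y d x) < e2).
{ rewrite <- (Rabs_pos_eq e2) by lra. apply Rsqr_lt_abs_0. exact Hs2. }
assert (Hkyx : 0 <= k * (y x / x) <= e / 4).
{ assert (0 < y x / x) by (apply Rdiv_lt_0_compat; lra). split; [nra|].
  apply Rle_trans with (k * ((e * T / (8 * k)) / (T / 2))); [|right; field; lra].
  apply Rmult_le_compat_l; [lra|]. unfold Rdiv at 1 3. apply Rmult_le_compat; try lra.
  - left. apply Rinv_0_lt_compat; lra.
  - apply Rinv_le_contravar; lra. }
assert (Hdk : Rabs (d x + k * (y x / x)) <= e / 2).
{ unfold to_s in Hs3. fold k be in Hs3. rewrite Rabs_mult in Hs3.
  rewrite (Rabs_pos_eq (Rpower x be)) in Hs3 by (left; apply Rpower_pos).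
  assert (r2 <= Rpower x be) by (apply Rle_Rpower_l; lra).
  pose proof (Rabs_pos (d x + k * (y x / x))).
  apply Rmult_le_reg_l with r2; trivial. fold e2. nra. }
replace (d x) with ((d x + k * (y x / x)) + - (k * (y x / x))) by ring.
eapply Rle_lt_trans; [apply Rabs_triang|].
rewrite Rabs_Ropp, (Rabs_pos_eq (k * (y x / x))) by lra. lra.
Qed.

End Shooting.

(** * Exclusion of P2 and P3 *)

Section NoDoubleInterface.
Context (nu p sg c : R) (w dw : R -> R) (a b : R).
Context (Hnu : 1 <= nu <= 2) (Hp : 0 < p < 1) (Hsg : 0 <= sg <= 2 * expo_t nu p)
  (Hc : 0 <= c) (Hab : 0 <= a < b).
Context (Hw : forall x, a < x < b -> 0 < w x /\ is_derive w x (dw x) /\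
     is_derive dw x (c * Rpower (w x) p - 1 * (Rpower x sg * w x) - nu / x * dw x)).

Definition profile_energy (x : R) : R :=
  energy (expo_t nu p) (hardy nu p) p sg 1 c (to_v nu p w x) (to_s nu p w dw x) x.

Lemma profile_energy_le (x : R) :
  profile_energy x <= to_s nu p w dw x * to_s nu p w dw x / 2
    + potential (expo_t nu p) (hardy nu p) sg 1 x * (to_v nu p w x * to_v nu p w x) / 2.
Proof.
unfold profile_energy, energy. pose proof (Rpower_pos (to_v nu p w x) (p + 1)).
assert (0 <= c / (p + 1)) by (apply Rdiv_le_0_compat; lra).
assert (0 <= c / (p + 1) * Rpower (to_v nu p w x) (p + 1)) by (apply Rmult_le_pos; lra).
lra.
Qed.

(** Points of small energy near [a] and strict decrease make the energy negative and bounded away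
    from [0] on [[xb, b)]. Near [b] its only negative term, of order [v ^ (p + 1)], tends to [0]
    together with [w], a contradiction. *)
Lemma double_interface_absurd :
  w b = 0 -> continuous w b ->
  (forall e x1, 0 < e -> a < x1 < b -> exists x, a < x < x1 /\ profile_energy x < e) -> False.
Proof.
intros Hwb Hcb Hleft.
assert (Hal := expo_t_range nu p Hnu Hp). assert (HK := hardy_pos nu p Hnu Hp).
assert (Ho := radial_oscillator nu p sg 1 c Hp w dw a b (proj1 Hab) Hw).
assert (Hdec : forall x1 x2, a < x1 -> x1 < x2 -> x2 < b ->
                 profile_energy x2 < profile_energy x1).
{ intros x1 x2 H1 H2 H3.
  apply (energy_decreasing _ _ p sg 1 c Hp Hal HK Hsg) with a b; trivial; lra. }
set (xa := (2 * a + b) / 3). set (xb := (a + 2 * b) / 3).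
assert (Hx : a < xa < xb) by (unfold xa, xb; lra).
assert (Hxb : xb < b) by (unfold xb; lra).
assert (HEa : profile_energy xa <= 0).
{ apply Rnot_lt_le. intros Hlt.
  destruct (Hleft (profile_energy xa) xa Hlt ltac:(lra)) as [x [Hx1 Hx2]].
  assert (H := Hdec x xa ltac:(lra) ltac:(lra) ltac:(lra)). lra. }
assert (HEb := Hdec xa xb ltac:(lra) ltac:(lra) ltac:(lra)).
set (E := - profile_energy xb). assert (HE : 0 < E) by (unfold E; lra).
set (k := expo_v nu p).
assert (Hk : 0 <= k) by (unfold k, expo_v; apply Rdiv_le_0_compat; lra).
pose proof (Rpower_pos b k) as Hbk.
set (e := Rmin 1 (E / (c + 1))).
assert (He : 0 < e) by (apply Rmin_pos; [lra|apply Rdiv_lt_0_compat; lra]).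
assert (He1 : e <= 1) by apply Rmin_l. assert (He2 : e <= E / (c + 1)) by apply Rmin_r.
destruct (continuous_epsilon w b (e / Rpower b k) Hcb) as [del [Hdel Hcl]].
{ apply Rdiv_lt_0_compat; trivial. }
pose proof (Rmax_l xb (b - del / 2)). pose proof (Rmax_r xb (b - del / 2)).
assert (Hm : Rmax xb (b - del / 2) < b) by (apply Rmax_lub_lt; lra).
set (x := (Rmax xb (b - del / 2) + b) / 2).
assert (Hxr : xb < x < b) by (unfold x; lra).
specialize (Hcl x). rewrite Rabs_minus_sym, Rabs_pos_eq in Hcl by lra.
specialize (Hcl ltac:(unfold x; lra)). rewrite Hwb, Rminus_0_r in Hcl.
destruct (Hw x ltac:(lra)) as [Hwx _]. rewrite Rabs_pos_eq in Hcl by lra.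
destruct (Ho x ltac:(lra)) as [Hvx _].
assert (Hv : to_v nu p w x < e).
{ unfold to_v. fold k. apply Rle_lt_trans with (Rpower b k * w x).
  - apply Rmult_le_compat_r; [lra|]. apply Rle_Rpower_l; lra.
  - apply Rmult_lt_compat_l with (r := Rpower b k) in Hcl; trivial.
    replace (Rpower b k * (e / Rpower b k)) with e in Hcl by (field; lra). exact Hcl. }
assert (HEx := Hdec xb x ltac:(lra) ltac:(lra) ltac:(lra)).
assert (Hlow : - E < profile_energy x); [|unfold E in Hlow; lra].
unfold profile_energy, energy. set (v := to_v nu p w x) in *. set (s := to_s nu p w dw x).
assert (0 <= s * s) by apply Rle_0_sqr.
pose proof (potential_pos (expo_t nu p) (hardy nu p) sg 1 HK ltac:(lra) x).
assert (0 <= potential (expo_t nu p) (hardy nu p) sg 1 x * (v * v)).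
{ apply Rmult_le_pos; [lra|]. apply Rle_0_sqr. }
assert (Hvp := Rpower_le_self p v (proj1 Hp) ltac:(lra)). pose proof (Rpower_pos v (p + 1)).
assert (Hcp : 0 <= c / (p + 1) <= c).
{ split; [apply Rdiv_le_0_compat; lra|]. apply Rmult_le_reg_r with (p + 1); [lra|].
  unfold Rdiv. rewrite Rmult_assoc, Rinv_l by lra. nra. }
assert (c / (p + 1) * Rpower v (p + 1) <= c * v) by (apply Rmult_le_compat; lra).
assert ((c + 1) * e <= E).
{ apply Rle_trans with ((c + 1) * (E / (c + 1))); [apply Rmult_le_compat_l; lra|].
  right. field. lra. }
assert (c * v <= c * e) by (apply Rmult_le_compat_l; lra).
lra.
Qed.

(** The energy is bounded by its quadratic part, which is continuous at [a > 0] and vanishes there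
    with [w] and [dw]. *)
Lemma left_energy_interior :
  0 < a -> w a = 0 -> dw a = 0 -> continuous w a -> continuous dw a ->
  forall e x1, 0 < e -> a < x1 < b -> exists x, a < x < x1 /\ profile_energy x < e.
Proof.
intros Ha Hwa Hdwa Cw Cd e x1 He Hx1.
assert (Cp : forall q, continuous (fun t => Rpower t q) a).
{ intros q. eapply is_derive_continuous, is_derive_Rpower; trivial. }
assert (Cv : continuous (to_v nu p w) a).
{ unfold to_v. apply continuous_Rmult; trivial. }
assert (Cs : continuous (to_s nu p w dw) a).
{ unfold to_s. apply continuous_Rmult; trivial. apply continuous_Rplus; trivial.
  apply continuous_Rmult; [apply continuous_const|]. apply continuous_Rmult; trivial.
  apply (ex_derive_continuous (fun t => / t)). auto_derive. lra. }
set (B := fun x => to_s nu p w dw x * to_s nu p w dw x / 2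
    + potential (expo_t nu p) (hardy nu p) sg 1 x * (to_v nu p w x * to_v nu p w x) / 2).
assert (CB : continuous B a).
{ unfold B. apply continuous_Rplus; (apply continuous_Rmult; [|apply continuous_const]).
  - apply continuous_Rmult; trivial.
  - apply continuous_Rmult; [|apply continuous_Rmult; trivial].
    eapply is_derive_continuous, is_derive_potential; trivial. }
assert (HB : B a = 0).
{ unfold B, to_s, to_v. rewrite Hwa, Hdwa. field. lra. }
destruct (continuous_epsilon B a e CB He) as [del [Hdel Hcl]].
pose proof (Rmin_l x1 (a + del)). pose proof (Rmin_r x1 (a + del)).
assert (a < Rmin x1 (a + del)) by (apply Rmin_glb_lt; lra).
exists ((a + Rmin x1 (a + del)) / 2). set (x := (a + Rmin x1 (a + del)) / 2).
assert (Hx : a < x < x1) by (unfold x; lra). split; trivial.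
specialize (Hcl x). rewrite Rabs_pos_eq in Hcl by lra.
specialize (Hcl ltac:(unfold x; lra)). rewrite HB, Rminus_0_r in Hcl.
eapply Rle_lt_trans; [apply profile_energy_le|]. fold (B x).
eapply Rle_lt_trans; [apply Rle_abs|exact Hcl].
Qed.

(** P2 only says that [w / x] tends to [0] and gives no pointwise control of [dw]. The mean value
    theorem on [[x / 2, x]] provides one point [z] where [dw] is small too, and one point is what
    the conclusion asks for. The singular potential is harmless, since [potential * v ^ 2 = x ^ (2
    expo_s) * (x ^ sg * w ^ 2 + K * (w / x) ^ 2)]. *)
Lemma left_energy_origin :
  a = 0 ->
  (forall e, 0 < e -> exists del, 0 < del /\ forall x, 0 < x < del -> Rabs (w x / x) < e) ->
  forall e x1, 0 < e -> a < x1 < b -> exists x, a < x < x1 /\ profile_energy x < e.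
Proof.
intros Ha Hlim e x1 He Hx1.
assert (HK := hardy_pos nu p Hnu Hp). assert (Hbe := expo_s_pos nu p Hnu Hp).
set (K := hardy nu p) in *. set (k := expo_v nu p).
assert (Hk : 0 <= k) by (unfold k, expo_v; apply Rdiv_le_0_compat; lra).
(* The coefficients of [e1 ^ 2]: [(3 + k) ^ 2] from [s ^ 2], and [1 + K] from the potential term. *)
set (C := (3 + k) * (3 + k) + 1 + K). assert (HC : 0 < C) by (unfold C; nra).
set (e1 := Rmin 1 (e / C)).
assert (He1 : 0 < e1) by (apply Rmin_pos; [lra|apply Rdiv_lt_0_compat; lra]).
assert (He1a : e1 <= 1) by apply Rmin_l. assert (He1b : e1 <= e / C) by apply Rmin_r.
destruct (Hlim e1 He1) as [del [Hdel Hcl]].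
set (x := Rmin x1 (Rmin del 1) / 2).
assert (L1 := Rmin_l x1 (Rmin del 1)). assert (L2 := Rmin_r x1 (Rmin del 1)).
assert (L3 := Rmin_l del 1). assert (L4 := Rmin_r del 1).
assert (L5 : 0 < Rmin x1 (Rmin del 1)) by (repeat apply Rmin_pos; lra).
destruct (mean_value w dw (x / 2) x) as [z [Hz Heq]].
- unfold x; lra.
- intros t Ht. apply (is_derive_continuous _ _ (dw t)), Hw. unfold x in *; lra.
- intros t Ht. apply Hw. unfold x in *; lra.
- assert (Hzr : 0 < z < x) by (unfold x in *; lra).
  assert (Hsmall : forall t, 0 < t <= x -> 0 < w t < e1 * t).
  { intros t Ht. destruct (Hw t ltac:(unfold x in *; lra)) as [Hwt _]. split; trivial.
    specialize (Hcl t ltac:(unfold x in *; lra)).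
    rewrite Rabs_pos_eq in Hcl by (left; apply Rdiv_lt_0_compat; lra).
    apply Rmult_lt_compat_r with (r := t) in Hcl; [|lra].
    unfold Rdiv in Hcl. rewrite Rmult_assoc, Rinv_l in Hcl by lra. lra. }
  exists z. split; [unfold x in *; lra|].
  assert (Hdz : Rabs (dw z) <= 3 * e1).
  { assert (Hx0 : 0 < x) by (unfold x; lra).
    assert (H1 := Hsmall x ltac:(lra)). assert (H2 := Hsmall (x / 2) ltac:(lra)).
    assert (Hd : dw z = (w x - w (x / 2)) * (2 / x)).
    { rewrite Heq. field. lra. }
    assert (Hpx : 0 < 2 / x) by (apply Rdiv_lt_0_compat; lra).
    assert (E1 : e1 * x * (2 / x) = 2 * e1) by (field; lra).
    apply Rabs_le. rewrite Hd. split; nra. }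
  destruct (Hsmall z ltac:(lra)) as [Hw0 Hw1].
  assert (Hz1 : z <= 1) by (unfold x in *; lra).
  assert (Hq : 0 < w z / z < e1).
  { split; [apply Rdiv_lt_0_compat; lra|]. apply Rmult_lt_reg_r with z; [lra|].
    unfold Rdiv. rewrite Rmult_assoc, Rinv_l by lra. lra. }
  assert (Hwe : w z < e1) by nra.
  set (S := Rpower z (expo_s nu p)).
  assert (HS : 0 < S <= 1) by (split; [apply Rpower_pos|apply Rpower_le_1; lra]).
  assert (Hs : Rabs (to_s nu p w dw z) <= (3 + k) * e1).
  { unfold to_s. fold S k. rewrite Rabs_mult, (Rabs_pos_eq S) by lra.
    assert (Rabs (dw z + k * (w z / z)) <= (3 + k) * e1).
    { eapply Rle_trans; [apply Rabs_triang|].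
      rewrite (Rabs_pos_eq (k * (w z / z))) by (apply Rmult_le_pos; lra).
      assert (k * (w z / z) <= k * e1) by (apply Rmult_le_compat_l; lra). lra. }
    pose proof (Rabs_pos (dw z + k * (w z / z))). nra. }
  assert (Hss : to_s nu p w dw z * to_s nu p w dw z <= (3 + k) * (3 + k) * (e1 * e1)).
  { replace ((3 + k) * (3 + k) * (e1 * e1)) with (((3 + k) * e1) * ((3 + k) * e1)) by ring.
    apply (Rsqr_le_abs_1 (to_s nu p w dw z)).
    rewrite (Rabs_pos_eq ((3 + k) * e1)) by nra. exact Hs. }
  assert (Hpv : potential (expo_t nu p) K sg 1 z * (to_v nu p w z * to_v nu p w z)
                <= (1 + K) * (e1 * e1)).
  { replace (potential (expo_t nu p) K sg 1 z * (to_v nu p w z * to_v nu p w z))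
      with (S * S * (Rpower z sg * (w z * w z) + K * (w z / z * (w z / z)))).
    - assert (Hzs : 0 < Rpower z sg <= 1).
      { split; [apply Rpower_pos|apply Rpower_le_1; lra]. }
      assert (0 <= w z * w z <= e1 * e1) by (split; nra).
      assert (0 <= w z / z * (w z / z) <= e1 * e1) by (split; nra).
      assert (Rpower z sg * (w z * w z) <= 1 * (e1 * e1)) by (apply Rmult_le_compat; lra).
      assert (K * (w z / z * (w z / z)) <= K * (e1 * e1)) by (apply Rmult_le_compat_l; lra).
      assert (0 <= Rpower z sg * (w z * w z)) by (apply Rmult_le_pos; lra).
      assert (0 <= K * (w z / z * (w z / z))) by (apply Rmult_le_pos; lra).
      assert (0 < S * S <= 1) by (split; nra).
      set (Y := Rpower z sg * (w z * w z) + K * (w z / z * (w z / z))) in *.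
      assert (S * S * Y <= 1 * Y) by (apply Rmult_le_compat_r; unfold Y; lra).
      unfold Y in *; lra.
    - unfold potential, to_v. fold k.
      assert (E1 : Rpower z (sg - 2 * expo_t nu p) * (Rpower z k * Rpower z k)
                   = S * S * Rpower z sg).
      { unfold S. rewrite <- !Rpower_plus. f_equal.
        unfold k, expo_t, expo_s, expo_v. field. lra. }
      assert (E2 : Rpower z (-2 * expo_t nu p - 2) * (Rpower z k * Rpower z k)
                   = S * S / (z * z)).
      { replace (S * S / (z * z)) with
          (Rpower z (expo_s nu p + expo_s nu p + - (1) + - (1))).
        - rewrite <- !Rpower_plus. f_equal.
          unfold k, expo_t, expo_s, expo_v. field. lra.
        - rewrite !Rpower_plus, Rpower_Ropp, Rpower_1 by lra. unfold S. field. lra. }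
      transitivity (Rpower z (sg - 2 * expo_t nu p) * (Rpower z k * Rpower z k) * (w z * w z)
        + K * (Rpower z (-2 * expo_t nu p - 2) * (Rpower z k * Rpower z k)) * (w z * w z));
        [|ring].
      rewrite E1, E2. field. lra. }
  eapply Rle_lt_trans; [apply profile_energy_le|]. fold K.
  assert (e1 * e1 <= e1) by nra.
  assert (C * e1 <= e).
  { apply Rle_trans with (C * (e / C)); [apply Rmult_le_compat_l; lra|]. right. field. lra. }
  assert (C * (e1 * e1) <= C * e1) by (apply Rmult_le_compat_l; lra).
  assert (Hfin : (3 + k) * (3 + k) * (e1 * e1) + (1 + K) * (e1 * e1) = C * (e1 * e1))
    by (unfold C; ring).
  lra.
Qed.

End NoDoubleInterface.

(** * Extension by zero beyond the interface *)

Lemma is_derive_zero_extension (g dg : R -> R) (T : R) :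
  (exists x0, x0 < T /\ forall x, x0 < x < T -> is_derive g x (dg x)) ->
  (forall e, 0 < e -> exists x1, x1 < T /\ forall x, x1 <= x < T -> Rabs (g x) < e) ->
  (forall e, 0 < e -> exists x1, x1 < T /\ forall x, x1 <= x < T -> Rabs (dg x) < e) ->
  is_derive (fun x => if Rlt_dec x T then g x else 0) T 0.
Proof.
intros [x0 [Hx0 Hd]] Hg Hdg. apply is_derive_Reals. intros eps Heps.
destruct (Hdg (eps / 2) ltac:(lra)) as [x1 [Hx1 H1]].
pose proof (Rmax_l x0 x1). pose proof (Rmax_r x0 x1).
assert (Hm : Rmax x0 x1 < T) by (apply Rmax_lub_lt; trivial).
assert (Hdel : 0 < T - Rmax x0 x1) by lra.
exists (mkposreal _ Hdel). intros h Hh0 Hh. simpl in Hh.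
destruct (Rlt_dec T T); [lra|]. rewrite !Rminus_0_r.
destruct (Rlt_dec (T + h) T) as [Hlt|Hge].
2:{ unfold Rdiv. rewrite Rmult_0_l, Rabs_R0. exact Heps. }
rewrite Rabs_left in Hh by lra.
(* The value of [g] at [T] is arbitrary, so the mean value theorem is applied up to a point [z < T]
   where [g] is smaller than the supposed excess. *)
assert (Hb : Rabs (g (T + h)) <= eps / 2 * - h).
{ apply Rnot_lt_le. intros Hbad.
  destruct (Hg (Rabs (g (T + h)) - eps / 2 * - h) ltac:(lra)) as [x2 [Hx2 H2]].
  pose proof (Rmax_l x2 (T + h)). pose proof (Rmax_r x2 (T + h)).
  assert (Hm2 : Rmax x2 (T + h) < T) by (apply Rmax_lub_lt; trivial).
  set (z := (Rmax x2 (T + h) + T) / 2).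
  assert (Hz : T + h < z < T) by (unfold z; lra).
  specialize (H2 z ltac:(unfold z in *; lra)).
  destruct (mean_value g dg (T + h) z) as [u [Hu Heq]]; [lra| | |].
  - intros t Ht. eapply is_derive_continuous, Hd. lra.
  - intros t Ht. apply Hd. lra.
  - specialize (H1 u ltac:(lra)).
    assert (H5 : Rabs (g z - g (T + h)) <= eps / 2 * - h).
    { rewrite Heq, Rabs_mult, (Rabs_pos_eq (z - (T + h))) by lra.
      pose proof (Rabs_pos (dg u)). apply Rmult_le_compat; lra. }
    assert (H6 : Rabs (g (T + h)) <= Rabs (g z) + Rabs (g z - g (T + h))).
    { replace (g (T + h)) with (g z + - (g z - g (T + h))) at 1 by ring.
      eapply Rle_trans; [apply Rabs_triang|]. rewrite Rabs_Ropp. lra. }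
    lra. }
unfold Rdiv. rewrite Rabs_mult, Rabs_inv, (Rabs_left h) by lra.
apply Rle_lt_trans with (eps / 2 * - h * / - h).
- apply Rmult_le_compat_r; trivial. left. apply Rinv_0_lt_compat. lra.
- rewrite Rmult_assoc, Rinv_r by lra. lra.
Qed.

Lemma is_derive_cutoff (g dg : R -> R) (T x : R) :
  (x < T -> is_derive g x (dg x)) ->
  (x = T -> is_derive (fun x => if Rlt_dec x T then g x else 0) T 0) ->
  is_derive (fun x => if Rlt_dec x T then g x else 0) x (if Rlt_dec x T then dg x else 0).
Proof.
intros H1 H2. destruct (Rlt_dec x T) as [Hlt|Hge].
- apply is_derive_ext_loc with g; [|apply H1; trivial].
  apply (locally_between _ (x - 1) T); [lra|]. intros t Ht.
  destruct (Rlt_dec t T); [reflexivity|lra].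
- destruct (Req_dec x T) as [->|Hne]; [apply H2; reflexivity|].
  apply is_derive_ext_loc with (fun _ => 0); [|apply is_derive_Rconst].
  apply (locally_between _ T (x + 1)); [lra|]. intros t Ht.
  destruct (Rlt_dec t T); [lra|reflexivity].
Qed.

(** * Profiles with interface *)

(** The critical solution is rescaled as [W * y (x / lam)]. The reaction gets coefficient [1] if
    [lam ^ (2 + sg) = 1 - th], and the absorption gets coefficient [c] if
    [W ^ (1 - p) = c * lam ^ 2 / th]; both are solvable because [0 < th < 1]. *)
Lemma compact_profile (n : nat) (p sg c : R) :
  1 <= INR n <= 2 -> 0 < p < 1 -> 0 <= sg <= 2 * expo_t (INR n) p -> 0 < c ->
  exists (w dw : R -> R) (T : R), 0 < T /\ (forall x, x < T -> 0 < w x /\ is_derive w x (dw x)) /\ dw 0 = 0 /\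
    (forall x, 0 < x < T -> is_derive dw x
      (c * Rpower (w x) p - Rpower x sg * w x - INR n / x * dw x)) /\
    forall e, 0 < e -> exists x1, 0 < x1 < T /\
      forall x, x1 <= x < T -> w x < e /\ Rabs (dw x) < e.
Proof.
intros Hn Hp Hsg Hc.
destruct (critical_profile n p sg Hn Hp Hsg) as [th [y [d [T [Hth [HT [Hy Hlim]]]]]]].
set (lam := Rpower (1 - th) (/ (2 + sg))).
assert (Hlam : 0 < lam) by apply Rpower_pos.
assert (Elam : lam * lam * Rpower lam sg = 1 - th).
{ replace (lam * lam) with (Rpower lam (1 + 1)) by (rewrite Rpower_plus, Rpower_1; trivial).
  rewrite <- Rpower_plus. unfold lam. rewrite Rpower_mult.
  replace (/ (2 + sg) * (1 + 1 + sg)) with 1 by (field; lra). apply Rpower_1. lra. }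
assert (Hbase : 0 < c * (lam * lam) / th).
{ apply Rdiv_lt_0_compat; [|lra]. repeat apply Rmult_lt_0_compat; trivial. }
set (W := Rpower (c * (lam * lam) / th) (/ (1 - p))).
assert (HW : 0 < W) by apply Rpower_pos.
assert (EW : W = Rpower W p * (c * (lam * lam) / th)).
{ assert (E : Rpower W (1 - p) = c * (lam * lam) / th).
  { unfold W. rewrite Rpower_mult, Rinv_l, Rpower_1 by lra. reflexivity. }
  rewrite <- E, <- Rpower_plus. replace (p + (1 - p)) with 1 by ring.
  rewrite Rpower_1; trivial. }
assert (Hsc : forall x, is_derive (fun t => t / lam) x (/ lam)).
{ intros x. eapply is_derive_eq. auto_derive; trivial. lra. }
assert (Hdom : forall x, x < lam * T -> x / lam < T).
{ intros x Hx. apply Rmult_lt_reg_r with lam; trivial. unfold Rdiv.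
  rewrite Rmult_assoc, Rinv_l by lra. lra. }
exists (fun x => W * y (x / lam)), (fun x => W / lam * d (x / lam)), (lam * T).
split; [nra|]. split; [|split; [|split]].
- intros x Hx. specialize (Hdom x Hx). split.
  + apply Rmult_lt_0_compat; trivial. eapply positive_solution_pos; [exact Hy|trivial].
  + eapply is_derive_eq.
    * apply is_derive_Rscal. apply (is_derive_Rcomp y (fun t => t / lam)).
      apply (proj1 Hy); trivial. apply Hsc.
    * field. lra.
- unfold Rdiv at 2. rewrite Rmult_0_l.
  rewrite (proj2 (proj1 (proj2 (proj2 Hy)) 0 (Rle_refl 0))). apply Rmult_0_r.
- intros x Hx. specialize (Hdom x (proj2 Hx)).
  assert (Hxl : 0 < x / lam) by (apply Rdiv_lt_0_compat; lra).
  destruct (proj2 (proj2 (proj2 Hy)) (x / lam) ltac:(lra)) as [Hpos D2].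
  eapply is_derive_eq.
  + apply is_derive_Rscal. apply (is_derive_Rcomp d (fun t => t / lam)).
    exact D2. apply Hsc.
  + rewrite <- (Rpower_mult_distr W) by trivial.
    assert (Ex : Rpower x sg = Rpower (x / lam) sg * Rpower lam sg).
    { rewrite Rpower_mult_distr by trivial. f_equal. field. lra. }
    rewrite Ex.
    assert (EW2 : c * Rpower W p = W * th / (lam * lam)).
    { rewrite EW at 2. field. lra. }
    replace (c * (Rpower W p * Rpower (y (x / lam)) p))
      with ((c * Rpower W p) * Rpower (y (x / lam)) p) by ring.
    rewrite EW2, <- Elam.
    set (A := Rpower (x / lam) sg). set (B := Rpower lam sg).
    set (Y := Rpower (y (x / lam)) p). field. lra.
- intros e He.
  set (e' := Rmin (e / W) (e * lam / W)).
  assert (He' : 0 < e') by (apply Rmin_pos; apply Rdiv_lt_0_compat; nra).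
  assert (L1 : e' <= e / W) by apply Rmin_l. assert (L2 : e' <= e * lam / W) by apply Rmin_r.
  destruct (Hlim e' He') as [x1 [Hx1 H1]].
  exists (lam * x1). split; [nra|]. intros x Hx.
  assert (Hxr : x1 <= x / lam < T).
  { split; [|apply Hdom; lra]. apply Rmult_le_reg_r with lam; trivial. unfold Rdiv.
    rewrite Rmult_assoc, Rinv_l by lra. lra. }
  destruct (H1 _ Hxr) as [H2 H3]. split.
  + apply Rlt_le_trans with (W * (e / W)); [apply Rmult_lt_compat_l; lra|].
    right. field. lra.
  + assert (HWl : 0 < W / lam) by (apply Rdiv_lt_0_compat; lra).
    rewrite Rabs_mult, (Rabs_pos_eq (W / lam)) by lra.
    apply Rlt_le_trans with (W / lam * (e * lam / W)); [apply Rmult_lt_compat_l; lra|].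
    right. field. lra.
Qed.

Lemma is_derive_right (g : R -> R) (x l : R) : is_derive g x l -> is_right_derive g x l.
Proof.
intros H. apply is_derive_Reals in H. unfold is_right_derive.
apply filterlim_locally. intros eps.
destruct (H eps (cond_pos eps)) as [del Hdel].
exists del. intros t Ht Hxt. unfold ball in Ht |- *; simpl in Ht |- *.
unfold AbsRing_ball, abs, minus, plus, opp in *; simpl in *.
specialize (Hdel (t - x) ltac:(lra) Ht). replace (x + (t - x)) with t in Hdel by ring.
exact Hdel.
Qed.

(** Every term of the right-hand side tends to [0] with [w] and [dw], as [n / x] is bounded near
    [T > 0]. This lets [dw] be extended differentiably by zero, so that the equation holds at the
    interface as well. *)
Lemma second_derivative_vanishes (n : nat) (p sg c : R) (w dw : R -> R) (T : R) :
  0 < p -> 0 <= sg -> 0 < c -> 0 < T -> (forall x, x < T -> 0 < w x) ->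
  (forall e, 0 < e -> exists x1, 0 < x1 < T /\
      forall x, x1 <= x < T -> w x < e /\ Rabs (dw x) < e) ->
  forall e, 0 < e -> exists x1, x1 < T /\ forall x, x1 <= x < T ->
    Rabs (c * Rpower (w x) p - Rpower x sg * w x - INR n / x * dw x) < e.
Proof.
intros Hp Hsg Hc HT Hw Hlim e He.
pose proof (Rpower_pos T sg) as HB. set (B := Rpower T sg) in *.
pose proof (pos_INR n) as Hn.
set (e1 := Rpower (e / (4 * c)) (/ p)). assert (He1 : 0 < e1) by apply Rpower_pos.
assert (Ee1 : Rpower e1 p = e / (4 * c)).
{ unfold e1. rewrite Rpower_mult, Rinv_l, Rpower_1; try lra. apply Rdiv_lt_0_compat; lra. }
set (D := INR n * 2 / T + 1).
assert (HD0 : 0 <= INR n * 2 / T) by (apply Rdiv_le_0_compat; lra).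
assert (HD : 0 < D) by (unfold D; lra).
set (e2 := Rmin e1 (Rmin (e / (4 * B)) (e / (4 * D)))).
assert (He2 : 0 < e2) by (repeat apply Rmin_pos; trivial; apply Rdiv_lt_0_compat; lra).
assert (L1 : e2 <= e1) by apply Rmin_l.
assert (L2 : e2 <= e / (4 * B)) by (eapply Rle_trans; [apply Rmin_r|apply Rmin_l]).
assert (L3 : e2 <= e / (4 * D)) by (eapply Rle_trans; [apply Rmin_r|apply Rmin_r]).
destruct (Hlim e2 He2) as [x1 [Hx1 H1]].
pose proof (Rmax_l x1 (T / 2)). pose proof (Rmax_r x1 (T / 2)).
exists (Rmax x1 (T / 2)). split; [apply Rmax_lub_lt; lra|].
intros x Hx. destruct (H1 x ltac:(lra)) as [H2 H3]. specialize (Hw x (proj2 Hx)).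
assert (A1 : 0 < c * Rpower (w x) p <= e / 4).
{ pose proof (Rpower_pos (w x) p). split; [nra|].
  replace (e / 4) with (c * Rpower e1 p) by (rewrite Ee1; field; lra).
  apply Rmult_le_compat_l; [lra|]. apply Rle_Rpower_l; lra. }
assert (A2 : 0 < Rpower x sg * w x <= e / 4).
{ pose proof (Rpower_pos x sg). split; [nra|].
  apply Rle_trans with (B * (e / (4 * B))); [|right; field; lra].
  apply Rmult_le_compat; try lra. apply Rle_Rpower_l; lra. }
assert (A3 : Rabs (INR n / x * dw x) <= e / 4).
{ assert (Hnx : 0 <= INR n / x <= D).
  { split; [apply Rdiv_le_0_compat; lra|]. apply Rle_trans with (INR n * 2 / T); [|unfold D; lra].
    unfold Rdiv at 2. rewrite Rmult_assoc. apply Rmult_le_compat_l; trivial.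
    replace (2 * / T) with (/ (T / 2)) by (field; lra). apply Rinv_le_contravar; lra. }
  rewrite Rabs_mult, (Rabs_pos_eq (INR n / x)) by lra.
  apply Rle_trans with (D * (e / (4 * D))); [|right; field; lra].
  pose proof (Rabs_pos (dw x)). apply Rmult_le_compat; lra. }
apply Rabs_le_between in A3. apply Rabs_def1; lra.
Qed.

Lemma profile_exists (n : nat) (m sg : R) :
  1 < m -> 1 <= INR n <= 2 -> 0 <= sg <= 2 * expo_t (INR n) (/ m) ->
  exists f eta, good_profile_with_interface (S n) m sg f 0 eta.
Proof.
intros Hm Hn Hsg.
assert (Hp : 0 < / m < 1).
{ split; [apply Rinv_0_lt_compat; lra|]. rewrite <- Rinv_1. apply Rinv_lt_contravar; lra. }
set (c := 1 / (m - 1)). assert (Hc : 0 < c) by (apply Rdiv_lt_0_compat; lra).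
destruct (compact_profile n (/ m) sg c Hn Hp Hsg Hc)
  as [w [dw [T [HT [Hw [Hdw0 [Hdw Hlim]]]]]]].
set (f := fun x => if Rlt_dec x T then Rpower (w x) (/ m) else 0).
set (w' := fun x => if Rlt_dec x T then w x else 0).
set (dw' := fun x => if Rlt_dec x T then dw x else 0).
set (ddw := fun x => c * Rpower (w x) (/ m) - Rpower x sg * w x - INR n / x * dw x).
set (ddw' := fun x => if Rlt_dec x T then ddw x else 0).
assert (Ew : forall x, w' x = fpow m f x).
{ intros x. unfold w', fpow, f. destruct (Rlt_dec x T) as [Hx|Hx].
  - destruct (Rlt_dec 0 (Rpower (w x) (/ m))) as [H|H].
    + rewrite Rpower_mult, Rinv_l, Rpower_1 by first [lra | apply Hw; trivial]. reflexivity.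
    + exfalso. apply H, Rpower_pos.
  - destruct (Rlt_dec 0 0); lra. }
assert (Hlim1 : forall e, 0 < e -> exists x1, x1 < T /\ forall x, x1 <= x < T -> Rabs (w x) < e).
{ intros e He. destruct (Hlim e He) as [x1 [Hx1 H1]]. exists x1. split; [lra|].
  intros x Hx. destruct (Hw x (proj2 Hx)) as [Hpos _]. rewrite Rabs_pos_eq by lra.
  apply H1; trivial. }
assert (Hlim2 : forall e, 0 < e -> exists x1, x1 < T /\ forall x, x1 <= x < T -> Rabs (dw x) < e).
{ intros e He. destruct (Hlim e He) as [x1 [Hx1 H1]]. exists x1. split; [lra|].
  intros x Hx. apply H1; trivial. }
assert (D1 : forall x, is_derive w' x (dw' x)).
{ intros x. apply is_derive_cutoff.
  - intros Hx. apply Hw; trivial.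
  - intros _. apply (is_derive_zero_extension w dw); trivial.
    exists 0. split; trivial. intros t Ht. apply Hw. lra. }
assert (D2 : forall x, 0 < x -> is_derive dw' x (ddw' x)).
{ intros x Hx0. apply is_derive_cutoff.
  - intros Hx. apply Hdw. lra.
  - intros _. apply (is_derive_zero_extension dw ddw); trivial.
    + exists 0. split; trivial.
    + apply (second_derivative_vanishes n (/ m) sg c w dw T); trivial; try lra.
      intros t Ht. apply Hw; trivial. }
assert (F1 : forall x, is_derive (fpow m f) x (dw' x)).
{ intros x. apply is_derive_ext with w'; [exact Ew|apply D1]. }
assert (F2 : forall x, Derive (fpow m f) x = dw' x).
{ intros x. apply is_derive_unique, F1. }
assert (F3 : forall x, 0 < x -> is_derive (Derive (fpow m f)) x (ddw' x)).
{ intros x Hx. apply is_derive_ext with dw'; [|apply D2; trivial].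
  intros t. symmetry. apply F2. }
assert (HfT : f T = 0).
{ unfold f. destruct (Rlt_dec T T); [lra|reflexivity]. }
assert (Hfpos : forall x, x < T -> 0 < f x).
{ intros x Hx. unfold f. destruct (Rlt_dec x T); [apply Rpower_pos|lra]. }
exists f, T. split; [split; [split|]|split; [split; [|split; [|split]]|split]]; trivial.
- intros x _. unfold f. destruct (Rlt_dec x T); [left; apply Rpower_pos|lra].
- intros x Hx. split; [eexists; apply F1|]. split; [eexists; apply F3; trivial|].
  rewrite (is_derive_unique _ _ _ (F3 x Hx)), F2, <- Ew, S_INR.
  unfold ddw', dw', w', f. destruct (Rlt_dec x T).
  + unfold ddw, c. field. lra.
  + field. lra.
- left. split; trivial. split; [apply Hfpos; trivial|].
  apply is_derive_right.
  (* [w] is positive and differentiable on both sides of [0], so the chain rule applies and the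
     slope vanishes with [dw 0]. *)
  apply is_derive_ext_loc with (fun x => Rpower (w x) (/ m)).
  { apply (locally_between _ (- 1) T); [lra|]. intros t Ht. unfold f.
    destruct (Rlt_dec t T); [reflexivity|lra]. }
  destruct (Hw 0 HT) as [Hw0 Dw0]. eapply is_derive_eq.
  + apply (is_derive_Rcomp (fun u => Rpower u (/ m)) w); [|exact Dw0].
    apply is_derive_Rpower; trivial.
  + rewrite Hdw0. ring.
- eapply is_derive_eq; [apply F1|]. unfold dw'. destruct (Rlt_dec T T); [lra|reflexivity].
- unfold at_left, within. apply filter_forall. intros t Ht. apply Hfpos; trivial.
- intros x Hx. apply Hfpos. lra.
Qed.

(** On [(s, eta)] the function [f ^ m] solves the equation of the energy argument with
    [c = 1 / (m - 1)]. P2 and P3 each supply points of arbitrarily small energy near [s], which the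
    interface at [eta] forbids. *)
Lemma profile_is_P1 (n : nat) (m sg : R) (f : R -> R) (s eta : R) :
  1 < m -> 1 <= INR n <= 2 -> 0 <= sg <= 2 * expo_t (INR n) (/ m) ->
  good_profile_with_interface (S n) m sg f s eta -> s = 0 /\ P1 f.
Proof.
intros Hm Hn Hsg [[[Hf0 Hode] Hstart] [[Heta [Hfe [Hde _]]] [Hse Hpos]]].
assert (Hp : 0 < / m < 1).
{ split; [apply Rinv_0_lt_compat; lra|]. rewrite <- Rinv_1. apply Rinv_lt_contravar; lra. }
set (c := 1 / (m - 1)). assert (Hc : 0 < c) by (apply Rdiv_lt_0_compat; lra).
set (w := fpow m f). set (dw := Derive w).
assert (Hw0 : forall x, f x = 0 -> w x = 0).
{ intros x Hx. unfold w, fpow. rewrite Hx. destruct (Rlt_dec 0 0); lra. }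
assert (Hs0 : 0 <= s).
{ destruct Hstart as [[-> _]|[[-> _]|[H _]]]; lra. }
assert (Hw : forall x, s < x < eta -> 0 < w x /\ is_derive w x (dw x) /\
   is_derive dw x (c * Rpower (w x) (/ m) - 1 * (Rpower x sg * w x) - INR n / x * dw x)).
{ intros x Hx. destruct (Hode x ltac:(lra)) as [E1 [E2 E3]]. fold w dw in E1, E2, E3.
  specialize (Hpos x Hx).
  assert (Ewx : w x = Rpower (f x) m).
  { unfold w, fpow. destruct (Rlt_dec 0 (f x)); [reflexivity|lra]. }
  assert (Ef : Rpower (w x) (/ m) = f x).
  { rewrite Ewx, Rpower_mult, Rinv_r, Rpower_1 by lra. reflexivity. }
  split; [rewrite Ewx; apply Rpower_pos|]. split; [apply Derive_correct; trivial|].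
  eapply is_derive_eq; [apply Derive_correct; exact E2|].
  rewrite Ef. rewrite S_INR in E3. unfold c. unfold Rdiv in *. lra. }
assert (Hcont : continuous w eta) by (eapply is_derive_continuous; exact Hde).
assert (Habs : (forall e x1, 0 < e -> s < x1 < eta ->
    exists x, s < x < x1 /\ profile_energy (INR n) (/ m) sg c w dw x < e) -> False).
{ apply (double_interface_absurd (INR n) (/ m) sg c w dw s eta); trivial; try lra.
  apply Hw0; trivial. }
destruct Hstart as [[-> H]|[[-> [Hf00 Hr]]|[Hs [Hfs [Hds _]]]]].
- split; trivial.
- exfalso. apply Habs.
  apply (left_energy_origin (INR n) (/ m) sg c w dw 0 eta); trivial; try lra.
  (* As [w 0 = 0], the right difference quotient in P2 is [w x / x] itself. *)
  intros e He. destruct ((proj1 (filterlim_locally _ _) Hr) (mkposreal e He)) as [del Hdel].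
  exists del. split; [apply cond_pos|]. intros x Hx.
  assert (Hb : ball 0 del x).
  { unfold ball; simpl. unfold AbsRing_ball, abs, minus, plus, opp; simpl.
    rewrite Ropp_0, Rplus_0_r, Rabs_pos_eq; lra. }
  specialize (Hdel x Hb ltac:(lra)). unfold ball in Hdel; simpl in Hdel.
  unfold AbsRing_ball, abs, minus, plus, opp in Hdel; simpl in Hdel.
  fold w in Hdel. rewrite (Hw0 0 Hf00), !Ropp_0, Rplus_0_r in Hdel.
  unfold Rminus in Hdel. rewrite !Ropp_0, !Rplus_0_r in Hdel. exact Hdel.
- exfalso. apply Habs.
  destruct (Hode s Hs) as [_ [E2 _]].
  apply (left_energy_interior (INR n) (/ m) sg c w dw s eta); trivial; try lra.
  + apply Hw0; trivial.
  + apply is_derive_unique; exact Hds.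
  + eapply is_derive_continuous; exact Hds.
  + apply (ex_derive_continuous dw); exact E2.
Qed.

Lemma sigma_c_expo_t (n : nat) (m : R) :
  1 < m -> sigma_c (S n) m = 2 * expo_t (INR n) (/ m).
Proof. intros Hm. unfold sigma_c, expo_t. rewrite S_INR. field. lra. Qed.

Theorem theorem1p4 :
  forall (m : R) (N : nat) (sigma : R),
    1 < m -> (N = 2%nat \/ N = 3%nat) -> 0 <= sigma <= sigma_c N m ->
    (exists (f : R -> R) (s eta : R),
        good_profile_with_interface N m sigma f s eta) /\
    (forall (f : R -> R) (s eta : R),
        good_profile_with_interface N m sigma f s eta -> s = 0 /\ P1 f).
Proof.
intros m N sigma Hm HN Hs.
assert (Hn : exists n, N = S n /\ 1 <= INR n <= 2).
{ destruct HN as [->| ->]; [exists 1%nat|exists 2%nat]; (split; [reflexivity|simpl; lra]). }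
destruct Hn as [n [-> Hn]]. rewrite sigma_c_expo_t in Hs by trivial. split.
- destruct (profile_exists n m sigma Hm Hn Hs) as [f [eta Hf]].
  exists f, 0, eta. exact Hf.
- intros f s eta Hf. apply (profile_is_P1 n m sigma f s eta); trivial.
Qed.
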